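(* Let $d\ge 1$ be fixed and let $m_n\to\infty$ as $n\to\infty$. Let $X_n\in\mathbb{R}^{n\times d}$, $y_n\in\mathbb{R}^n$ be deterministic, $\lambda_n>0$, and let $H_n,g_n,A_n,\beta_n$, the sketch rows $s_{n,i}$, compressed rows $(z_{n,i},u_{n,i})$, influence vectors $\psi_{n,i}$, and the distribution functions $F_{n,m_n}$, $\widehat F_{n,m_n}$, $\widehat F_{n,m_n,B_n}$ be as defined in the context. Assume: (i) as $n\to\infty$, $\lambda_n\to\lambda_\infty\ge 0$, $H_n\to H$, $g_n\to g$ (finite limits), and there is $c_0>0$ with $\lambda_{\min}(H_n+\lambda_n I_d)\ge c_0$ for all sufficiently large $n$; (ii) for every $n$, $s_{n,1},\dots,s_{n,m_n}$ are i.i.d. with $\mathbb{E}(s_{n,1}s_{n,1}^\top)=I_n$; $$\sup_n \mathbb{E}\Big[\|z_{n,1}z_{n,1}^\top-H_n\|_{\mathrm F}^4+\|z_{n,1}u_{n,1}-g_n\|_2^4\Big]<\infty;$$ and there is a finite matrix $\Omega\in\mathbb{R}^{d\times d}$ such that $\Omega_n:=\mathbb{E}(\psi_{n,1}\psi_{n,1}^\top)\to\Omega$; (iii) $\operatorname{rank}(\Omega)\ge1$. Then $$\sup_{t\in\mathbb{R}}|F_{n,m_n}(t)-\widehat F_{n,m_n}(t)|\to0\quad\text{in probability}.$$ If, in addition, $B_n\to\infty$, then $$\sup_{t\in\mathbb{R}}|F_{n,m_n}(t)-\widehat F_{n,m_n,B_n}(t)|\to0\quad\text{in probability}.$$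
   Context: All limits are along one sequence $n\to\infty$ with $d$ fixed. Define $H_n:=\frac1n X_n^\top X_n$, $g_n:=\frac1n X_n^\top y_n$, $A_n:=(H_n+\lambda_n I_d)^{-1}$, $\beta_n:=A_ng_n$ (the minimizer over $\beta\in\mathbb{R}^d$ of $\frac1n\|X_n\beta-y_n\|_2^2+\lambda_n\|\beta\|_2^2$). For random sketch rows $s_{n,1},\dots,s_{n,m}\in\mathbb{R}^n$ define $z_{n,i}:=n^{-1/2}X_n^\top s_{n,i}\in\mathbb{R}^d$, $u_{n,i}:=n^{-1/2}y_n^\top s_{n,i}\in\mathbb{R}$, $\widehat H_{n,m}:=\frac1m\sum_{i=1}^m z_{n,i}z_{n,i}^\top$, $\widehat g_{n,m}:=\frac1m\sum_{i=1}^m z_{n,i}u_{n,i}$, and the sketched estimator $\widehat\beta_{n,m}:=(\widehat H_{n,m}+\lambda_nI_d)^{-1}\widehat g_{n,m}$. The influence vectors are $\psi_{n,i}:=A_n\{z_{n,i}(u_{n,i}-z_{n,i}^\top\beta_n)-\lambda_n\beta_n\}$, which have mean zero when the rows are isotropic. Bootstrap: conditionally on the sketch, draw independent weight vectors $w_b=(w_{b,1},\dots,w_{b,m})\sim\mathrm{Multinomial}(m;\frac1m,\dots,\frac1m)$, $b=1,\dots,B$, and set $\widehat H^*_{n,m,b}:=\frac1m\sum_i w_{b,i}z_{n,i}z_{n,i}^\top$, $\widehat g^*_{n,m,b}:=\frac1m\sum_i w_{b,i}z_{n,i}u_{n,i}$, $\widehat\beta^*_{n,m,b}:=(\widehat H^*_{n,m,b}+\lambda_nI_d)^{-1}\widehat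 g^*_{n,m,b}$, $e^*_{n,m,b}:=\|\widehat\beta^*_{n,m,b}-\widehat\beta_{n,m}\|_2$. Let $\mathbb{P}^*$ denote conditional probability given $\sigma(s_{n,1},\dots,s_{n,m_n})$. Define $$F_{n,m_n}(t):=\mathbb{P}\{\sqrt{m_n}\|\widehat\beta_{n,m_n}-\beta_n\|_2\le t\},\qquad \widehat F_{n,m_n}(t):=\mathbb{P}^*\{\sqrt{m_n}\|\widehat\beta^*_{n,m_n,1}-\widehat\beta_{n,m_n}\|_2\le t\},$$ $$\widehat F_{n,m_n,B_n}(t):=\frac1{B_n}\sum_{b=1}^{B_n}\mathbf{1}\{\sqrt{m_n}\,e^*_{n,m_n,b}\le t\},$$ where $B_n$ is the (positive integer) number of bootstrap draws. $\|\cdot\|_{\mathrm F}$ is the Frobenius norm and $\lambda_{\min}$ the smallest eigenvalue. *)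

(* Defs.v *)
From HB Require Import structures.
From mathcomp Require Import all_boot all_order all_algebra.
From mathcomp Require Import all_classical all_reals all_analysis.
From mathcomp Require Import measurable_realfun.

Set Implicit Arguments.
Unset Strict Implicit.
Unset Printing Implicit Defensive.

Import Order.TTheory GRing.Theory Num.Theory.
Import numFieldNormedType.Exports.

Local Open Scope classical_set_scope.
Local Open Scope ring_scope.

(* On column vectors this is the Euclidean norm; the library's [`|M|] on
   matrices is the maximum norm. *)
Definition frobenius (R : realType) (p q : nat) (M : 'M[R]_(p, q)) : R :=
  Num.sqrt (\sum_i \sum_j M i j ^+ 2).

(* Only used for symmetric matrices of positive size, whose set of eigenvalues
   is finite and nonempty, so that the infimum is a minimum. *)
Definition lambda_min (R : realType) (d : nat) (M : 'M[R]_d) : R :=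
  inf [set a | eigenvalue M a].

(* Random vectors are tuple-valued because tuples carry the product
   (= Borel) sigma-algebra. *)
Definition cvec (R : realType) (n : nat) (t : n.-tuple R) : 'cV[R]_n :=
  \col_j tnth t j.

Definition ridgeH (R : realType) (n d : nat) (X : 'M[R]_(n, d)) : 'M[R]_d :=
  n%:R^-1 *: (X^T *m X).

Definition ridgeg (R : realType) (n d : nat) (X : 'M[R]_(n, d))
    (y : 'cV[R]_n) : 'cV[R]_d :=
  n%:R^-1 *: (X^T *m y).

Definition ridgeA (R : realType) (n d : nat) (X : 'M[R]_(n, d)) (lam : R) :
    'M[R]_d :=
  invmx (ridgeH X + lam%:M).

Definition ridge_beta (R : realType) (n d : nat) (X : 'M[R]_(n, d))
    (y : 'cV[R]_n) (lam : R) : 'cV[R]_d :=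
  ridgeA X lam *m ridgeg X y.

Definition zrow (R : realType) (n d : nat) (X : 'M[R]_(n, d)) (s : 'cV[R]_n) :
    'cV[R]_d :=
  (Num.sqrt n%:R)^-1 *: (X^T *m s).

Definition urow (R : realType) (n : nat) (y s : 'cV[R]_n) : R :=
  (Num.sqrt n%:R)^-1 * (y^T *m s) 0 0.

Definition sketchH (R : realType) (n d m : nat) (X : 'M[R]_(n, d))
    (s : 'I_m -> 'cV[R]_n) : 'M[R]_d :=
  m%:R^-1 *: \sum_i zrow X (s i) *m (zrow X (s i))^T.

Definition sketchg (R : realType) (n d m : nat) (X : 'M[R]_(n, d))
    (y : 'cV[R]_n) (s : 'I_m -> 'cV[R]_n) : 'cV[R]_d :=
  m%:R^-1 *: \sum_i urow y (s i) *: zrow X (s i).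

Definition sketch_beta (R : realType) (n d m : nat) (X : 'M[R]_(n, d))
    (y : 'cV[R]_n) (lam : R) (s : 'I_m -> 'cV[R]_n) : 'cV[R]_d :=
  invmx (sketchH X s + lam%:M) *m sketchg X y s.

Definition influence (R : realType) (n d : nat) (X : 'M[R]_(n, d))
    (y : 'cV[R]_n) (lam : R) (s : 'cV[R]_n) : 'cV[R]_d :=
  let z := zrow X s in
  let beta := ridge_beta X y lam in
  ridgeA X lam *m ((urow y s - (z^T *m beta) 0 0) *: z - lam *: beta).

Definition bootH (R : realType) (n d m : nat) (X : 'M[R]_(n, d))
    (s : 'I_m -> 'cV[R]_n) (w : m.-tuple nat) : 'M[R]_d :=
  m%:R^-1 *: \sum_i (tnth w i)%:R *: (zrow X (s i) *m (zrow X (s i))^T).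

Definition bootg (R : realType) (n d m : nat) (X : 'M[R]_(n, d))
    (y : 'cV[R]_n) (s : 'I_m -> 'cV[R]_n) (w : m.-tuple nat) : 'cV[R]_d :=
  m%:R^-1 *: \sum_i ((tnth w i)%:R * urow y (s i)) *: zrow X (s i).

Definition boot_beta (R : realType) (n d m : nat) (X : 'M[R]_(n, d))
    (y : 'cV[R]_n) (lam : R) (s : 'I_m -> 'cV[R]_n) (w : m.-tuple nat) :
    'cV[R]_d :=
  invmx (bootH X s w + lam%:M) *m bootg X y s w.

Definition sketch_err (R : realType) (n d m : nat) (X : 'M[R]_(n, d))
    (y : 'cV[R]_n) (lam : R) (s : 'I_m -> 'cV[R]_n) : R :=
  Num.sqrt m%:R * frobenius (sketch_beta X y lam s - ridge_beta X y lam).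

Definition boot_err (R : realType) (n d m : nat) (X : 'M[R]_(n, d))
    (y : 'cV[R]_n) (lam : R) (s : 'I_m -> 'cV[R]_n) (w : m.-tuple nat) : R :=
  Num.sqrt m%:R * frobenius (boot_beta X y lam s w - sketch_beta X y lam s).

(* Entrywise expectation. [fine] sends an infinite expectation to 0; in the
   places where this is used the entries are integrable: for E(s s^T) = I the
   diagonal equations force square-integrability, and for E(psi psi^T) it
   follows from the fourth-moment bound. *)
Definition mx_expectation (disp : measure_display) (T : measurableType disp)
    (R : realType) (P : probability T R) (p q : nat) (M : T -> 'M[R]_(p, q)) :
    'M[R]_(p, q) :=
  \matrix_(i, j) fine 'E_P[fun x => M x i j].

Definition mutually_independent (disp disp' : measure_display)
    (T : measurableType disp) (T' : measurableType disp') (R : realType)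
    (P : probability T R) (I : finType) (X : I -> T -> T') : Prop :=
  forall A : I -> set T', (forall i, measurable (A i)) ->
    P (\bigcap_i (X i @^-1` A i)) = (\prod_i P (X i @^-1` A i))%E.

Definition identically_distributed (disp disp' : measure_display)
    (T : measurableType disp) (T' : measurableType disp') (R : realType)
    (P : probability T R) (I : finType) (X : I -> T -> T') : Prop :=
  forall (i j : I) (A : set T'), measurable A ->
    P (X i @^-1` A) = P (X j @^-1` A).

(* [f] is a version of the conditional probability P(E | G). *)
Definition is_cond_prob (disp : measure_display) (T : measurableType disp)
    (R : realType) (P : probability T R) (G : set (set T)) (E : set T)
    (f : T -> \bar R) : Prop :=
  (forall A : set (\bar R), measurable A -> G (f @^-1` A)) /\
  (forall C : set T, G C -> (\int[P]_(x in C) f x = P (E `&` C))%E).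

(* [k] is a regular conditional distribution of the real random variable [Y]
   given the sub-sigma-algebra [G]. *)
Definition is_cond_distribution (disp : measure_display)
    (T : measurableType disp) (R : realType) (P : probability T R)
    (G : set (set T)) (Y : T -> R) (k : R.-pker T ~> R) : Prop :=
  forall A : set R, measurable A ->
    is_cond_prob P G (Y @^-1` A) (fun x => k x A).

Definition multinomial_pmf (R : realType) (N m : nat) (p : 'I_m -> R)
    (k : m.-tuple nat) : R :=
  if (\sum_i tnth k i == N)%N then
    N`!%:R / \prod_i (tnth k i)`!%:R * \prod_i p i ^+ tnth k i
  else 0.

(* [w_b], [b : 'I_B], are, conditionally on the sigma-algebra [G], independent
   with distribution Multinomial(m; 1/m, ..., 1/m). *)
Definition bootstrap_weights (disp : measure_display)
    (T : measurableType disp) (R : realType) (P : probability T R)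
    (G : set (set T)) (m B : nat) (w : 'I_B -> T -> m.-tuple nat) : Prop :=
  forall k : 'I_B -> m.-tuple nat,
    is_cond_prob P G [set x | forall b, w b x = k b]
      (fun=> (\prod_b multinomial_pmf m (fun=> m%:R^-1 : R) (k b))%:E).

(* The random variables may live on a different probability space for each
   index. *)
Definition cvg_in_prob (disp : nat -> measure_display)
    (T : forall n, measurableType (disp n)) (R : realType)
    (P : forall n, probability (T n) R) (Z : forall n, T n -> R) (c : R) :
    Prop :=
  forall eps : R, 0 < eps ->
    P n [set x | eps < `|Z n x - c|] @[n --> \oo] --> 0%E.

Definition sup_dist (R : realType) (F G : R -> R) : R :=
  sup (range (fun t => `|F t - G t|)).

Definition cdf_sketch (disp : measure_display) (T : measurableType disp)
    (R : realType) (P : probability T R) (n d m : nat) (X : 'M[R]_(n, d))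
    (y : 'cV[R]_n) (lam : R) (s : 'I_m -> T -> n.-tuple R) (t : R) : R :=
  fine (P [set x | sketch_err X y lam (fun i => cvec (s i x)) <= t]).

Definition cdf_boot_emp (disp : measure_display) (T : measurableType disp)
    (R : realType) (n d m B : nat) (X : 'M[R]_(n, d)) (y : 'cV[R]_n) (lam : R)
    (s : 'I_m -> T -> n.-tuple R) (w : 'I_B -> T -> m.-tuple nat)
    (x : T) (t : R) : R :=
  B%:R^-1 *
  \sum_b (boot_err X y lam (fun i => cvec (s i x)) (w b x) <= t)%R%:R.

(* Main.v *)
Require Import Defs.
From HB Require Import structures.
From mathcomp Require Import all_boot all_order all_algebra.
From mathcomp Require Import all_classical all_reals all_analysis.
From mathcomp Require Import measurable_realfun.
From mathcomp Require Import ring lra zify.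

Set Implicit Arguments.
Unset Strict Implicit.
Unset Printing Implicit Defensive.

Import Order.TTheory GRing.Theory Num.Theory.
Import numFieldNormedType.Exports.

Local Open Scope classical_set_scope.
Local Open Scope ring_scope.

(** Neither law is compared with its Gaussian limit; both are compared with one
    random walk.  Write [Omega = L L^T] and let [S_m] be [m^(-1/2)] times the sum
    of [m] independent copies of [L eps], with [eps] a uniform vector of signs.
    To first order [sqrt m (beta^ - beta)] is the normalized sum of the influence
    vectors, and the bootstrap error is the same sum recentered and reweighted by
    multinomial counts, that is, a normalized sum of [m] uniform draws from the
    observed influence vectors.  Lindeberg's swapping of summands, applied to
    smoothed indicators of balls, brings both sums close in law to [S_m], because
    the covariances agree in the limit.  Removing the smoothing requires
    anti-concentration of [|S_m|]: this is where [rank Omega >= 1] enters, since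
    a nonzero column of [L] gives a binomial walk with atoms of mass
    [O(m^(-1/2))].  Monotonicity upgrades closeness on a finite grid to uniform
    closeness, and the empirical distribution of the bootstrap draws is handled
    by Chebyshev's inequality. *)

(** * Frobenius norm and quadratic forms *)

(** With the walk in place of a Gaussian vector, tails and boundary mass of balls are finite
    computations: a second moment equal to the trace of [Omega] for every [m], and a bound on
    central binomial coefficients. The price is that the walk has atoms and changes with [m], so
    every estimate carries an [O(m^(-1/2))] term and the grid that yields uniformity is fixed before
    [m].

    The sketch lives on a different probability space for each [n]. All estimates are therefore
    finite-sample inequalities whose constants depend only on the level [t], the smoothing width
    [delta], the factor [L] and the bounds [c0], [M]. The width comes first, because the Taylor
    constant of a smoothed indicator grows as [delta] shrinks; truncation levels and finally the
    sample size are chosen after it. Fourth moments enter twice: they bound the third moments in the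
    Taylor remainder, and they bound the variance of the products whose averages form the empirical
    covariance, so that the bootstrap sees nearly [Omega] with high probability. *)

Section Frobenius.
Variable R : realType.

Lemma cauchy_schwarz (I : finType) (a b : I -> R) :
  (\sum_i a i * b i) ^+ 2 <= (\sum_i a i ^+ 2) * (\sum_i b i ^+ 2).
Proof.
suff : 0 <= \sum_i \sum_j (a i * b j - a j * b i) ^+ 2.
  under eq_bigr do under eq_bigr do rewrite sqrrB.
  under eq_bigr do rewrite big_split sumrB /=.
  rewrite big_split sumrB /=.
  have -> : \sum_i \sum_j (a i * b j) ^+ 2 =
      (\sum_i a i ^+ 2) * (\sum_i b i ^+ 2).
    rewrite big_distrl /=; apply: eq_bigr => i _; rewrite big_distrr /=.
    by apply: eq_bigr => j _; rewrite exprMn.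
  have -> : \sum_i \sum_j (a j * b i) ^+ 2 =
      (\sum_i a i ^+ 2) * (\sum_i b i ^+ 2).
    rewrite mulrC big_distrl /=; apply: eq_bigr => i _; rewrite big_distrr /=.
    by apply: eq_bigr => j _; rewrite exprMn mulrC.
  have -> : \sum_i \sum_j a i * b j * (a j * b i) *+ 2 =
      (\sum_i a i * b i) ^+ 2 *+ 2.
    rewrite -mulr_natr expr2 big_distrl big_distrl /=; apply: eq_bigr => i _.
    rewrite big_distrr big_distrl /=; apply: eq_bigr => j _.
    by rewrite -mulr_natr; ring.
  by lra.
by apply: sumr_ge0 => i _; apply: sumr_ge0 => j _; exact: sqr_ge0.
Qed.

Lemma frobenius_ge0 p q (M : 'M[R]_(p, q)) : 0 <= frobenius M.
Proof. exact: sqrtr_ge0. Qed.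

Lemma sqr_frobenius p q (M : 'M[R]_(p, q)) :
  frobenius M ^+ 2 = \sum_i \sum_j M i j ^+ 2.
Proof.
by rewrite sqr_sqrtr//; apply: sumr_ge0 => i _; apply: sumr_ge0 => j _;
  exact: sqr_ge0.
Qed.

Lemma frobeniusE_pair p q (M : 'M[R]_(p, q)) :
  frobenius M ^+ 2 = \sum_ij M ij.1 ij.2 ^+ 2.
Proof. by rewrite sqr_frobenius pair_big. Qed.

Lemma sqr_frobenius_col d (v : 'cV[R]_d) :
  frobenius v ^+ 2 = \sum_i v i 0 ^+ 2.
Proof. by rewrite sqr_frobenius; apply: eq_bigr => i _; rewrite big_ord1. Qed.

Lemma frobenius0 p q : frobenius (0 : 'M[R]_(p, q)) = 0.
Proof.
apply/eqP; rewrite -(@sqrf_eq0 R) sqr_frobenius big1// => i _.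
by rewrite big1// => j _; rewrite mxE expr0n.
Qed.

Lemma frobeniusZ p q a (M : 'M[R]_(p, q)) :
  frobenius (a *: M) = `|a| * frobenius M.
Proof.
apply/eqP; rewrite -(@eqrXn2 _ 2)// ?mulr_ge0// ?frobenius_ge0//.
rewrite exprMn !sqr_frobenius real_normK ?num_real//; apply/eqP.
rewrite big_distrr; apply: eq_bigr => i _ /=.
by rewrite big_distrr; apply: eq_bigr => j _ /=; rewrite mxE exprMn.
Qed.

Lemma frobeniusN p q (M : 'M[R]_(p, q)) : frobenius (- M) = frobenius M.
Proof. by rewrite -scaleN1r frobeniusZ normrN1 mul1r. Qed.

Lemma frobeniusBC p q (M N : 'M[R]_(p, q)) :
  frobenius (M - N) = frobenius (N - M).
Proof. by rewrite -opprB frobeniusN. Qed.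

Lemma ler_frobeniusD p q (M N : 'M[R]_(p, q)) :
  frobenius (M + N) <= frobenius M + frobenius N.
Proof.
rewrite -(@ler_pXn2r _ 2)// ?nnegrE ?addr_ge0 ?frobenius_ge0//.
have := @cauchy_schwarz _ (fun ij => M ij.1 ij.2) (fun ij => N ij.1 ij.2).
rewrite -!frobeniusE_pair -exprMn => MN.
have {}MN : \sum_ij M ij.1 ij.2 * N ij.1 ij.2 <= frobenius M * frobenius N.
  apply: le_trans (ler_norm _) _.
  rewrite -(@ler_pXn2r _ 2)// ?nnegrE ?mulr_ge0 ?frobenius_ge0//.
  by rewrite real_normK ?num_real.
rewrite sqrrD (frobeniusE_pair (M + N)).
under eq_bigr do rewrite mxE sqrrD.
rewrite !big_split /= -!frobeniusE_pair -[X in _ <= _ + X + _]mulr_natr.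
by lra.
Qed.

Lemma frobenius_sum p q (I : finType) (M : I -> 'M[R]_(p, q)) :
  frobenius (\sum_i M i) <= \sum_i frobenius (M i).
Proof.
elim/big_ind2: _ => [|a b c e ab ce|//]; first by rewrite frobenius0.
by apply: le_trans (ler_frobeniusD _ _) _; exact: lerD.
Qed.

Lemma ler_frobeniusM p q r (M : 'M[R]_(p, q)) (N : 'M[R]_(q, r)) :
  frobenius (M *m N) <= frobenius M * frobenius N.
Proof.
rewrite -(@ler_pXn2r _ 2)// ?nnegrE ?mulr_ge0 ?frobenius_ge0//.
rewrite exprMn !sqr_frobenius big_distrl /=; apply: ler_sum => i _.
rewrite [X in _ * X]exchange_big big_distrr /=; apply: ler_sum => j _.
by rewrite mxE; exact: cauchy_schwarz.
Qed.

Lemma ler_entry_frobenius p q (M : 'M[R]_(p, q)) i j : `|M i j| <= frobenius M.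
Proof.
rewrite -(@ler_pXn2r _ 2)// ?nnegrE ?frobenius_ge0//.
rewrite real_normK ?num_real// sqr_frobenius (bigD1 i)//= (bigD1 j)//=.
rewrite -addrA lerDl addr_ge0//; first by apply: sumr_ge0 => ? _; exact: sqr_ge0.
by apply: sumr_ge0 => ? _; apply: sumr_ge0 => ? _; exact: sqr_ge0.
Qed.

Lemma frobenius_le_sum p q (M : 'M[R]_(p, q)) :
  frobenius M <= \sum_i \sum_j `|M i j|.
Proof.
have S0 : 0 <= \sum_i \sum_j `|M i j|.
  by apply: sumr_ge0 => i _; apply: sumr_ge0.
rewrite -(@ler_pXn2r _ 2)// ?nnegrE ?frobenius_ge0//.
rewrite sqr_frobenius [leRHS]expr2 big_distrl /=; apply: ler_sum => i _.
rewrite big_distrl /=; apply: ler_sum => j _.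
rewrite -real_normK ?num_real// expr2 ler_wpM2l// (bigD1 i)//= (bigD1 j)//=.
rewrite -addrA lerDl addr_ge0//; first by apply: sumr_ge0.
by apply: sumr_ge0 => ? _; apply: sumr_ge0.
Qed.

Lemma frobenius_eq0 p q (M : 'M[R]_(p, q)) : (frobenius M == 0) = (M == 0).
Proof.
apply/eqP/eqP => [M0|->]; last exact: frobenius0.
apply/matrixP => i j; rewrite mxE; apply/eqP; rewrite -normr_le0 -M0.
exact: ler_entry_frobenius.
Qed.

Definition dot d (u v : 'cV[R]_d) : R := \sum_i u i 0 * v i 0.

Definition quad d (M : 'M[R]_d) (v : 'cV[R]_d) : R :=
  \sum_i \sum_j M i j * (v i 0 * v j 0).

Lemma dotC d (u v : 'cV[R]_d) : dot u v = dot v u.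
Proof. by apply: eq_bigr => i _; rewrite mulrC. Qed.

Lemma dot_mx d (u v : 'cV[R]_d) : dot u v = (u^T *m v) 0 0.
Proof. by rewrite mxE; apply: eq_bigr => i _; rewrite mxE. Qed.

Lemma quad_dot d (M : 'M[R]_d) v : quad M v = dot v (M *m v).
Proof.
rewrite /quad /dot; apply: eq_bigr => i _; rewrite mxE big_distrr /=.
by apply: eq_bigr => j _; ring.
Qed.

Lemma dotDl d (u v w : 'cV[R]_d) : dot (u + v) w = dot u w + dot v w.
Proof. by rewrite -big_split /=; apply: eq_bigr => i _; rewrite mxE mulrDl. Qed.

Lemma dotZl d a (u v : 'cV[R]_d) : dot (a *: u) v = a * dot u v.
Proof. by rewrite /dot big_distrr /=; apply: eq_bigr => i _; rewrite mxE mulrA. Qed.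

Lemma dotDr d (u v w : 'cV[R]_d) : dot w (u + v) = dot w u + dot w v.
Proof. by rewrite dotC dotDl !(dotC w). Qed.

Lemma dotZr d a (u v : 'cV[R]_d) : dot u (a *: v) = a * dot u v.
Proof. by rewrite dotC dotZl dotC. Qed.

Lemma dotvv d (v : 'cV[R]_d) : dot v v = frobenius v ^+ 2.
Proof. by rewrite sqr_frobenius_col. Qed.

Lemma ler_dot d (u v : 'cV[R]_d) : `|dot u v| <= frobenius u * frobenius v.
Proof.
rewrite -(@ler_pXn2r _ 2)// ?nnegrE ?mulr_ge0 ?frobenius_ge0//.
rewrite real_normK ?num_real// exprMn !sqr_frobenius_col.
exact: cauchy_schwarz.
Qed.

Lemma sqr_frobeniusD d (u v : 'cV[R]_d) :
  frobenius (u + v) ^+ 2 = frobenius u ^+ 2 + 2 * dot u v + frobenius v ^+ 2.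
Proof. by rewrite -!dotvv dotDl !dotDr (dotC v u); lra. Qed.

Lemma quadD d (M N : 'M[R]_d) v : quad (M + N) v = quad M v + quad N v.
Proof. by rewrite !quad_dot mulmxDl dotDr. Qed.

Lemma quadN d (M : 'M[R]_d) v : quad (- M) v = - quad M v.
Proof. by rewrite !quad_dot mulNmx -scaleN1r dotZr mulN1r. Qed.

Lemma quad_scalar d a (v : 'cV[R]_d) : quad a%:M v = a * frobenius v ^+ 2.
Proof. by rewrite quad_dot mul_scalar_mx dotZr dotvv. Qed.

Lemma ler_quad d (M : 'M[R]_d) v : `|quad M v| <= frobenius M * frobenius v ^+ 2.
Proof.
rewrite quad_dot; apply: le_trans (ler_dot _ _) _.
rewrite expr2 mulrA mulrC ler_wpM2r ?frobenius_ge0//.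
exact: ler_frobeniusM.
Qed.

End Frobenius.

(** * Coercivity, positive semidefinite matrices and their factorization *)

Section Coercive.
Variable R : realType.

Definition coercive d (c : R) (K : 'M[R]_d) : Prop :=
  forall x, c * frobenius x ^+ 2 <= quad K x.

Lemma quad_mx d (K : 'M[R]_d) x : quad K x = (x^T *m K *m x) 0 0.
Proof. by rewrite quad_dot dot_mx mulmxA. Qed.

Lemma coercive_unit d c (K : 'M[R]_d) : 0 < c -> coercive c K -> K \in unitmx.
Proof.
move=> c0 cK; rewrite -row_free_unit -kermx_eq0; apply/negPn/negP => /rowV0Pn[v].
move/sub_kermxP => vK; apply/negP; rewrite negbK.
have := cK v^T; rewrite quad_mx trmxK vK mul0mx mxE.
rewrite pmulr_rle0// -[v == 0](inj_eq (@trmx_inj _ _ _)) trmx0 -frobenius_eq0.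
by rewrite -sqrf_eq0 eq_le sqr_ge0 andbT.
Qed.

Lemma coercive_inv d c (K : 'M[R]_d) (v : 'cV[R]_d) : 0 < c -> coercive c K ->
  frobenius (invmx K *m v) <= c^-1 * frobenius v.
Proof.
move=> c0 cK; have Ku := coercive_unit c0 cK.
set x := invmx K *m v; have -> : v = K *m x by rewrite mulmxA mulmxV ?mul1mx.
have [->|x0] := eqVneq x 0; first by rewrite mulmx0 frobenius0 mulr0.
have xp : 0 < frobenius x by rewrite lt_def frobenius_eq0 x0 frobenius_ge0.
rewrite mulrC ler_pdivlMr// mulrC -(ler_pM2r xp) -mulrA -expr2.
apply: le_trans (cK x) _; rewrite quad_dot; apply: le_trans (ler_norm _) _.
by rewrite mulrC; exact: ler_dot.
Qed.

Lemma coercive_perturb d c (K K' : 'M[R]_d) : coercive c K ->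
  frobenius (K' - K) <= c / 2 -> coercive (c / 2) K'.
Proof.
move=> cK KK x; have := cK x; have := ler_quad (K' - K) x.
rewrite quadD quadN => /ler_normlP[+ _].
have := ler_wpM2r (sqr_ge0 (frobenius x)) KK.
by lra.
Qed.

Lemma quadZ d (K : 'M[R]_d) a x : quad K (a *: x) = a ^+ 2 * quad K x.
Proof. by rewrite !quad_dot -scalemxAr dotZl dotZr; ring. Qed.

Lemma quad_sym d (K : 'M[R]_d) (x y : 'cV[R]_d) : K^T = K ->
  quad K (x + y) = quad K x + 2 * dot x (K *m y) + quad K y.
Proof.
move=> Ks; rewrite !quad_dot mulmxDr !dotDl !dotDr.
suff -> : dot y (K *m x) = dot x (K *m y) by ring.
by rewrite dotC !dot_mx trmx_mul Ks mulmxA.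
Qed.

(** The quadratic [t => quad K (t *: x + y)] is nonnegative, so its discriminant is not positive.
    When [quad K x = 0] it degenerates to an affine function, which stays nonnegative only with
    slope zero. *)
Lemma psd_cauchy_schwarz d (K : 'M[R]_d) (x y : 'cV[R]_d) : K^T = K ->
  (forall v, 0 <= quad K v) -> dot x (K *m y) ^+ 2 <= quad K x * quad K y.
Proof.
move=> Ks Kp; set b := dot x (K *m y).
have H t : 0 <= t ^+ 2 * quad K x + 2 * t * b + quad K y.
  by have := Kp (t *: x + y); rewrite quad_sym// quadZ dotZl mulrA.
have := Kp x; rewrite le_eqVlt => /orP[/eqP Kx0|Kx].
  have [->|b0] := eqVneq b 0; first by rewrite expr0n -Kx0 mul0r.
  have := H (- (quad K y + 1) / (2 * b)); rewrite -Kx0 mulr0 add0r.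
  have -> : 2 * (- (quad K y + 1) / (2 * b)) * b = - (quad K y + 1).
    by field.
  by lra.
have := H (- b / quad K x).
have -> : (- b / quad K x) ^+ 2 * quad K x + 2 * (- b / quad K x) * b + quad K y
   = quad K y - b ^+ 2 / quad K x by field; rewrite gt_eqF.
by rewrite subr_ge0 ler_pdivrMr// mulrC.
Qed.

(** Cauchy-Schwarz in the form of [K], applied to [x] and [invmx K *m x], gives
    [|x|^4 <= quad K x * quad (invmx K) x], and the last factor is at most
    [frobenius (invmx K) * |x|^2]. The added 1 keeps the constant positive. *)
Lemma psd_unit_coercive d (K : 'M[R]_d) : K^T = K ->
  (forall v, 0 <= quad K v) -> K \in unitmx -> exists2 e, 0 < e & coercive e K.
Proof.
move=> Ks Kp Ku; pose C := frobenius (invmx K) + 1.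
have C0 : 0 < C by rewrite ltr_wpDl ?frobenius_ge0.
exists C^-1; first by rewrite invr_gt0.
move=> x; have := psd_cauchy_schwarz x (invmx K *m x) Ks Kp.
rewrite mulmxA mulmxV// mul1mx dotvv.
have -> : quad K (invmx K *m x) = quad (invmx K) x.
  by rewrite !quad_dot mulmxA mulmxV// mul1mx dotC.
have [->|x0] := eqVneq x 0.
  by move=> _; rewrite frobenius0 expr0n mulr0 quad_dot mulmx0 dotvv frobenius0 expr0n.
have xp : 0 < frobenius x ^+ 2.
  by rewrite exprn_gt0// lt_def frobenius_eq0 x0 frobenius_ge0.
move=> H; rewrite mulrC ler_pdivrMr// -(ler_pM2r xp) -expr2; apply: le_trans H _.
rewrite -mulrA ler_wpM2l//.
have := ler_quad (invmx K) x => /(le_trans (ler_norm _)) => H.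
by apply: le_trans H _; rewrite ler_wpM2r ?(ltW xp)// lerDl.
Qed.

(** A variational argument in place of diagonalization. The best coercivity constant [mu] is
    attained, so [K - mu] is positive semidefinite; were it invertible it would be coercive and [mu]
    could be increased. Hence [mu] is an eigenvalue, and it bounds all the others from below. *)
Lemma lambda_min_coercive d (K : 'M[R]_d) c : (0 < d)%N -> K^T = K ->
  (forall v, 0 <= quad K v) -> c <= lambda_min K -> coercive c K.
Proof.
case: d K => [//|d] K _ Ks Kp cK.
pose S := [set a : R | coercive a K].
have S0 : S 0 by move=> x; rewrite mul0r.
pose e : 'cV[R]_d.+1 := delta_mx 0 0.
have e1 : frobenius e ^+ 2 = 1.
  rewrite sqr_frobenius_col (bigD1 0)//= big1 ?addr0 ?mxE ?expr1n// => i i0.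
  by rewrite mxE (negbTE i0) expr0n.
have Sub : ubound S (quad K e) by move=> a /(_ e); rewrite e1 mulr1.
have Ssup : has_sup S by split; [exists 0|exists (quad K e)].
pose mu := sup S.
have Smu : S mu.
  move=> x; rewrite -subr_le0; apply/ler_addgt0Pl => /= t t0; rewrite addr0.
  have t'0 : 0 < t / (frobenius x ^+ 2 + 1).
    by rewrite divr_gt0// ltr_wpDl ?sqr_ge0.
  have [a Sa /ltW mua] := sup_adherent t'0 Ssup.
  have : (mu - a) * frobenius x ^+ 2 <= t.
    apply: (@le_trans _ _ (t / (frobenius x ^+ 2 + 1) * frobenius x ^+ 2)).
      by rewrite ler_wpM2r ?sqr_ge0// lerBlDr -lerBlDl.
    by rewrite mulrAC ler_pdivrMr ?ltr_wpDl ?sqr_ge0// ler_pM2l// lerDl.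
  by have := Sa x; lra.
have Keig : eigenvalue K mu.
  rewrite /eigenvalue /eigenspace kermx_eq0 row_free_unit; apply/negP => Ku.
  have [||t t0 tK] := psd_unit_coercive _ _ Ku.
  - by rewrite linearB /= tr_scalar_mx Ks.
  - by move=> v; rewrite quadD quadN quad_scalar subr_ge0; exact: Smu.
  have : S (mu + t).
    by move=> x; have := tK x; rewrite quadD quadN quad_scalar; lra.
  by move/(ub_le_sup (proj2 Ssup)); rewrite -/mu gerDl leNgt t0.
suff cmu : c <= mu by move=> x; apply: le_trans (Smu x); rewrite ler_wpM2r ?sqr_ge0.
apply: le_trans cK _; apply: ge_inf => //; exists mu => a /eigenvalueP[v vK v0].
have := Smu v^T; rewrite quad_mx trmxK vK -scalemxAl mxE.
have -> : (v *m v^T) 0 0 = frobenius v^T ^+ 2.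
  by rewrite -dotvv dot_mx trmxK.
rewrite ler_pM2r// exprn_gt0// lt_def frobenius_ge0 andbT frobenius_eq0.
by rewrite -trmx0 (inj_eq (@trmx_inj _ _ _)).
Qed.

(** Cholesky elimination of the first row and column: the Schur complement of the pivot is again
    positive semidefinite. *)
Lemma psd_factor d (K : 'M[R]_d) : K^T = K -> (forall v, 0 <= quad K v) ->
  exists L : 'M[R]_d, K = L *m L^T.
Proof.
elim: d K => [|d IH]; first by move=> K _ _; exists 0; apply/matrixP => -[].
rewrite -[d.+1]/(1 + d)%N => K Ks Kp.
rewrite -[K](@submxK _ 1 d 1 d) in Ks Kp *.
set w := ulsubmx _ in Ks Kp *; set v := ursubmx _ in Ks Kp *.
set v' := dlsubmx _ in Ks Kp *; set K' := drsubmx _ in Ks Kp *.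
move: Ks; rewrite tr_block_mx => /eq_block_mx[ws vs _ Ks].
have {}vs : v' = v^T by rewrite -vs trmxK.
rewrite {}vs in Kp *.
pose a := w 0 0; have wa : w = a%:M by rewrite [w]mx11_scalar.
have Q (t : R) (x : 'cV[R]_d) :
    0 <= t ^+ 2 * a + 2 * t * (v *m x) 0 0 + quad K' x.
  have := Kp (col_mx t%:M x); rewrite quad_mx tr_col_mx mul_row_block mul_row_col.
  have mxDE (A B : 'M[R]_1) : (A + B) 0 0 = A 0 0 + B 0 0 by rewrite mxE.
  rewrite tr_scalar_mx wa !mulmxDl !mxDE -!scalar_mxM.
  rewrite -[(x^T *m K' *m x) 0 0]quad_mx.
  have -> : (x^T *m v^T *m t%:M) 0 0 = t * (v *m x) 0 0.
    by rewrite mul_mx_scalar -trmx_mul mxE mxE.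
  have -> : (t%:M *m v *m x) 0 0 = t * (v *m x) 0 0.
    by rewrite mul_scalar_mx -scalemxAl mxE.
  rewrite mxE eqxx mulr1n; set q := (v *m x) 0 0.
  suff -> : t * a * t + t * q + (t * q + quad K' x) =
    t ^+ 2 * a + 2 * t * q + quad K' x by [].
  by ring.
have a0 : 0 <= a.
  have := Q 1 0; rewrite mulmx0 mxE quad_dot mulmx0 dotvv frobenius0.
  by rewrite expr0n expr1n mulr0 mul1r !addr0.
(* With a zero pivot [Q] is affine in [t], so its slope vanishes; taking [x = v^T] shows that the
   whole row is zero. *)
have va : a = 0 -> v = 0.
  move=> a0'; apply/eqP; rewrite -(inj_eq (@trmx_inj _ _ _)) trmx0 -frobenius_eq0.
  rewrite -sqrf_eq0 -dotvv dot_mx trmxK; set b := (v *m v^T) 0 0.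
  apply/negPn/negP => b0; have := Q (- (quad K' v^T + 1) / (2 * b)) v^T.
  rewrite a0' mulr0 add0r -/b.
  have -> : 2 * (- (quad K' v^T + 1) / (2 * b)) * b = - (quad K' v^T + 1).
    by field.
  by lra.
pose u := (Num.sqrt a)^-1 *: v^T.
have uu : u *m u^T = a^-1 *: (v^T *m v).
  by rewrite /u linearZ /= trmxK -scalemxAl -scalemxAr scalerA -invfM -expr2 sqr_sqrtr.
have au : Num.sqrt a *: u = v^T.
  rewrite /u scalerA; have [a'|a'] := eqVneq a 0.
    by rewrite (va a') trmx0 scaler0.
  by rewrite divff ?scale1r// gt_eqF// sqrtr_gt0 lt_def a' a0.
have [||L LE] := IH (K' - u *m u^T).
- by rewrite linearB /= Ks trmx_mul trmxK.
- move=> x; rewrite quadD quadN uu.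
  have -> : quad (a^-1 *: (v^T *m v)) x = a^-1 * (v *m x) 0 0 ^+ 2.
    rewrite quad_mx -scalemxAr -scalemxAl mxE; congr (_ * _).
    have -> : x^T *m (v^T *m v) *m x = (v *m x)^T *m (v *m x).
      by rewrite trmx_mul !mulmxA.
    by rewrite [LHS]mxE big_ord1 mxE expr2.
  have [a'|a'] := eqVneq a 0.
    have := Q 0 x; rewrite (va a') mul0mx mxE expr0n a'; lra.
  (* The minimizer in [t], at which [Q] takes the value of the Schur complement. *)
  have := Q (- (v *m x) 0 0 / a) x.
  have -> : (- (v *m x) 0 0 / a) ^+ 2 * a + 2 * (- (v *m x) 0 0 / a) * (v *m x) 0 0
    = - (a^-1 * (v *m x) 0 0 ^+ 2) by field.
  by lra.
exists (block_mx (Num.sqrt a)%:M 0 u L : 'M[R]_(1 + d)).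
rewrite tr_block_mx trmx0 mulmx_block !mul0mx mulmx0 !addr0.
rewrite tr_scalar_mx -scalar_mxM -expr2 sqr_sqrtr// -wa mul_scalar_mx.
rewrite mul_mx_scalar au -[Num.sqrt a *: u^T]linearZ /= au trmxK.
by rewrite -LE [_ + (_ - _)]addrC subrK.
Qed.

End Coercive.

(** * Smoothed indicators of balls *)

Section SmoothStep.
Variable R : realType.

(* The only smoothness the swapping argument needs: a second-order expansion
   whose cubic remainder is uniform in the base point. *)
Definition taylor3 d (f : 'cV[R]_d -> R) : Prop :=
  exists (C : R) (l : 'cV[R]_d -> 'cV[R]_d) (q : 'cV[R]_d -> 'M[R]_d),
  [/\ 0 <= C, forall x, frobenius (q x) <= C &
    forall x h, `|f (x + h) - f x - dot (l x) h - quad (q x) h|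
                <= C * frobenius h ^+ 3].

Lemma taylor3_lin d (a b : R) (f g : 'cV[R]_d -> R) : taylor3 f -> taylor3 g ->
  taylor3 (fun x => a * f x + b * g x).
Proof.
move=> [C [l [q [C0 qC Cf]]]] [D [l' [q' [D0 qD Dg]]]].
exists (`|a| * C + `|b| * D), (fun x => a *: l x + b *: l' x),
  (fun x => a *: q x + b *: q' x); split.
- by rewrite addr_ge0// mulr_ge0.
- move=> x; apply: le_trans (ler_frobeniusD _ _) _.
  by rewrite !frobeniusZ lerD// ler_wpM2l.
- move=> x h; rewrite dotDl !dotZl quadD.
  have quadZl c (M : 'M[R]_d) v : quad (c *: M) v = c * quad M v.
    by rewrite !quad_dot -scalemxAl dotZr.
  rewrite !quadZl.
  rewrite (_ : _ - _ = a * (f (x + h) - f x - dot (l x) h - quad (q x) h) +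
     b * (g (x + h) - g x - dot (l' x) h - quad (q' x) h)); last by ring.
  apply: le_trans (ler_normD _ _) _; rewrite !normrM mulrDl -!mulrA.
  by rewrite lerD// ler_wpM2l.
Qed.

(** The third power makes the second derivative Lipschitz across the sphere, and the squared norm
    keeps the function smooth at the origin. *)
Definition bump d (b : R) (x : 'cV[R]_d) : R :=
  Num.max 0 (b - frobenius x ^+ 2) ^+ 3.

(** The third derivative of the cubed positive part takes only the values 0 and 6, so the
    second-order remainder is at most [|q|^3]. *)
Lemma pos_cube_taylor (u0 q u : R) : u = Num.max 0 u0 ->
  `|Num.max 0 (u0 + q) ^+ 3 - u ^+ 3 - 3 * u ^+ 2 * q - 3 * u * q ^+ 2|
  <= `|q| ^+ 3.
Proof.
move=> ->; rewrite -normrX; case: (ltP 0 u0) => u0p; last first.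
  case: (ltP 0 (u0 + q)) => uqp.
    rewrite !expr0n /= !(mulr0, mul0r) !subr0 !normrX.
    by rewrite ler_pXn2r ?nnegrE ?normr_ge0// !ger0_norm; lra.
  by rewrite !expr0n /= !(subr0, mulr0, mul0r) normr0.
case: (ltP 0 (u0 + q)) => uqp.
  by rewrite le_eqVlt; apply/orP; left; apply/eqP; congr `| _ |; ring.
have q0 : q < 0 by lra.
rewrite expr0n /= (_ : _ - _ = q ^+ 3 - (u0 + q) ^+ 3); last by ring.
have a1 : (u0 + q) ^+ 3 <= 0 by rewrite exprn_odd_le0.
have a2 : q ^+ 3 <= (u0 + q) ^+ 3.
  rewrite -subr_ge0.
  rewrite (_ : _ - _ = u0 * ((u0 + q) ^+ 2 + (u0 + q) * q + q ^+ 2)); last by ring.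
  apply: mulr_ge0; first exact: ltW.
  by rewrite !addr_ge0 ?sqr_ge0// mulr_le0//; exact: ltW.
by rewrite !ler0_norm; lra.
Qed.

Lemma bump_bounds d b (x : 'cV[R]_d) : 0 <= b -> 0 <= bump b x <= b ^+ 3.
Proof.
move=> b0; rewrite /bump exprn_ge0 ?le_max ?lexx//=.
rewrite ler_pXn2r ?nnegrE ?le_max ?lexx// ge_max b0/= lerBlDr lerDl.
exact: sqr_ge0.
Qed.

Lemma bump_out d b (x : 'cV[R]_d) : b <= frobenius x ^+ 2 -> bump b x = 0.
Proof. by move=> bx; rewrite /bump max_l ?expr0n// subr_le0. Qed.

(** Compact support turns the local expansion into one with constants uniform in [x]: far from the
    ball everything vanishes, near it [x] is bounded. *)
Lemma taylor3_bump d b : 0 <= b -> taylor3 (@bump d b).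
Proof.
move=> b0.
pose u (x : 'cV[R]_d) := Num.max 0 (b - frobenius x ^+ 2).
have u_ge0 x : 0 <= u x by rewrite le_max lexx.
have u_le x : u x <= b by rewrite ge_max b0/= lerBlDr lerDl sqr_ge0.
have u_out x : b <= frobenius x ^+ 2 -> u x = 0.
  by move=> bx; rewrite /u max_l// subr_le0.
(* For increments shorter than 1, a base point beyond radius [M] leaves both [x] and [x + h] outside
   the support, whose radius is bounded by [b + 1] to avoid a square root. [c1] controls the
   second-order term, [c2] serves short increments and [c3] long ones. *)
pose M := 2 * (b + 1).
pose c1 := 12 * b * (b + 1) ^+ 2 + 3 * b ^+ 2.
pose c2 := (2 * M + 1) ^+ 3 + 3 * b * (4 * M + 1).
pose c3 := b ^+ 3 + 6 * b ^+ 2 * (b + 1) + c1.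
have M0 : 0 <= M by rewrite /M; lra.
have c1_ge0 : 0 <= c1 by rewrite !(addr_ge0, mulr_ge0)// ?exprn_ge0//; lra.
have c2_ge0 : 0 <= c2 by rewrite !(addr_ge0, mulr_ge0, exprn_ge0)//; lra.
have c3_ge0 : 0 <= c3 by rewrite !(addr_ge0, mulr_ge0, exprn_ge0)//; lra.
have r_small x : u x != 0 -> frobenius x <= b + 1.
  move=> ux; rewrite leNgt; apply/negP => bx; move/negP: ux; apply; apply/eqP.
  apply: u_out; apply: (@le_trans _ _ ((b + 1) ^+ 2)); last first.
    by rewrite ler_pXn2r ?nnegrE ?frobenius_ge0 ?(ltW bx)//; lra.
  by rewrite sqrrD; have := sqr_ge0 b; lra.
(* Half the Hessian of [u ^+ 3]; its gradient is [- 6 u^2 x]. *)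
pose q (x : 'cV[R]_d) : 'M[R]_d :=
  (- 3 * u x ^+ 2)%:M + (12 * u x) *: (x *m x^T).
have quadq x h : quad (q x) h =
    - 3 * u x ^+ 2 * frobenius h ^+ 2 + 12 * u x * dot x h ^+ 2.
  rewrite quadD quad_scalar; congr (_ + _).
  rewrite quad_dot -scalemxAl dotZr; congr (_ * _).
  rewrite -mulmxA [x^T *m h]mx11_scalar -dot_mx mul_mx_scalar dotZr.
  by rewrite (dotC h) expr2.
exists (c1 * (1 + frobenius (1%:M : 'M[R]_d)) + c2 + c3),
  (fun x => (- (6 * u x ^+ 2)) *: x), q; split.
- by rewrite !(addr_ge0, mulr_ge0, frobenius_ge0).
- move=> x; apply: (@le_trans _ _ (c1 * (1 + frobenius (1%:M : 'M[R]_d)))).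
    apply: le_trans (ler_frobeniusD _ _) _; rewrite mulrDr mulr1 addrC.
    have F0 := frobenius_ge0 (1%:M : 'M[R]_d).
    have bb0 : 0 <= 12 * b * (b + 1) ^+ 2 by rewrite !mulr_ge0 ?exprn_ge0//; lra.
    apply: lerD; last first.
      rewrite -[_%:M]scalemx1 frobeniusZ ler_wpM2r// normrM normrN.
      rewrite !ger0_norm ?sqr_ge0//.
      have : u x ^+ 2 <= b ^+ 2 by rewrite ler_pXn2r ?nnegrE.
      by rewrite /c1; lra.
    rewrite frobeniusZ ger0_norm ?mulr_ge0//.
    have [->|ux] := eqVneq (u x) 0; first by rewrite mulr0 mul0r.
    apply: (@le_trans _ _ (12 * b * (b + 1) ^+ 2)); last first.
      by rewrite /c1; have := sqr_ge0 b; lra.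
    apply: ler_pM => //; rewrite ?mulr_ge0 ?frobenius_ge0//; first by rewrite ler_pM2l.
    apply: le_trans (ler_frobeniusM _ _) _.
    have -> : frobenius x^T = frobenius x.
      by rewrite /frobenius exchange_big; congr Num.sqrt; apply: eq_bigr => i _;
        apply: eq_bigr => j _; rewrite mxE.
    by rewrite -expr2 ler_pXn2r ?nnegrE ?frobenius_ge0 ?r_small//; lra.
  by rewrite -addrA lerDl addr_ge0.
- move=> x h; set k := frobenius h; set r := frobenius x; set p := dot x h.
  have k0 : 0 <= k := frobenius_ge0 h.
  have r0 : 0 <= r := frobenius_ge0 x.
  have pk : `|p| <= r * k := ler_dot x h.
  have bumpD : bump b (x + h) = Num.max 0 (b - r ^+ 2 + - (2 * p + k ^+ 2)) ^+ 3.
    by rewrite /bump sqr_frobeniusD -/r -/k -/p; congr (Num.max _ _ ^+ 3); ring.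
  rewrite quadq dotZl -/p -/k.
  suff : `|bump b (x + h) - bump b x - - (6 * u x ^+ 2) * p -
    (- 3 * u x ^+ 2 * k ^+ 2 + 12 * u x * p ^+ 2)| <= c2 * k ^+ 3 \/
    `|bump b (x + h) - bump b x - - (6 * u x ^+ 2) * p -
    (- 3 * u x ^+ 2 * k ^+ 2 + 12 * u x * p ^+ 2)| <= c3 * k ^+ 3.
    have k3 : 0 <= k ^+ 3 by rewrite exprn_ge0.
    move=> [] /le_trans; apply; apply: ler_wpM2r => //.
      by rewrite -addrA addrC -addrA lerDl addr_ge0// mulr_ge0// addr_ge0// frobenius_ge0.
    by rewrite addrC lerDl addr_ge0// mulr_ge0// addr_ge0// frobenius_ge0.
  (* Below length 1 the cancellation in the Taylor expansion is needed. From 1 on, [1], [k] and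
     [k ^+ 2] are at most [k ^+ 3], and each term is bounded separately. *)
  have [k1|k1] := ltP k 1; [left|right].
    have [rM|rM] := leP r M; last first.
      have bump0 y : b + 1 <= frobenius y -> b <= frobenius y ^+ 2.
        move=> by1; apply: (@le_trans _ _ ((b + 1) ^+ 2)).
          by rewrite sqrrD; have := sqr_ge0 b; lra.
        by rewrite ler_pXn2r ?nnegrE ?frobenius_ge0//; lra.
      have bx : b <= frobenius x ^+ 2.
        by apply: bump0; rewrite -/r; move: rM; rewrite /M; lra.
      have bxh : b <= frobenius (x + h) ^+ 2.
        apply: bump0; have := ler_frobeniusD (x + h) (- h).
        by rewrite addrK frobeniusN -/r -/k; move: rM; rewrite /M; lra.
      rewrite (bump_out bx) (bump_out bxh) (u_out _ bx).
      rewrite !expr0n /= !(mulr0, mul0r, oppr0, subr0, addr0) normr0 mulr_ge0//.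
      by rewrite exprn_ge0.
    have := pos_cube_taylor (- (2 * p + k ^+ 2)) (erefl (u x)).
    rewrite -/r -bumpD -[u x ^+ 3]/(bump b x) => H.
    rewrite (_ : _ - _ = (bump b (x + h) - bump b x
       - 3 * u x ^+ 2 * - (2 * p + k ^+ 2) - 3 * u x * (- (2 * p + k ^+ 2)) ^+ 2)
       + 3 * u x * (4 * p * k ^+ 2 + k ^+ 4)); last by ring.
    apply: le_trans (ler_normD _ _) _; rewrite [c2 * _]mulrDl lerD//.
      apply: le_trans H _; rewrite -exprMn ler_pXn2r ?nnegrE//; last first.
        by rewrite mulr_ge0//; lra.
      rewrite normrN; apply: le_trans (ler_normD _ _) _.
      rewrite normrM normrX (ger0_norm k0) ger0_norm//. rewrite [(2 * M + 1) * k]mulrDl mul1r lerD//.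
        rewrite -mulrA ler_wpM2l//; apply: le_trans pk _.
        by rewrite ler_wpM2r.
      by rewrite expr2 ler_piMr// ltW.
    rewrite normrM [`|3 * _|]ger0_norm ?mulr_ge0//.
    rewrite -[3 * b * _ * _]mulrA; apply: ler_pM => //; rewrite ?mulr_ge0 ?ler_pM2l//.
    apply: le_trans (ler_normD _ _) _; rewrite [(4 * M + 1) * _]mulrDl mul1r lerD//.
      rewrite normrM [`|4 * p|]normrM normrX (ger0_norm k0) [`|4|]ger0_norm//.
      rewrite (_ : 4 * M * k ^+ 3 = 4 * (M * k) * k ^+ 2); last by ring.
      rewrite ler_wpM2r ?sqr_ge0// ler_wpM2l//; apply: le_trans pk _.
      by rewrite ler_wpM2r.
    by rewrite ger0_norm ?exprn_ge0// exprS ler_piMl ?exprn_ge0// ltW.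
  have k13 : 1 <= k ^+ 3 by rewrite exprn_ege1.
  have kk3 : k <= k ^+ 3 by rewrite exprS ler_peMr// exprn_ege1.
  have k23 : k ^+ 2 <= k ^+ 3 by rewrite [leRHS]exprS ler_peMl ?sqr_ge0.
  have u2 : u x ^+ 2 <= b ^+ 2 by rewrite ler_pXn2r ?nnegrE.
  have [bx1 bx2] := andP (bump_bounds x b0).
  have [by1 by2] := andP (bump_bounds (x + h) b0).
  have [ux|ux] := eqVneq (u x) 0.
    rewrite ux !expr0n /= !(mulr0, mul0r, oppr0, subr0, addr0).
    apply: (@le_trans _ _ (b ^+ 3)); first by rewrite ler_norml; lra.
    have b3 : 0 <= b ^+ 3 by rewrite exprn_ge0.
    apply: (@le_trans _ _ c3); last by rewrite ler_peMr.
    rewrite /c3 -addrA lerDl addr_ge0// !mulr_ge0// ?exprn_ge0//; lra.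
  have rb := r_small x ux.
  have pb : `|p| <= (b + 1) * k.
    by apply: le_trans pk _; rewrite ler_wpM2r.
  apply: le_trans (ler_normB _ _) _; rewrite [c3 * _]mulrDl lerD//.
    apply: le_trans (ler_normB _ _) _; rewrite [(b ^+ 3 + _) * _]mulrDl lerD//.
      apply: (@le_trans _ _ (b ^+ 3)); first by rewrite ler_norml; lra.
      by rewrite ler_peMr// exprn_ge0.
    have u6 : 0 <= 6 * u x ^+ 2 by rewrite mulr_ge0// sqr_ge0.
    rewrite normrM normrN (ger0_norm u6).
    rewrite -[6 * b ^+ 2 * _ * _]mulrA; apply: ler_pM => //.
      by rewrite ler_pM2l.
    by apply: le_trans pb _; rewrite ler_wpM2l//; lra.
  apply: le_trans (ler_normD _ _) _; rewrite addrC [c1 * _]mulrDl lerD//.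
    rewrite normrM (@ger0_norm _ (12 * _)) ?mulr_ge0//.
    rewrite -[12 * b * _ * _]mulrA; apply: ler_pM => //; rewrite ?mulr_ge0 ?ler_pM2l//.
    apply: (@le_trans _ _ ((b + 1) ^+ 2 * k ^+ 2)); last first.
      by rewrite ler_wpM2l// sqr_ge0.
    rewrite -exprMn normrX ler_pXn2r ?nnegrE ?mulr_ge0//; lra.
  rewrite normrM (@ger0_norm _ (k ^+ 2)) ?sqr_ge0// normrM normrN.
  rewrite !ger0_norm ?sqr_ge0//; apply: ler_pM => //; rewrite ?mulr_ge0 ?sqr_ge0//.
  by rewrite ler_pM2l.
Qed.

(* A normalized third difference of [bump b] in [b], hence equal to 1 on the
   inner ball, to 0 outside the outer one, and monotone in between. *)
Definition smooth_step d (a e : R) (x : 'cV[R]_d) : R :=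
  (6 * e ^+ 3)^-1 * (bump (a + 3 * e) x - 3 * bump (a + 2 * e) x
                     + 3 * bump (a + e) x - bump a x).

Lemma taylor3_step d a e : 0 <= a -> 0 < e -> taylor3 (@smooth_step d a e).
Proof.
move=> a0 e0.
have B c : 0 <= c -> taylor3 (@bump d (a + c * e)).
  by move=> c0; apply: taylor3_bump; rewrite addr_ge0// mulr_ge0// ltW.
have H := taylor3_lin (6 * e ^+ 3)^-1 (6 * e ^+ 3)^-1
  (taylor3_lin 1 (- 3) (B 3 (ler0n _ _)) (B 2 (ler0n _ _)))
  (taylor3_lin 3 (- 1) (B 1 ler01) (B 0 (lexx _))).
rewrite (_ : smooth_step a e = fun x => (6 * e ^+ 3)^-1 *
  (1 * bump (a + 3 * e) x + -3 * bump (a + 2 * e) x) + (6 * e ^+ 3)^-1 *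
  (3 * bump (a + 1 * e) x + -1 * bump (a + 0 * e) x)); first exact: H.
apply/funext => x; rewrite /smooth_step !mul1r mul0r addr0 -mulrDr.
by congr (_ * _); ring.
Qed.

Lemma smooth_step_le d a e (x : 'cV[R]_d) : 0 < e ->
  (frobenius x ^+ 2 <= a)%R%:R <= smooth_step a e x
  <= (frobenius x ^+ 2 <= a + 3 * e)%R%:R.
Proof.
move=> e0; rewrite /smooth_step /bump.
set t := frobenius x ^+ 2; clearbody t.
have e3 : 0 < e ^+ 3 by rewrite exprn_gt0.
have E0 : 0 < 6 * e ^+ 3 by rewrite mulr_gt0.
set N := (X in _ * X).
suff H : (t <= a)%R%:R * (6 * e ^+ 3) <= N /\
               N <= (t <= a + 3 * e)%R%:R * (6 * e ^+ 3).
  case: H => N0 N1.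
  by rewrite [_^-1 * _]mulrC ler_pdivlMr// ler_pdivrMr// N0 N1.
have [t3|t3] := leP t (a + 3 * e); last first.
  have -> : (t <= a) = false by apply/negbTE; rewrite -ltNge; lra.
  by rewrite /N !max_l ?expr0n /= ?mul0r; try lra.
have [t2|t2] := leP (a + 2 * e) t.
  have N_E : N = (a + 3 * e - t) ^+ 3.
    rewrite /N (@max_r _ _ 0 (a + 3 * e - t)); last lra.
    by rewrite !max_l; [rewrite expr0n/=; ring|lra..].
  have h0 : 0 <= (a + 3 * e - t) ^+ 3 by rewrite exprn_ge0//; lra.
  have h1 : (a + 3 * e - t) ^+ 3 <= e ^+ 3.
    by rewrite ler_pXn2r ?nnegrE//; lra.
  have -> : (t <= a) = false by apply/negbTE; rewrite -ltNge; lra.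
  by rewrite N_E /=; split; lra.
have [t1|t1] := leP (a + e) t.
  set s := a + 2 * e - t; have s0 : 0 <= s by rewrite /s; lra.
  have s1 : s <= e by rewrite /s; lra.
  have N_E : N = (s + e) ^+ 3 - 3 * s ^+ 3.
    rewrite /N (@max_r _ _ 0 (a + 3 * e - t)); last lra.
    rewrite (@max_r _ _ 0 (a + 2 * e - t)); last lra.
    by rewrite !max_l; [rewrite expr0n /s/=; ring|lra..].
  have -> : (t <= a) = false by apply/negbTE; rewrite -ltNge; lra.
  have e0' := ltW e0.
  (* On this piece [N] is a cubic in [s]. These products are the nonnegative terms into which [N]
     and [6 * e ^+ 3 - N] decompose for [s] between 0 and [e]. *)
  have u0 : 0 <= e * s * (3 * e + s) by rewrite !mulr_ge0// addr_ge0// mulr_ge0.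
  have u1 : s ^+ 3 <= e ^+ 3 by rewrite ler_pXn2r ?nnegrE.
  have u2 : 0 <= (e - s) ^+ 2 * (e + 2 * s).
    by rewrite mulr_ge0 ?sqr_ge0//; lra.
  have u3 : 0 <= e ^+ 2 * (e - s) by rewrite mulr_ge0 ?sqr_ge0//; lra.
  have u4 : 0 <= s ^+ 3 by rewrite exprn_ge0.
  have u5 : 0 <= s ^+ 2 * (e - s) by rewrite mulr_ge0 ?sqr_ge0//; lra.
  rewrite N_E /= mul0r mul1r; split.
    rewrite (_ : _ - _ = e ^+ 3 + e * s * (3 * e + s) + 2 * (s ^+ 2 * (e - s))); last by ring.
    lra.
  rewrite -subr_ge0 (_ : _ - _ = 3 * (e ^+ 2 * (e - s))
    + (e - s) ^+ 2 * (e + 2 * s) + e ^+ 3); last by ring.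
  lra.
have [t0|t0] := leP t a.
  have N_E : N = 6 * e ^+ 3 by rewrite /N !max_r; [ring|lra..].
  by rewrite N_E /= !mul1r; split.
set s := a + e - t; have s0 : 0 <= s by rewrite /s; lra.
have s1 : s <= e by rewrite /s; lra.
have N_E : N = 6 * e ^+ 3 - (e - s) ^+ 3.
  rewrite /N (@max_r _ _ 0 (a + 3 * e - t)); last lra.
  rewrite (@max_r _ _ 0 (a + 2 * e - t)); last lra.
  rewrite (@max_r _ _ 0 (a + e - t)); last lra.
  by rewrite max_l; [rewrite /s expr0n/=; ring|lra].
have h0 : 0 <= (e - s) ^+ 3 by rewrite exprn_ge0//; lra.
have h1 : (e - s) ^+ 3 <= e ^+ 3 by rewrite ler_pXn2r ?nnegrE//; lra.
by rewrite N_E /=; split; lra.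
Qed.

End SmoothStep.

(** * Random walks with uniform increments *)

Section Averages.
Variable R : realType.

Definition avg (I : finType) (F : I -> R) : R := #|I|%:R^-1 * \sum_i F i.

Lemma avg_ge0 (I : finType) (F : I -> R) : (forall i, 0 <= F i) -> 0 <= avg F.
Proof. by move=> F0; rewrite mulr_ge0 ?invr_ge0// sumr_ge0. Qed.

Lemma ler_avg (I : finType) (F G : I -> R) :
  (forall i, F i <= G i) -> avg F <= avg G.
Proof. by move=> FG; rewrite ler_wpM2l ?invr_ge0// ler_sum. Qed.

Lemma eq_avg (I : finType) (F G : I -> R) : F =1 G -> avg F = avg G.
Proof. by move=> FG; congr (_ * _); apply: eq_bigr => i _. Qed.

Lemma avgD (I : finType) (F G : I -> R) :
  avg (fun i => F i + G i) = avg F + avg G.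
Proof. by rewrite /avg big_split mulrDr. Qed.

Lemma avgZ (I : finType) a (F : I -> R) : avg (fun i => a * F i) = a * avg F.
Proof. by rewrite /avg -big_distrr mulrCA. Qed.

Lemma avgB (I : finType) (F G : I -> R) :
  avg (fun i => F i - G i) = avg F - avg G.
Proof. by rewrite /avg sumrB mulrBr. Qed.

Lemma avg_cst (I : finType) (a : R) : (0 < #|I|)%N -> avg (fun _ : I => a) = a.
Proof.
by move=> I0; rewrite /avg sumr_const -[a *+ _]mulr_natl mulKf// pnatr_eq0 -lt0n.
Qed.

Lemma ler_norm_avg (I : finType) (F : I -> R) : `|avg F| <= avg (fun i => `|F i|).
Proof.
rewrite normrM ger0_norm ?invr_ge0// ler_wpM2l ?invr_ge0//.
exact: ler_norm_sum.
Qed.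

Lemma exchange_avg (I J : finType) (F : I -> J -> R) :
  avg (fun i => avg (F i)) = avg (fun j => avg (fun i => F i j)).
Proof. by rewrite /avg -!big_distrr /= mulrCA exchange_big. Qed.

Lemma avg_sum (I J : finType) (F : I -> J -> R) :
  avg (fun i => \sum_j F i j) = \sum_j avg (fun i => F i j).
Proof. by rewrite /avg exchange_big big_distrr. Qed.

(* One step of the random walk with uniformly chosen increments [h i], acting
   on functions of the position. *)
Definition avop (V : zmodType) (I : finType) (h : I -> V) (f : V -> R) : V -> R :=
  fun x => avg (fun i => f (x + h i)).

Section Operators.
Variables (V : zmodType) (I : finType) (h : I -> V).
Hypothesis I_gt0 : (0 < #|I|)%N.

Lemma avop_norm_le f e : (forall x, `|f x| <= e) -> forall x, `|avop h f x| <= e.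
Proof.
move=> fe x; apply: le_trans (ler_norm_avg _) _.
by rewrite -[leRHS](avg_cst e I_gt0); exact: ler_avg.
Qed.

Lemma iter_avop_le n f g : (forall x, f x <= g x) ->
  forall x, iter n (avop h) f x <= iter n (avop h) g x.
Proof. by elim: n => // n IH fg x /=; apply: ler_avg => i; exact: IH. Qed.

Lemma avop_cst c x : avop h (fun=> c) x = c.
Proof. exact: avg_cst. Qed.

Lemma iter_avop_ub n f c : (forall x, f x <= c) -> forall x, iter n (avop h) f x <= c.
Proof.
move=> fc; elim: n => // n IH x /=.
by rewrite -[leRHS](avop_cst c x); exact: ler_avg.
Qed.

Lemma iter_avop_lb n f c : (forall x, c <= f x) -> forall x, c <= iter n (avop h) f x.
Proof.
move=> fc; elim: n => // n IH x /=.
by rewrite -[leLHS](avop_cst c x); exact: ler_avg.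
Qed.

Lemma iter_avop_norm n f e : (forall x, `|f x| <= e) ->
  forall x, `|iter n (avop h) f x| <= e.
Proof. by move=> fe; elim: n => // n IH x; exact: avop_norm_le. Qed.

Lemma avopB f g x :
  avop h (fun x => f x - g x) x = avop h f x - avop h g x.
Proof. by rewrite /avop -avgB. Qed.

Lemma iter_avopB n f g x : iter n (avop h) (fun x => f x - g x) x =
  iter n (avop h) f x - iter n (avop h) g x.
Proof.
elim: n x => // n IH x /=; rewrite /avop -avgB; apply: eq_avg => i.
by rewrite IH.
Qed.

Lemma iter_avopZ n a f x : iter n (avop h) (fun x => a * f x) x =
  a * iter n (avop h) f x.
Proof.
elim: n x => // n IH x /=; rewrite /avop -avgZ; apply: eq_avg => i.
by rewrite IH.
Qed.

End Operators.

Lemma avop_comm (V : zmodType) (I J : finType) (h : I -> V) (k : J -> V) f x :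
  avop h (avop k f) x = avop k (avop h f) x.
Proof.
rewrite /avop exchange_avg; apply: eq_avg => j; apply: eq_avg => i.
by rewrite addrAC.
Qed.

Lemma iter_avop_comm (V : zmodType) (I J : finType) (h : I -> V) (k : J -> V) n f :
  iter n (avop h) (avop k f) = avop k (iter n (avop h) f).
Proof. by elim: n => //= n ->; apply/funext => x; rewrite avop_comm. Qed.

(** Averages over translations commute, so [h^(n+1) - k^(n+1) = h^n (h - k) + k (h^n - k^n)] as
    operators. Each average is a contraction for the supremum norm, hence the one-step errors merely
    add up. *)
Lemma iter_avop_telescope (V : zmodType) (I J : finType) (h : I -> V) (k : J -> V)
    f e n : (0 < #|I|)%N -> (0 < #|J|)%N ->
  (forall x, `|avop h f x - avop k f x| <= e) ->
  forall x, `|iter n (avop h) f x - iter n (avop k) f x| <= n%:R * e.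
Proof.
move=> I0 J0 fe; elim: n => [|n IH] x; first by rewrite subrr normr0 mul0r.
have -> : iter n.+1 (avop h) f x - iter n.+1 (avop k) f x =
  iter n (avop h) (fun x => avop h f x - avop k f x) x +
  avop k (fun x => iter n (avop h) f x - iter n (avop k) f x) x.
  rewrite iter_avopB avopB !iter_avop_comm /=.
  by ring.
apply: le_trans (ler_normD _ _) _; rewrite -natr1 mulrDl mul1r addrC lerD//.
  exact: avop_norm_le.
exact: iter_avop_norm.
Qed.

Lemma big_cons_tuple (J : finType) n (G : n.+1.-tuple J -> R) :
  \sum_t G t = \sum_j \sum_(t : n.-tuple J) G [tuple of j :: t].
Proof.
rewrite pair_big /= (reindex (fun p : J * n.-tuple J => [tuple of p.1 :: p.2]))//.
exists (fun t : n.+1.-tuple J => (thead t, [tuple of behead t])).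
- by case=> j t _ /=; congr pair; apply/val_inj.
- by move=> t _; rewrite /= -tuple_eta.
Qed.

Lemma avg_tuple0 (J : finType) (G : 0.-tuple J -> R) : avg G = G [tuple].
Proof.
rewrite /avg card_tuple expn0 invr1 mul1r (bigD1 [tuple])//= big1 ?addr0//.
by move=> t /eqP[]; exact: tuple0.
Qed.

Lemma avg_cons_tuple (J : finType) n (G : n.+1.-tuple J -> R) :
  avg G = avg (fun j => avg (fun t : n.-tuple J => G [tuple of j :: t])).
Proof.
rewrite /avg big_cons_tuple -big_distrr /= mulrA; congr (_ * _).
by rewrite !card_tuple expnS natrM invfM.
Qed.

(** Turns sampling with replacement into iteration of one operator, the form in which steps can be
    swapped. *)
Lemma avg_resample (V : zmodType) (J : finType) (h : J -> V) (F : V -> R) n x :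
  avg (fun t : n.-tuple J => F (x + \sum_(k < n) h (tnth t k))) =
  iter n (avop h) F x.
Proof.
elim: n x => [|n IH] x.
  by rewrite avg_tuple0 big_ord0 addr0.
rewrite avg_cons_tuple iterS; apply: eq_avg => j; rewrite -IH.
apply: eq_avg => t; rewrite big_ord_recl tnth0 addrA; congr (F (_ + _)).
by apply: eq_bigr => k _; rewrite tnthS.
Qed.

Lemma avg_prod (J : finType) n (G : 'I_n -> J -> R) :
  avg (fun t : n.-tuple J => \prod_(k < n) G k (tnth t k)) = \prod_k avg (G k).
Proof.
elim: n G => [|n IH] G.
  by rewrite avg_tuple0 !big_ord0.
rewrite avg_cons_tuple big_ord_recl -(IH (fun k => G (lift ord0 k))) mulrC -avgZ.
apply: eq_avg => j; rewrite mulrC -avgZ; apply: eq_avg => t.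
by rewrite big_ord_recl tnth0; congr (_ * _); apply: eq_bigr => k _; rewrite tnthS.
Qed.

Lemma avg_marginal (J : finType) n (F : J -> R) (k0 : 'I_n) : (0 < #|J|)%N ->
  avg (fun t : n.-tuple J => F (tnth t k0)) = avg F.
Proof.
move=> J0; have := avg_prod (fun k j => if k == k0 then F j else 1).
rewrite (bigD1 k0)//= eqxx [X in _ * X]big1 ?mulr1; last first.
  by move=> k /negbTE ->; rewrite avg_cst.
move=> <-; apply: eq_avg => t; rewrite (bigD1 k0)//= eqxx big1 ?mulr1//.
by move=> k /negbTE ->.
Qed.

Lemma avg_sqr_resample (J : finType) n (a : J -> R) : (0 < #|J|)%N ->
  avg a = 0 ->
  avg (fun t : n.-tuple J => (\sum_(k < n) a (tnth t k)) ^+ 2) =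
  n%:R * avg (fun j => a j ^+ 2).
Proof.
move=> J0 a0; pose v := avg (fun j => a j ^+ 2).
(* The values of [a] are read as steps of a walk on the line. The claim is made for every starting
   point so that the induction can move it. *)
suff H x : iter n (avop (a : J -> R^o)) (fun y : R => y ^+ 2) x = x ^+ 2 + n%:R * v.
  have := avg_resample (a : J -> R^o) (fun y : R => y ^+ 2) n 0.
  rewrite H expr0n add0r => <-; apply: eq_avg => t; by rewrite add0r.
elim: n x => [|n IH] x; first by rewrite mul0r addr0.
rewrite iterS [LHS](@eq_avg _ _ (fun j => x ^+ 2 + (2 * x * a j
    + (a j ^+ 2 + n%:R * v)))); last by move=> j; rewrite IH; ring.
rewrite (avgD (fun=> x ^+ 2)) (avgD (fun j => 2 * x * a j)).
rewrite (avgD (fun j => a j ^+ 2)) (avgZ (2 * x) a) a0 !avg_cst// -natr1 -/v.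
by ring.
Qed.

Lemma avg_chebyshev (I : finType) (F : I -> R) e : 0 < e ->
  avg (fun i => (e <= `|F i|)%R%:R) <= e ^- 2 * avg (fun i => F i ^+ 2).
Proof.
move=> e0; rewrite -avgZ; apply: ler_avg => i.
have [eF|_] := leP e `|F i|; last by rewrite mulr_ge0 ?sqr_ge0// invr_ge0 sqr_ge0.
rewrite mulrC ler_pdivlMr ?exprn_gt0// mul1r -[leRHS]real_normK ?num_real//.
by rewrite ler_pXn2r ?nnegrE ?(ltW e0).
Qed.

End Averages.

(** * Size of the binomial coefficients *)

Lemma leq_bin_center k j : ('C(k.*2, j) <= 'C(k.*2, k))%N.
Proof.
have up i n : (i < k)%N -> ('C(k.*2, i) <= 'C(k.*2, i.+1))%N.
  move=> ik; rewrite -(@leq_pmul2l i.+1)// mul_bin_left.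
  by rewrite leq_mul2r; apply/orP; right; rewrite -addnn; lia.
have mono i : (i <= k)%N -> ('C(k.*2, i) <= 'C(k.*2, k))%N.
  move=> ik; rewrite -(subKn ik); elim: (k - i)%N => [|n IH]; first by rewrite subn0.
  apply: leq_trans IH; case: (leqP k n) => kn; last first.
    by rewrite [in leqRHS](_ : k - n = (k - n.+1).+1)%N; [apply: up => //|]; lia.
  have -> : (k - n.+1 = 0)%N by lia.
  by have -> : (k - n = 0)%N by lia.
have [jk|kj] := leqP j k; first exact: mono.
have [j2|j2] := leqP j k.*2; last by rewrite bin_small.
by rewrite -bin_sub//; apply: mono; rewrite -addnn; lia.
Qed.

(** The factor [2k + 1] is what makes the induction close: the step amounts to
    [(2k + 1)(2k + 3) <= (2k + 2)^2]. *)
Lemma bin_center_le k : ('C(k.*2, k) ^ 2 * k.*2.+1 <= 16 ^ k)%N.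
Proof.
elim: k => [|k IH]; first by rewrite bin0.
have H : (k.+1 * 'C(k.+1.*2, k.+1) = 2 * k.*2.+1 * 'C(k.*2, k))%N.
  have e1 : (k.+1 * 'C(k.+1.*2, k.+1) = k.+1.*2 * 'C(k.*2.+1, k))%N.
    by rewrite doubleS -mul_bin_diag.
  have e2 : (k.+1 * 'C(k.*2.+1, k) = k.*2.+1 * 'C(k.*2, k))%N.
    rewrite -[k.*2 in RHS]/(k.*2.+1.-1) mul_bin_down; congr (_ * _)%N.
    by rewrite -addnn; lia.
  by rewrite e1 (_ : k.+1.*2 = 2 * k.+1)%N; [rewrite -mulnA e2 mulnA|lia].
rewrite -(@leq_pmul2l (k.+1 ^ 2)) ?expn_gt0// mulnA -expnMn H.
have -> : ((2 * k.*2.+1 * 'C(k.*2, k)) ^ 2 * k.+1.*2.+1 =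
   4 * (k.*2.+1 * k.+1.*2.+1) * ('C(k.*2, k) ^ 2 * k.*2.+1))%N by ring.
apply: (@leq_trans (4 * (k.*2.+1 * k.+1.*2.+1) * 16 ^ k)); first by rewrite leq_mul2l IH orbT.
rewrite [(16 ^ k.+1)%N]expnS [(k.+1 ^ 2 * _)%N]mulnA leq_mul2r; apply/orP; right.
by rewrite -!addnn; nia.
Qed.

Lemma bin_le_sqrt (R : realType) n j : (0 < n)%N ->
  'C(n, j)%:R / 2 ^+ n <= (Num.sqrt n%:R)^-1 :> R.
Proof.
move=> n0; have H : ('C(n, j) ^ 2 * n <= 4 ^ n)%N.
  have e k : (4 ^ k.*2 = 16 ^ k)%N by rewrite -muln2 mulnC expnM.
  have [k [->|->]] : exists k, n = k.*2 \/ n = k.*2.+1.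
    exists n./2; rewrite -{1 3}(odd_double_half n); case: (odd n); lia.
    rewrite e; apply: leq_trans (bin_center_le k); rewrite leq_mul//.
    by rewrite leq_sqr leq_bin_center.
  rewrite [(4 ^ _)%N]expnS e.
  (* Pascal's rule bounds an odd row by twice the center of the preceding even row; squared, the 2
     is the extra factor 4 available in [4 ^ n]. *)
  have C2 : ('C(k.*2.+1, j) <= 2 * 'C(k.*2, k))%N.
    case: j => [|j]; last by rewrite binS; have := leq_bin_center k j;
      have := leq_bin_center k j.+1; lia.
    by rewrite bin0; have := bin_gt0 k.*2 k; rewrite -addnn; lia.
  apply: (@leq_trans (4 * ('C(k.*2, k) ^ 2 * k.*2.+1))).
    rewrite mulnA leq_mul2r; apply/orP; right.
    by rewrite (_ : 4 = 2 ^ 2)%N// -expnMn leq_sqr.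
  by rewrite leq_mul2l bin_center_le orbT.
have s0 : 0 < Num.sqrt n%:R :> R by rewrite sqrtr_gt0 ltr0n.
rewrite ler_pdivrMr ?exprn_gt0// mulrC ler_pdivlMr//.
rewrite -(@ler_pXn2r _ 2) ?nnegrE ?mulr_ge0 ?sqrtr_ge0 ?exprn_ge0//.
rewrite exprMn sqr_sqrtr//.
have -> : (2 ^+ n) ^+ 2 = (4 ^ n)%N%:R :> R.
  by rewrite natrX -exprM mulnC exprM -[2 ^+ 2](@natrX R 2 2).
by rewrite -natrX -natrM ler_nat // mulnC.
Qed.

(** The diameter is real because it will come from a square root. Only the smallest and largest
    elements of [S] matter. *)
Lemma card_diam (R : realType) N (S : {set 'I_N}) (D : R) : 0 <= D ->
  (forall i j, i \in S -> j \in S -> (i <= j)%N -> (j - i)%N%:R <= D) ->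
  #|S|%:R <= D + 1.
Proof.
move=> D0 SD; have [->|[i0 i0S]] := set_0Vmem S; first by rewrite cards0 addr_ge0.
have [i iS imin] := arg_minnP (fun i : 'I_N => nat_of_ord i) i0S.
have [j jS jmax] := arg_maxnP (fun i : 'I_N => nat_of_ord i) i0S.
have ij : (i <= j)%N := imin j jS.
apply: (@le_trans _ _ ((j - i).+1)%:R); last by rewrite -natr1 lerD2r SD.
rewrite ler_nat cardE -(size_map val) -(size_iota i (j - i).+1).
apply: uniq_leq_size; first by rewrite map_inj_uniq ?enum_uniq//; exact: val_inj.
move=> _ /mapP[k + ->]; rewrite mem_enum mem_iota => kS.
by have := imin k kS; have := jmax k kS => /=; lia.
Qed.

(** * Second-order comparison of steps, and anti-concentration of sign walks *)

Section Rademacher.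
Variable R : realType.

(** Uncentered second moments, hence a covariance only for families of mean zero. *)
Definition covmx (I : finType) d (h : I -> 'cV[R]_d) : 'M[R]_d :=
  \matrix_(j, k) avg (fun i => h i j 0 * h i k 0).

(** Averaging [quad q] over a family pairs [q] with its [covmx] in this way. *)
Definition mxdot d (q M : 'M[R]_d) : R := \sum_j \sum_k q j k * M j k.

Lemma mxdotB d (q M N : 'M[R]_d) : mxdot q (M - N) = mxdot q M - mxdot q N.
Proof.
rewrite /mxdot -sumrB; apply: eq_bigr => j _; rewrite -sumrB.
by apply: eq_bigr => k _; rewrite !mxE mulrBr.
Qed.

Lemma mxdot_le d (q M : 'M[R]_d) C e : frobenius q <= C ->
  (forall j k, `|M j k| <= e) -> `|mxdot q M| <= C * (d%:R ^+ 2 * e).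
Proof.
move=> qC Me; apply: le_trans (ler_norm_sum _ _ _) _.
apply: (@le_trans _ _ (\sum_(j < d) \sum_(k < d) C * e)).
  apply: ler_sum => j _; apply: le_trans (ler_norm_sum _ _ _) _.
  apply: ler_sum => k _; rewrite normrM ler_pM//.
  exact: le_trans (ler_entry_frobenius _ _ _) qC.
rewrite !sumr_const !card_ord -[_ *+ d]mulr_natl -[(C * e) *+ d]mulr_natl.
by rewrite le_eqVlt; apply/orP; left; apply/eqP; ring.
Qed.

Lemma avop_taylor d (I : finType) (h : I -> 'cV[R]_d) f C l (q : 'cV[R]_d -> 'M[R]_d) :
  (0 < #|I|)%N ->
  (forall x h, `|f (x + h) - f x - dot (l x) h - quad (q x) h|
               <= C * frobenius h ^+ 3) ->
  (forall j, avg (fun i => h i j 0) = 0) ->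
  forall x, `|avop h f x - f x - mxdot (q x) (covmx h)|
            <= C * avg (fun i => frobenius (h i) ^+ 3).
Proof.
move=> I0 fT h0 x.
have -> : avop h f x - f x - mxdot (q x) (covmx h) =
    avg (fun i => f (x + h i) - f x - dot (l x) (h i) - quad (q x) (h i)).
  rewrite !avgB avg_cst// -/(avop h f x); congr (_ - _).
    rewrite /dot avg_sum big1 ?subr0// => j _.
    by rewrite avgZ h0 mulr0.
  rewrite /quad avg_sum; apply: eq_bigr => j _; rewrite avg_sum.
  by apply: eq_bigr => k _; rewrite avgZ mxE.
apply: le_trans (ler_norm_avg _) _; rewrite -avgZ.
exact: ler_avg.
Qed.

(** Mean zero removes the linear terms, and the quadratic ones see a step only through [covmx]. The
    constant comes from [f] alone, ahead of the index types, because the bootstrap draws from a set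
    that grows with [m]. *)
Lemma taylor3_swap d (f : 'cV[R]_d -> R) : taylor3 f -> exists2 C : R, 0 <= C &
  forall (I J : finType) (h : I -> 'cV[R]_d) (k : J -> 'cV[R]_d) e,
  (0 < #|I|)%N -> (0 < #|J|)%N ->
  (forall j, avg (fun i => h i j 0) = 0) ->
  (forall j, avg (fun i => k i j 0) = 0) ->
  (forall i j, `|(covmx h - covmx k) i j| <= e) ->
  forall x, `|avop h f x - avop k f x| <= C * (d%:R ^+ 2 * e
    + avg (fun i => frobenius (h i) ^+ 3) + avg (fun i => frobenius (k i) ^+ 3)).
Proof.
move=> [C [l [q [C0 qC fT]]]]; exists C => // I J h k e I0 J0 h0 k0 hk x.
have Hh := avop_taylor I0 fT h0 x; have Hk := avop_taylor J0 fT k0 x.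
have Hq := mxdot_le (qC x) hk; rewrite mxdotB in Hq.
have -> : avop h f x - avop k f x =
    (mxdot (q x) (covmx h) - mxdot (q x) (covmx k)) +
    (avop h f x - f x - mxdot (q x) (covmx h)) -
    (avop k f x - f x - mxdot (q x) (covmx k)) by ring.
apply: le_trans (ler_normB _ _) _; rewrite mulrDr lerD//.
by apply: le_trans (ler_normD _ _) _; rewrite mulrDr lerD.
Qed.

Definition sgnb (b : bool) : R := (-1) ^+ b.

Definition rademacher d (L : 'M[R]_d) (c : R) (s : {ffun 'I_d -> bool}) : 'cV[R]_d :=
  c *: \sum_k sgnb (s k) *: col k L.

Lemma card_signs d : (0 < #|{: {ffun 'I_d -> bool}}|)%N.
Proof. by rewrite card_ffun expn_gt0 card_bool. Qed.

(** A symmetry of the uniform law on sign vectors: a moment odd in coordinate [k0] equals its own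
    negative. *)
Definition flip d (k0 : 'I_d) (s : {ffun 'I_d -> bool}) : {ffun 'I_d -> bool} :=
  [ffun k => s k (+) (k == k0)].

Lemma flipK d (k0 : 'I_d) : involutive (flip k0).
Proof. by move=> s; apply/ffunP => k; rewrite !ffunE -addbA addbb addbF. Qed.

Lemma avg_flip d (k0 : 'I_d) (F : {ffun 'I_d -> bool} -> R) :
  avg (fun s => F (flip k0 s)) = avg F.
Proof.
by congr (_ * _); rewrite [RHS](reindex_inj (inv_inj (flipK k0))).
Qed.

Lemma sgnb_flip d (k0 k : 'I_d) s :
  sgnb (flip k0 s k) = if k == k0 then - sgnb (s k) else sgnb (s k).
Proof.
rewrite ffunE /sgnb; case: (k == k0); last by rewrite addbF.
by rewrite addbT; case: (s k); rewrite /= ?expr0 ?expr1 ?opprK.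
Qed.

Lemma avg_sgnb d (k : 'I_d) : avg (fun s : {ffun 'I_d -> bool} => sgnb (s k)) = 0.
Proof.
have H : avg (fun s : {ffun 'I_d -> bool} => sgnb (s k)) =
         -1 * avg (fun s : {ffun 'I_d -> bool} => sgnb (s k)).
  by rewrite -[LHS](avg_flip k) -avgZ; apply: eq_avg => s;
    rewrite sgnb_flip eqxx mulN1r.
by move: H; lra.
Qed.

Lemma avg_sgnb2 d (k l : 'I_d) :
  avg (fun s : {ffun 'I_d -> bool} => sgnb (s k) * sgnb (s l)) = (k == l)%:R.
Proof.
have [->|kl] := eqVneq k l.
  rewrite -[RHS](@avg_cst R {ffun 'I_d -> bool}) ?card_signs//.
  by apply: eq_avg => s; rewrite /sgnb -expr2 sqrr_sign.
have H : avg (fun s : {ffun 'I_d -> bool} => sgnb (s k) * sgnb (s l)) =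
    -1 * avg (fun s : {ffun 'I_d -> bool} => sgnb (s k) * sgnb (s l)).
  rewrite -[LHS](avg_flip k) -avgZ; apply: eq_avg => s.
  by rewrite !sgnb_flip eqxx eq_sym (negbTE kl); ring.
by rewrite /=; move: H; lra.
Qed.

Lemma rademacherE d (L : 'M[R]_d) c s j : rademacher L c s j 0 = c * \sum_k sgnb (s k) * L j k.
Proof.
rewrite mxE summxE; congr (_ * _); apply: eq_bigr => k _; by rewrite !mxE.
Qed.

Lemma avg_rademacher d (L : 'M[R]_d) c j : avg (fun s => rademacher L c s j 0) = 0.
Proof.
under eq_avg do rewrite rademacherE.
rewrite avgZ avg_sum big1 ?mulr0// => k _.
by under eq_avg do rewrite mulrC; rewrite avgZ avg_sgnb mulr0.
Qed.

Lemma covmx_rademacher d (L : 'M[R]_d) c : covmx (rademacher L c) = c ^+ 2 *: (L *m L^T).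
Proof.
apply/matrixP => i j; rewrite !mxE.
rewrite [LHS](@eq_avg _ {ffun 'I_d -> bool} _ (fun s => c ^+ 2 *
  \sum_k \sum_l L i k * L j l * (sgnb (s k) * sgnb (s l)))); last first.
  move=> s; rewrite !rademacherE (_ : c * _ * _ = c ^+ 2 *
    ((\sum_k sgnb (s k) * L i k) * (\sum_k sgnb (s k) * L j k))); last by ring.
  congr (_ * _); rewrite big_distrl /=; apply: eq_bigr => k _.
  by rewrite big_distrr /=; apply: eq_bigr => l _; ring.
rewrite avgZ; congr (_ * _); rewrite avg_sum; apply: eq_bigr => k _.
rewrite avg_sum (bigD1 k)//= avgZ avg_sgnb2 eqxx mulr1 big1 ?addr0 ?mxE//.
by move=> l lk; rewrite avgZ avg_sgnb2 eq_sym (negbTE lk) mulr0.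
Qed.

Lemma rademacher_le d (L : 'M[R]_d) c s :
  frobenius (rademacher L c s) <= `|c| * \sum_k frobenius (col k L).
Proof.
rewrite frobeniusZ ler_wpM2l//; apply: le_trans (frobenius_sum _) _.
apply: ler_sum => k _; rewrite frobeniusZ /sgnb normrX normrN1 expr1n mul1r.
exact: lexx.
Qed.

Lemma iter_avop_rademacher_sqr d (L : 'M[R]_d) c n x :
  iter n (avop (rademacher L c)) (fun y => frobenius y ^+ 2) x =
  frobenius x ^+ 2 + n%:R * (c ^+ 2 * \tr (L *m L^T)).
Proof.
elim: n x => [|n IH] x; first by rewrite mul0r addr0.
have H : avg (fun s => frobenius (rademacher L c s) ^+ 2) = c ^+ 2 * \tr (L *m L^T).
  under eq_avg do rewrite sqr_frobenius_col.
  rewrite avg_sum /mxtrace big_distrr /=; apply: eq_bigr => i _.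
  have := covmx_rademacher L c => /matrixP/(_ i i); rewrite !mxE => <-.
  by apply: eq_avg => s; rewrite expr2.
rewrite iterS [LHS](@eq_avg _ {ffun 'I_d -> bool} _ (fun s => (frobenius x ^+ 2 +
  n%:R * (c ^+ 2 * \tr (L *m L^T))) +
  (2 * (\sum_i x i 0 * rademacher L c s i 0) + frobenius (rademacher L c s) ^+ 2))); last first.
  by move=> s; rewrite IH sqr_frobeniusD /dot; ring.
rewrite (avgD (fun=> _ + _)) avg_cst ?card_signs// avgD H avgZ avg_sum big1.
  by rewrite -natr1; ring.
by move=> i _; rewrite avgZ avg_rademacher mulr0.
Qed.

(** The sign of column [k0] is independent of the other signs, so a step is a residual step followed
    by a two-point step along that column. Pairing each sign vector with its flip proves it; the
    residual [r] still ranges over all sign vectors and takes each value for both signs of [k0]. *)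
Lemma avop_rademacher_split d (L : 'M[R]_d) c (k0 : 'I_d) :
  exists r : {ffun 'I_d -> bool} -> 'cV[R]_d,
  forall f : 'cV[R]_d -> R, avop (rademacher L c) f =
    avop r (avop (fun b : bool => sgnb b *: (c *: col k0 L)) f).
Proof.
pose b := c *: col k0 L.
exists (fun s => rademacher L c s - sgnb (s k0) *: b) => f; apply/funext => x.
have radflip s : rademacher L c (flip k0 s) = rademacher L c s - 2 *: (sgnb (s k0) *: b).
  apply/matrixP => i j; rewrite (ord1 j) [RHS]mxE !rademacherE !mxE.
  rewrite (bigD1 k0)//= [in RHS](bigD1 k0)//= sgnb_flip eqxx.
  under eq_bigr => k kk do rewrite sgnb_flip (negbTE kk).
  by ring.
have -> : avop (rademacher L c) f x =
    avg (fun s => 2^-1 * (f (x + rademacher L c s) + f (x + rademacher L c (flip k0 s)))).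
  rewrite avgZ avgD (avg_flip k0 (fun s => f (x + rademacher L c s))).
  by rewrite -/(avop (rademacher L c) f x); field.
apply: eq_avg => s; rewrite /avop /avg card_bool big_bool; congr (_ * _).
rewrite radflip -/b; clearbody b; set v := rademacher L c s.
case: (s k0); rewrite /sgnb expr0 expr1 !scaleN1r !scale1r.
  congr (f _ + f _); apply/matrixP => i j; rewrite (ord1 j) !mxE; ring.
rewrite addrC.
congr (f _ + f _); apply/matrixP => i j; rewrite (ord1 j) !mxE; ring.
Qed.

Lemma iter_sgn_binomial d (b : 'cV[R]_d) n (f : 'cV[R]_d -> R) x :
  iter n (avop (fun s : bool => sgnb s *: b)) f x =
  2 ^- n * \sum_(j < n.+1) 'C(n, j)%:R * f (x + (n%:R - 2 * j%:R) *: b).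
Proof.
elim: n x => [|n IH] x.
  by rewrite big_ord1 bin0 expr0 invr1 !mul1r mulr0 subr0 scale0r addr0.
set V := avop _ in IH *.
transitivity (2^-1 * (iter n V f (x - b) + iter n V f (x + b))).
  rewrite iterS {1}/V /avop /avg card_bool big_bool /sgnb expr1 expr0.
  by rewrite scaleN1r scale1r.
rewrite !IH.
rewrite exprS invfM -mulrDr !mulrA; congr (_ * _).
rewrite [in RHS]big_ord_recl bin0 mul1r.
under [in RHS]eq_bigr => j _ do rewrite lift0 binS natrD mulrDl.
rewrite big_split /= addrA [RHS]addrC; congr (_ + _).
  apply: eq_bigr => j _; congr (_ * f _); rewrite -addrA; congr (_ + _).
  by rewrite -[X in - X + _]scale1r -scaleNr -scalerDl -!(natr1 n, natr1 j); congr (_ *: _); ring.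
rewrite [in RHS]big_ord_recr /= bin_small// mul0r addr0 [in LHS]big_ord_recl bin0 mul1r.
congr (_ + _).
  congr f; rewrite -addrA; congr (_ + _).
  by rewrite -[X in X + _]scale1r -scalerDl -(natr1 n); congr (_ *: _) => /=; ring.
apply: eq_bigr => j _; congr (_ * f _); rewrite -addrA; congr (_ + _).
rewrite -[X in X + _]scale1r -scalerDl lift0 -!(natr1 n, natr1 j); congr (_ *: _); ring.
Qed.

(* On the line [x + t b] the squared norm is a quadratic polynomial in [t], so
   the walk positions with squared norm in [A, B] fill two short runs, and each
   single position has binomial probability at most [n^(-1/2)]. *)
Lemma sgn_anticoncentration d (b x : 'cV[R]_d) n A B : (0 < n)%N -> b != 0 -> A <= B ->
  iter n (avop (fun s : bool => sgnb s *: b))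
    (fun y => (A <= frobenius y ^+ 2 <= B)%R%:R) x
  <= (Num.sqrt (B - A) / frobenius b + 2) / Num.sqrt n%:R.
Proof.
move=> n0 b0 AB; rewrite iter_sgn_binomial.
have nb : 0 < frobenius b by rewrite lt_def frobenius_eq0 b0 frobenius_ge0.
pose z (j : 'I_n.+1) : R := n%:R - 2 * j%:R.
(* The vertex of the parabola [g]. On one side of it, [|g t - g s|] is at least
   [frobenius b ^+ 2 * (t - s) ^+ 2], which bounds the length of a run; hence the split into [S1]
   and [S2]. *)
pose z0 := - dot x b / frobenius b ^+ 2.
pose g (t : R) := frobenius (x + t *: b) ^+ 2.
have gB s t : g t - g s = frobenius b ^+ 2 * (t - s) * (t + s - 2 * z0).
  rewrite /g !sqr_frobeniusD !frobeniusZ !dotZr !exprMn !real_normK ?num_real//.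
  by rewrite /z0; field; rewrite gt_eqF.
pose D := Num.sqrt (B - A) / frobenius b / 2.
have D0 : 0 <= D by rewrite !divr_ge0 ?sqrtr_ge0 ?frobenius_ge0.
have diamz s t : A <= g s <= B -> A <= g t <= B -> s <= t ->
    0 <= (t - s) * (t + s - 2 * z0) - (t - s) ^+ 2 -> t - s <= 2 * D.
  move=> /andP[As sB] /andP[At tB] st H.
  have : frobenius b ^+ 2 * (t - s) ^+ 2 <= B - A.
    apply: (@le_trans _ _ (g t - g s)); last by lra.
    by rewrite gB -mulrA ler_pM2l ?exprn_gt0//; lra.
  have -> : 2 * D = Num.sqrt (B - A) / frobenius b by rewrite /D; field; rewrite gt_eqF.
  rewrite ler_pdivlMr// [_ * frobenius b]mulrC -exprMn => H'.
  rewrite -(ger0_norm (_ : 0 <= frobenius b * (t - s))) ?mulr_ge0 ?subr_ge0 ?(ltW nb)//.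
  by rewrite -sqrtr_sqr ler_sqrt// subr_ge0.
pose S1 := [set j : 'I_n.+1 | (A <= g (z j) <= B) && (z0 <= z j)]%SET.
pose S2 := [set j : 'I_n.+1 | (A <= g (z j) <= B) && (z j < z0)]%SET.
have zB (i j : 'I_n.+1) : (i <= j)%N -> (j - i)%N%:R = (z i - z j) / 2.
  by move=> ij; rewrite natrB// /z; field.
have zle (i j : 'I_n.+1) : (i <= j)%N -> z j <= z i.
  by move=> ij; rewrite /z lerD2l lerN2 ler_pM2l// ler_nat.
have c1 : #|S1|%:R <= D + 1.
  apply: card_diam => // i j; rewrite !inE => /andP[gi zi] /andP[gj zj] ij.
  rewrite zB// ler_pdivrMr// mulrC; apply: diamz => //; first exact: zle.
  rewrite (_ : _ - _ = (z i - z j) * (2 * (z j - z0))); last by ring.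
  by rewrite mulr_ge0 ?subr_ge0 ?zle// mulr_ge0// subr_ge0.
have c2 : #|S2|%:R <= D + 1.
  apply: card_diam => // i j; rewrite !inE => /andP[gi zi] /andP[gj zj] ij.
  rewrite zB// ler_pdivrMr// mulrC.
  have gN t : frobenius (x + t *: b) ^+ 2 = g t by [].
  have := gB (z j) (z i); have zij := zle _ _ ij => gBij.
  have : frobenius b ^+ 2 * (z i - z j) ^+ 2 <= B - A.
    apply: (@le_trans _ _ (g (z j) - g (z i))); last by move: gi gj; lra.
    rewrite gB -mulrA ler_pM2l ?exprn_gt0// -subr_ge0.
    rewrite (_ : _ - _ = (z i - z j) * (2 * (z0 - z i))); last by ring.
    by rewrite mulr_ge0 ?subr_ge0// mulr_ge0// subr_ge0 ltW.
  have -> : 2 * D = Num.sqrt (B - A) / frobenius b by rewrite /D; field; rewrite gt_eqF.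
  rewrite ler_pdivlMr// [_ * frobenius b]mulrC -exprMn => H'.
  rewrite -(ger0_norm (_ : 0 <= frobenius b * (z i - z j))) ?mulr_ge0 ?subr_ge0 ?(ltW nb)//.
  by rewrite -sqrtr_sqr ler_sqrt// subr_ge0.
have s0 : 0 < Num.sqrt n%:R :> R by rewrite sqrtr_gt0 ltr0n.
rewrite big_distrr /=.
apply: (@le_trans _ _ (\sum_(j < n.+1) (Num.sqrt n%:R)^-1 *
   ((j \in S1)%:R + (j \in S2)%:R))).
  apply: ler_sum => j _; rewrite mulrA.
  have b1 : 0 <= 2 ^- n * 'C(n, j)%:R :> R by rewrite mulr_ge0// invr_ge0 exprn_ge0.
  apply: ler_pM; [exact: b1|exact: ler0n|by rewrite mulrC bin_le_sqrt|].
  rewrite !inE -/(g _) -/(z j); case: (A <= g (z j) <= B) => /=; last by rewrite addr0.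
  by case: (leP z0 (z j)) => /=; rewrite ?addr0 ?add0r.
rewrite -mulr_sumr big_split /= -!natr_sum.
have cE (S : {set 'I_n.+1}) : (\sum_(i < n.+1) (i \in S) = #|S|)%N.
  by rewrite -sum1_card [RHS]big_mkcond /=; apply: eq_bigr => i _; case: (i \in S).
rewrite !cE mulrC ler_wpM2r ?invr_ge0 ?(ltW s0)//.
have -> : Num.sqrt (B - A) / frobenius b + 2 = (D + 1) + (D + 1).
  by rewrite /D; field; rewrite gt_eqF.
exact: lerD.
Qed.

(* Only the signs of one nonzero column are used; the others are averaged out. *)
Lemma rademacher_anticoncentration d (L : 'M[R]_d) k0 n A B x :
  (0 < n)%N -> col k0 L != 0 -> A <= B ->
  iter n (avop (rademacher L (Num.sqrt n%:R)^-1))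
    (fun y => (A <= frobenius y ^+ 2 <= B)%R%:R) x
  <= Num.sqrt (B - A) / frobenius (col k0 L) + 2 / Num.sqrt n%:R.
Proof.
move=> n0 L0 AB; set c := _^-1.
have s0 : 0 < Num.sqrt n%:R :> R by rewrite sqrtr_gt0 ltr0n.
have [r rE] := avop_rademacher_split L c k0.
have rademacherE n' (f : 'cV[R]_d -> R) : iter n' (avop (rademacher L c)) f = iter n' (avop r)
    (iter n' (avop (fun b : bool => sgnb b *: (c *: col k0 L))) f).
  by elim: n' => //= n' ->; rewrite rE -iter_avop_comm.
rewrite rademacherE; apply: iter_avop_ub; first exact: card_signs.
move=> y; apply: le_trans (sgn_anticoncentration _ _ _ _) _ => //.
  by rewrite scaler_eq0 negb_or L0 andbT invr_eq0 gt_eqF.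
rewrite frobeniusZ ger0_norm ?invr_ge0 ?(ltW s0)// mulrDl lerD2r /c.
rewrite le_eqVlt; apply/orP; left; apply/eqP; field.
by rewrite frobenius_eq0 L0 gt_eqF.
Qed.

End Rademacher.

(** * Multinomial weights as resampling counts *)

Section Multinomial.
Variable R : realType.

Definition cnt m N (t : N.-tuple 'I_m) : m.-tuple nat :=
  [tuple count_mem i t | i < m].

Lemma tnth_cnt m N (t : N.-tuple 'I_m) i : tnth (cnt t) i = count_mem i t.
Proof. by rewrite tnth_mktuple. Qed.

Lemma count_mem_sum m N (t : N.-tuple 'I_m) i :
  count_mem i t = (\sum_(k < N) (tnth t k == i))%N.
Proof.
rewrite -sum1_count big_tuple big_mkcond /=; apply: eq_bigr => k _.
by case: eqP.
Qed.

Lemma sum_cnt m N (t : N.-tuple 'I_m) : (\sum_i tnth (cnt t) i = N)%N.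
Proof.
under eq_bigr do rewrite tnth_cnt count_mem_sum.
rewrite exchange_big /= (eq_bigr (fun=> 1%N)) ?sum1_card ?card_ord// => k _.
rewrite (bigD1 (tnth t k))//= eqxx big1// => i /negbTE.
by rewrite eq_sym => ->.
Qed.

Lemma sum_cnt_scale (V : lmodType R) m N (t : N.-tuple 'I_m) (v : 'I_m -> V) :
  \sum_i (tnth (cnt t) i)%:R *: v i = \sum_(k < N) v (tnth t k).
Proof.
under eq_bigr do rewrite tnth_cnt count_mem_sum natr_sum scaler_suml.
rewrite exchange_big /=; apply: eq_bigr => k _.
rewrite (bigD1 (tnth t k))//= eqxx scale1r big1 ?addr0// => i /negbTE.
by rewrite eq_sym => ->; rewrite scale0r.
Qed.

(** Truncated subtraction leaves a zero count unchanged, whence the positivity guard in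
    [cnt_cons]. *)
Definition decr m (k : m.-tuple nat) (j : 'I_m) : m.-tuple nat :=
  [tuple (tnth k i - (i == j))%N | i < m].

Lemma tnth_decr m (k : m.-tuple nat) j i :
  tnth (decr k j) i = (tnth k i - (i == j))%N.
Proof. by rewrite tnth_mktuple. Qed.

Lemma cnt_cons m N (j : 'I_m) (t : N.-tuple 'I_m) (k : m.-tuple nat) :
  (cnt [tuple of j :: t] == k) = (0 < tnth k j)%N && (cnt t == decr k j).
Proof.
apply/eqP/andP => [<-|[kj /eqP tk]].
  rewrite tnth_cnt /= eqxx; split=> //; apply/eqP/eq_from_tnth => i.
  by rewrite tnth_decr !tnth_cnt /= [j == i]eq_sym; case: (i == j); lia.
apply/eq_from_tnth => i; rewrite tnth_cnt /=.
rewrite -[count_mem i t]tnth_cnt tk tnth_decr [j == i]eq_sym.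
by case: eqP => [->|_]; lia.
Qed.

(** Induction on the number of draws by splitting off the first: drawing [j] first contributes a
    term proportional to [tnth k j], and these sum to [N + 1], which completes the factorial. If [k]
    has the wrong total, both sides vanish. *)
Lemma multinomial_pmfE m N (k : m.-tuple nat) : (0 < m)%N ->
  multinomial_pmf N (fun=> m%:R^-1 : R) k =
  avg (fun t : N.-tuple 'I_m => (cnt t == k)%:R).
Proof.
move=> m0; elim: N k => [|N IH] k.
  rewrite avg_tuple0 /multinomial_pmf.
  have [k0|k0] := eqVneq (\sum_i tnth k i)%N 0%N.
    have kz i : tnth k i = 0%N.
      by apply/eqP; move/eqP: k0; rewrite sum_nat_eq0 => /forallP/(_ i).
    rewrite !big1 ?invr1 ?mulr1//; [|by move=> i _; rewrite kz..].
    suff -> : cnt [tuple] = k by rewrite eqxx.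
    by apply/eq_from_tnth => i; rewrite tnth_cnt kz.
  case: eqP => // E; case/negP: k0; rewrite -E; apply/eqP.
  by rewrite sum_cnt.
rewrite avg_cons_tuple.
have -> : avg (fun j => avg (fun t : N.-tuple 'I_m =>
     (cnt [tuple of j :: t] == k)%:R : R)) =
   avg (fun j => (0 < tnth k j)%N%:R * multinomial_pmf N (fun=> m%:R^-1) (decr k j)).
  apply: eq_avg => j; rewrite IH -avgZ; apply: eq_avg => t.
  by rewrite cnt_cons; case: (0 < tnth k j)%N; rewrite ?mul1r ?mul0r.
have sumdecr j : (0 < tnth k j)%N ->
    (\sum_i tnth (decr k j) i).+1 = (\sum_i tnth k i)%N.
  move=> kj; rewrite (bigD1 j)//= [in RHS](bigD1 j)//= tnth_decr eqxx.
  rewrite -addSn; congr (_ + _)%N; first by lia.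
  by apply: eq_bigr => i /negbTE ij; rewrite tnth_decr ij subn0.
rewrite {1}/multinomial_pmf; case: ifP => [/eqP kN|kN]; last first.
  rewrite /avg big1 ?mulr0// => j _.
  have [kj|] := ltnP 0 (tnth k j); last by rewrite mul0r.
  by rewrite /multinomial_pmf -eqSS sumdecr// kN mulr0.
pose Q : R := (\prod_i (tnth k i)`!%:R)^-1; pose p : R := m%:R^-1.
have pE (k' : m.-tuple nat) : \prod_(i < m) p ^+ tnth k' i =
    p ^+ (\sum_i tnth k' i)%N by rewrite -expr_sum.
have H j : (0 < tnth k j)%N%:R * multinomial_pmf N (fun=> m%:R^-1) (decr k j) =
    (N`!%:R * Q * p ^+ N) * (tnth k j)%:R.
  have [kj|] := ltnP 0 (tnth k j); last first.
    by rewrite leqn0 => /eqP ->; rewrite mulr0 mul0r.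
  rewrite mul1r /multinomial_pmf -eqSS sumdecr// kN eqxx pE.
  have -> : (\sum_i tnth (decr k j) i = N)%N.
    by apply/eqP; rewrite -eqSS sumdecr// kN.
  rewrite -/p -[RHS]mulrA [p ^+ N * _]mulrC !mulrA; congr (_ * _).
  rewrite -!mulrA; congr (_ * _); rewrite /Q.
  rewrite (bigD1 j)//= [in RHS](bigD1 j)//= tnth_decr eqxx subn1.
  have -> : \prod_(i < m | i != j) (tnth (decr k j) i)`!%:R =
            \prod_(i < m | i != j) (tnth k i)`!%:R :> R.
    by apply: eq_bigr => i /negbTE ij; rewrite tnth_decr ij subn0.
  rewrite -{2}(prednK kj) factS natrM !invfM prednK//.
  rewrite mulrAC [_^-1 * _ * _]mulrAC mulVf ?mul1r// pnatr_eq0 -lt0n//.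
under eq_avg do rewrite H.
rewrite avgZ pE kN /avg card_ord -natr_sum kN -/p -/Q factS natrM exprS.
by rewrite -!mulrA; ring.
Qed.

End Multinomial.

(** * Linearization of the sketched estimators *)

Section Delta.
Variables (R : realType) (n d m : nat).
Variables (X : 'M[R]_(n, d)) (y : 'cV[R]_n) (lam : R) (s : 'I_m -> 'cV[R]_n).
Hypothesis m_gt0 : (0 < m)%N.

Let z i := zrow X (s i).
Let u i := urow y (s i).
Let psi i := influence X y lam (s i).
Let K := ridgeH X + lam%:M.
Let beta := ridge_beta X y lam.
Let m0 : m%:R != 0 :> R. Proof. by rewrite pnatr_eq0 -lt0n. Qed.

Lemma ridgeH_sym : (ridgeH X)^T = ridgeH X.
Proof. by rewrite /ridgeH linearZ /= trmx_mul trmxK. Qed.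

Lemma ridgeK_sym : (ridgeH X + lam%:M)^T = ridgeH X + lam%:M.
Proof. by rewrite linearD /= ridgeH_sym tr_scalar_mx. Qed.

Lemma ridgeH_psd v : 0 <= quad (ridgeH X) v.
Proof.
rewrite quad_mx /ridgeH -scalemxAr -scalemxAl mxE.
have -> : v^T *m (X^T *m X) *m v = (X *m v)^T *m (X *m v).
  by rewrite trmx_mul !mulmxA.
by rewrite -dot_mx dotvv mulr_ge0 ?invr_ge0// sqr_ge0.
Qed.

(** Weights equal to 1 give the sketch and multinomial counts give the bootstrap. The total [m]
    makes the constant part [lam *: beta] of the influence vectors match the ridge term exactly. *)
Lemma influence_sum (c : 'I_m -> R) : \sum_i c i = m%:R ->
  ridgeA X lam *m (m%:R^-1 *: (\sum_i (c i * u i) *: z i)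
    - (m%:R^-1 *: (\sum_i c i *: (z i *m (z i)^T)) + lam%:M) *m beta)
  = m%:R^-1 *: \sum_i c i *: psi i.
Proof.
move=> cm.
have -> : m%:R^-1 *: \sum_i c i *: psi i = ridgeA X lam *m (m%:R^-1 *:
    \sum_i c i *: ((u i - ((z i)^T *m beta) 0 0) *: z i - lam *: beta)).
  rewrite -scalemxAr mulmx_sumr; congr (_ *: _); apply: eq_bigr => i _.
  by rewrite -scalemxAr.
congr (_ *m _); rewrite mulmxDl mul_scalar_mx -scalemxAl mulmx_suml.
have lb : lam *: beta = m%:R^-1 *: \sum_i c i *: (lam *: beta).
  rewrite -scaler_suml cm. by rewrite !scalerA mulrA mulVf// mul1r.
rewrite [X in _ - (_ + X)]lb -scalerDr -scalerBr; congr (_ *: _).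
rewrite -big_split -sumrB; apply: eq_bigr => i _ /=.
set a := ((z i)^T *m beta) 0 0.
have zb : (z i)^T *m beta = a%:M by exact: mx11_scalar.
rewrite -scalemxAl -mulmxA zb mul_mx_scalar; apply/matrixP => j k.
by rewrite !mxE; ring.
Qed.

Definition sketch_sum : 'cV[R]_d :=
  (Num.sqrt m%:R)^-1 *: \sum_i psi i.

Definition boot_sum (w : m.-tuple nat) : 'cV[R]_d :=
  (Num.sqrt m%:R)^-1 *: (\sum_i (tnth w i)%:R *: psi i - \sum_i psi i).

Let sq0 : 0 < Num.sqrt m%:R :> R. Proof. by rewrite sqrtr_gt0 ltr0n. Qed.

Let sqm : Num.sqrt m%:R * m%:R^-1 = (Num.sqrt m%:R)^-1 :> R.
Proof.
have -> : m%:R^-1 = (Num.sqrt m%:R)^-1 * (Num.sqrt m%:R)^-1 :> R.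
  by rewrite -invfM -expr2 sqr_sqrtr.
by rewrite mulrA divff ?mul1r// gt_eqF.
Qed.

Variable c0 : R.
Hypotheses (c0_gt0 : 0 < c0) (cK : coercive c0 K).

Let Ku : K \in unitmx. Proof. exact: coercive_unit cK. Qed.

Lemma sketch_sumE : sketch_sum = Num.sqrt m%:R *:
  (ridgeA X lam *m (sketchg X y s - (sketchH X s + lam%:M) *m beta)).
Proof.
have := @influence_sum (fun=> 1) _; rewrite sumr_const card_ord => /(_ erefl).
have -> : \sum_i (1 * u i) *: z i = \sum_i u i *: z i.
  by apply: eq_bigr => i _; rewrite mul1r.
have -> : \sum_i 1 *: (z i *m (z i)^T) = \sum_i z i *m (z i)^T.
  by apply: eq_bigr => i _; rewrite scale1r.
have -> : \sum_i 1 *: psi i = \sum_i psi i.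
  by apply: eq_bigr => i _; rewrite scale1r.
by rewrite /sketchg /sketchH => ->; rewrite scalerA sqm.
Qed.

Lemma boot_sumE w : (\sum_i tnth w i = m)%N -> boot_sum w = Num.sqrt m%:R *:
  (ridgeA X lam *m ((bootg X y s w - (bootH X s w + lam%:M) *m beta) -
                    (sketchg X y s - (sketchH X s + lam%:M) *m beta))).
Proof.
move=> wm; rewrite mulmxBr scalerBr -sketch_sumE.
have := @influence_sum (fun i => (tnth w i)%:R) _; rewrite -natr_sum wm => /(_ erefl).
rewrite /bootg /bootH => ->.
by rewrite scalerA sqm -scalerBr.
Qed.

Lemma frobenius_delta (c : R) (Kb : 'M[R]_d) (v : 'cV[R]_d) : 0 < c -> coercive c Kb ->
  frobenius (invmx Kb *m (K *m v) - v) <= c^-1 * (frobenius (Kb - K) * frobenius v).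
Proof.
move=> c_gt0 cKb; have Kbu := coercive_unit c_gt0 cKb.
rewrite -[X in _ - X](mul1mx v) -(mulVmx Kbu) -mulmxA -mulmxBr -mulmxBl.
apply: le_trans (coercive_inv _ c_gt0 cKb) _; rewrite ler_pM2l ?invr_gt0//.
by rewrite [frobenius (Kb - K)]frobeniusBC; exact: ler_frobeniusM.
Qed.

Lemma coercive_ridge (Hb : 'M[R]_d) : frobenius (Hb - ridgeH X) <= c0 / 2 ->
  coercive (c0 / 2) (Hb + lam%:M).
Proof.
move=> HH; apply: coercive_perturb cK _.
by rewrite /K opprD addrACA subrr addr0.
Qed.

(** The scaled error is exactly [invmx Kh *m (K *m sketch_sum)], with [Kh] and [K] the sketched and
    true regularized matrices, so only the replacement of [Kh] by [K] costs anything. The factor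
    [2 / c0] is the inverse of the coercivity that [Kh] retains. *)
Lemma sketch_delta : frobenius (sketchH X s - ridgeH X) <= c0 / 2 ->
  frobenius (Num.sqrt m%:R *: (sketch_beta X y lam s - beta) - sketch_sum) <=
  2 / c0 * (frobenius (sketchH X s - ridgeH X) * frobenius sketch_sum).
Proof.
move=> HH; set Kh := sketchH X s + lam%:M.
have c2 : 0 < c0 / 2 by rewrite divr_gt0.
have cKh : coercive (c0 / 2) Kh by exact: coercive_ridge.
have Khu := coercive_unit c2 cKh.
have -> : Num.sqrt m%:R *: (sketch_beta X y lam s - beta) =
          invmx Kh *m (K *m sketch_sum).
  rewrite sketch_sumE -scalemxAr -scalemxAr; congr (_ *: _).
  rewrite [K *m _]mulmxA /ridgeA mulmxV// mul1mx mulmxBr mulmxA mulVmx// mul1mx.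
  by [].
apply: le_trans (frobenius_delta _ c2 cKh) _.
by rewrite /Kh /K opprD addrACA subrr addr0 invf_div.
Qed.

(** The influence vectors are taken at [beta], whereas the bootstrap is centered at the sketched
    estimator. This adds the second product, in which the change from the sketched to the bootstrap
    matrix meets the scaled sketch error. *)
Lemma boot_delta w : (\sum_i tnth w i = m)%N ->
  frobenius (sketchH X s - ridgeH X) <= c0 / 2 ->
  frobenius (bootH X s w - ridgeH X) <= c0 / 2 ->
  frobenius (Num.sqrt m%:R *: (boot_beta X y lam s w - sketch_beta X y lam s)
             - boot_sum w) <=
  2 / c0 * (frobenius (bootH X s w - ridgeH X) * frobenius (boot_sum w) +
            frobenius (bootH X s w - sketchH X s) *
            frobenius (Num.sqrt m%:R *: (sketch_beta X y lam s - beta))).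
Proof.
move=> wm HH Hw; set Kh := sketchH X s + lam%:M; set Kb := bootH X s w + lam%:M.
have c2 : 0 < c0 / 2 by rewrite divr_gt0.
have cKh : coercive (c0 / 2) Kh by exact: coercive_ridge.
have cKb : coercive (c0 / 2) Kb by exact: coercive_ridge.
have Khu := coercive_unit c2 cKh; have Kbu := coercive_unit c2 cKb.
set Dn := Num.sqrt m%:R *: (sketch_beta X y lam s - beta).
have -> : Num.sqrt m%:R *: (boot_beta X y lam s w - sketch_beta X y lam s) =
    invmx Kb *m (K *m boot_sum w) - invmx Kb *m ((Kb - Kh) *m Dn).
  rewrite (boot_sumE wm) /Dn -!scalemxAr -scalerBr; congr (_ *: _).
  rewrite [K *m _]mulmxA /ridgeA mulmxV// mul1mx -mulmxBr.
  rewrite -/Kb -/Kh mulmxBl [Kh *m (_ - _)]mulmxBr.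
  have -> : Kh *m sketch_beta X y lam s = sketchg X y s by rewrite mulKVmx.
  set sg := sketchg X y s; set bt := Kh *m beta.
  rewrite [Kb *m (_ - _)]mulmxBr.
  have E (a b c e : 'cV[R]_d) : a - b - c - (e - b - c) = a - e.
    by apply/matrixP => i j; rewrite !mxE; ring.
  rewrite E.
  by rewrite mulmxBr [invmx Kb *m (Kb *m _)]mulmxA mulVmx// mul1mx.
rewrite addrAC; apply: le_trans (ler_frobeniusD _ _) _; rewrite mulrDr lerD//.
  apply: le_trans (frobenius_delta _ c2 cKb) _.
  by rewrite /Kb /K opprD addrACA subrr addr0 invf_div.
rewrite frobeniusN; apply: le_trans (coercive_inv _ c2 cKb) _.
rewrite invf_div ler_wpM2l// ?divr_ge0// ?(ltW c0_gt0)//.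
by apply: le_trans (ler_frobeniusM _ _) _; rewrite /Kb /Kh opprD addrACA subrr addr0.
Qed.

Lemma sketch_errE : sketch_err X y lam s =
  frobenius (Num.sqrt m%:R *: (sketch_beta X y lam s - beta)).
Proof. by rewrite frobeniusZ ger0_norm ?ltW. Qed.

Lemma boot_errE w : boot_err X y lam s w =
  frobenius (Num.sqrt m%:R *: (boot_beta X y lam s w - sketch_beta X y lam s)).
Proof. by rewrite frobeniusZ ger0_norm ?ltW. Qed.

End Delta.

Lemma ler_dist_frobenius (R : realType) p q (M N : 'M[R]_(p, q)) :
  `|frobenius M - frobenius N| <= frobenius (M - N).
Proof.
rewrite ler_norml; apply/andP; split.
  have := ler_frobeniusD (N - M) M; rewrite subrK frobeniusBC; lra.
by have := ler_frobeniusD (M - N) N; rewrite subrK; lra.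
Qed.

(** * Distribution of the norm of the walk *)

Section Walk.
Variable R : realType.

(* The walk replaces the Gaussian limit with covariance [L *m L^T]. *)
Definition walk d (L : 'M[R]_d) m (f : 'cV[R]_d -> R) : R :=
  iter m (avop (rademacher L (Num.sqrt m%:R)^-1)) f 0.

Definition walk_cdf d (L : 'M[R]_d) m (t : R) : R :=
  walk L m (fun y => (frobenius y <= t)%R%:R).

Lemma walk_le d (L : 'M[R]_d) m f g :
  (forall x, f x <= g x) -> walk L m f <= walk L m g.
Proof. by move=> fg; apply: iter_avop_le. Qed.

Lemma ler_bool_nat (a b : bool) : (a -> b) -> a%:R <= b%:R :> R.
Proof. by case: a b => [] [] //= /(_ isT). Qed.

Lemma walk_cdf_nd d (L : 'M[R]_d) m s t : s <= t -> walk_cdf L m s <= walk_cdf L m t.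
Proof.
by move=> st; apply: walk_le => x; apply: ler_bool_nat => /le_trans; apply.
Qed.

Lemma walk_increment d (L : 'M[R]_d) k0 m s t : (0 < m)%N -> col k0 L != 0 ->
  0 <= s -> s <= t ->
  walk_cdf L m t - walk_cdf L m s <=
  Num.sqrt (t ^+ 2 - s ^+ 2) / frobenius (col k0 L) + 2 / Num.sqrt m%:R.
Proof.
move=> m0 L0 s0 st; have t0 := le_trans s0 st.
have st2 : s ^+ 2 <= t ^+ 2 by rewrite ler_pXn2r ?nnegrE.
apply: le_trans (rademacher_anticoncentration 0 m0 L0 st2).
rewrite /walk_cdf /walk -iter_avopB; apply: iter_avop_le => x.
rewrite !ler_pXn2r ?nnegrE ?frobenius_ge0//.
by case: (leP (frobenius x) t) => xt /=; case: (leP (frobenius x) s) => xs /=;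
  case: (leP s (frobenius x)) => sx /=; lra.
Qed.

(** Chebyshev's inequality; the second moment of the walk is the trace for every [m], so the tail
    bound is uniform in [m]. *)
Lemma walk_tail d (L : 'M[R]_d) m t : (0 < m)%N -> 0 < t ->
  1 - \tr (L *m L^T) / t ^+ 2 <= walk_cdf L m t.
Proof.
move=> m0 t0.
have -> : 1 - \tr (L *m L^T) / t ^+ 2 =
    walk L m (fun y => 1 - t ^- 2 * frobenius y ^+ 2).
  rewrite /walk (iter_avopB _ _ (fun=> 1)) iter_avopZ iter_avop_rademacher_sqr.
  rewrite frobenius0 expr0n /= add0r exprVn sqr_sqrtr// [m%:R * _]mulrA mulfV ?mul1r; last first.
    by rewrite pnatr_eq0 -lt0n.
  rewrite mulrC; congr (_ - _).
  apply/eqP; rewrite eq_le; apply/andP; split.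
    by apply: iter_avop_lb => //; exact: card_signs.
  by apply: iter_avop_ub => //; exact: card_signs.
apply: walk_le => x; case: (leP (frobenius x) t) => xt /=.
  by rewrite gerBl mulr_ge0 ?sqr_ge0// invr_ge0 sqr_ge0.
rewrite subr_le0 mulrC ler_pdivlMr ?exprn_gt0// mul1r.
by rewrite ler_pXn2r ?nnegrE ?frobenius_ge0 ?(ltW t0)// ltW.
Qed.

(** The margin between [t] and the inner radius [t + delta] absorbs the linearization error. The
    width is a third of the difference of squares because [smooth_step] reaches 0 after three
    widths. *)
Definition upper_step d (t delta : R) : 'cV[R]_d -> R :=
  smooth_step ((t + delta) ^+ 2)
              (((t + 2 * delta) ^+ 2 - (t + delta) ^+ 2) / 3).

Definition lower_step d (t delta : R) : 'cV[R]_d -> R :=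
  smooth_step ((t - 2 * delta) ^+ 2)
              (((t - delta) ^+ 2 - (t - 2 * delta) ^+ 2) / 3).

Section Steps.
Variables (d : nat) (t delta : R).
Hypotheses (delta_gt0 : 0 < delta) (delta_t : 2 * delta <= t).

Let up0 : 0 < ((t + 2 * delta) ^+ 2 - (t + delta) ^+ 2) / 3.
Proof.
have d0 := delta_gt0; have dt := delta_t.
by rewrite divr_gt0// subr_gt0 ltr_pXn2r ?nnegrE//; lra.
Qed.

Let lo0 : 0 < ((t - delta) ^+ 2 - (t - 2 * delta) ^+ 2) / 3.
Proof.
have d0 := delta_gt0; have dt := delta_t.
by rewrite divr_gt0// subr_gt0 ltr_pXn2r ?nnegrE//; lra.
Qed.

Lemma taylor3_upper : taylor3 (@upper_step d t delta).
Proof. by apply: taylor3_step => //; exact: sqr_ge0. Qed.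

Lemma taylor3_lower : taylor3 (@lower_step d t delta).
Proof. by apply: taylor3_step => //; exact: sqr_ge0. Qed.

Lemma upper_step_bounds (x : 'cV[R]_d) :
  (frobenius x <= t + delta)%R%:R <= upper_step t delta x
  <= (frobenius x <= t + 2 * delta)%R%:R.
Proof.
have d0 := delta_gt0; have dt := delta_t.
have := smooth_step_le ((t + delta) ^+ 2) x up0.
rewrite (_ : (t + delta) ^+ 2 + _ = (t + 2 * delta) ^+ 2); last by field.
by rewrite !ler_pXn2r ?nnegrE ?frobenius_ge0//; lra.
Qed.

Lemma lower_step_bounds (x : 'cV[R]_d) :
  (frobenius x <= t - 2 * delta)%R%:R <= lower_step t delta x
  <= (frobenius x <= t - delta)%R%:R.
Proof.
have d0 := delta_gt0; have dt := delta_t.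
have := smooth_step_le ((t - 2 * delta) ^+ 2) x lo0.
rewrite (_ : (t - 2 * delta) ^+ 2 + _ = (t - delta) ^+ 2); last by field.
by rewrite !ler_pXn2r ?nnegrE ?frobenius_ge0//; lra.
Qed.

(** The common last step for the sketch and the bootstrap: [p] is the probability under study, [up]
    and [lo] are its smoothed counterparts, and [bad] is the mass where linearization fails. The
    remaining terms bound the walk's mass in the shell between [t - 2 * delta] and [t + 2 * delta],
    whose squared radii differ by [8 * t * delta]. *)
Lemma walk_sandwich (L : 'M[R]_d) k0 m p bad e up lo :
  (0 < m)%N -> col k0 L != 0 ->
  p <= up + bad -> lo - bad <= p ->
  `|up - walk L m (upper_step t delta)| <= e ->
  `|lo - walk L m (lower_step t delta)| <= e ->
  `|p - walk_cdf L m t| <= e + bad +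
    (Num.sqrt (8 * t * delta) / frobenius (col k0 L) + 2 / Num.sqrt m%:R).
Proof.
have d0 := delta_gt0; have dt := delta_t.
move=> m0 L0 pu pl /ler_normlP[_ ue] /ler_normlP[le_ _].
have U : walk L m (upper_step t delta) <= walk_cdf L m (t + 2 * delta).
  by apply: walk_le => x; case/andP: (upper_step_bounds x).
have V : walk_cdf L m (t - 2 * delta) <= walk L m (lower_step t delta).
  by apply: walk_le => x; case/andP: (lower_step_bounds x).
have s0 : 0 <= t - 2 * delta by lra.
have st : t - 2 * delta <= t + 2 * delta by lra.
have := walk_increment m0 L0 s0 st.
rewrite (_ : _ ^+ 2 - _ ^+ 2 = 8 * t * delta); last by ring.
have := walk_cdf_nd L m (_ : t - 2 * delta <= t).
have := walk_cdf_nd L m (_ : t <= t + 2 * delta).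
move=> H1 H2; have {}H1 := H1 ltac:(lra); have {}H2 := H2 ltac:(lra).
by rewrite ler_norml; lra.
Qed.

End Steps.
End Walk.

(** * The bootstrap law compared with the walk, for a fixed sketch *)

Section BootClose.
Variable R : realType.

Lemma avg_frobenius_resample (J : finType) N p q (Y : J -> 'M[R]_(p, q)) :
  (0 < #|J|)%N -> \sum_j Y j = 0 ->
  avg (fun t : N.-tuple J => frobenius (\sum_(k < N) Y (tnth t k)) ^+ 2) =
  N%:R * avg (fun j => frobenius (Y j) ^+ 2).
Proof.
move=> J0 Y0; under eq_avg do rewrite sqr_frobenius.
rewrite avg_sum; under [in RHS]eq_avg do rewrite sqr_frobenius.
rewrite avg_sum big_distrr /=; apply: eq_bigr => a _.
rewrite !avg_sum big_distrr /=; apply: eq_bigr => b _.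
rewrite -avg_sqr_resample//; last first.
  by move/matrixP: Y0 => /(_ a b); rewrite summxE mxE /avg => ->; rewrite mulr0.
by apply: eq_avg => t; rewrite summxE.
Qed.

Lemma sqr_frobeniusB_le p q (A B : 'M[R]_(p, q)) :
  frobenius (A - B) ^+ 2 <= 2 * frobenius A ^+ 2 + 2 * frobenius B ^+ 2.
Proof.
have H := ler_frobeniusD A (- B); rewrite frobeniusN in H.
apply: (@le_trans _ _ ((frobenius A + frobenius B) ^+ 2)).
  by rewrite ler_pXn2r ?nnegrE ?addr_ge0 ?frobenius_ge0.
by rewrite -subr_ge0 (_ : _ - _ = (frobenius A - frobenius B) ^+ 2) ?sqr_ge0//; ring.
Qed.

(** Lets the fourth-moment assumption supply the second moments for Chebyshev and the third moments
    for the Taylor remainder. *)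
Lemma pow4_ge (a : R) : 0 <= a -> a ^+ 2 <= 1 + a ^+ 4 /\ a ^+ 3 <= 1 + a ^+ 4.
Proof.
move=> a0; have [a1|a1] := leP a 1.
  have a4 : 0 <= a ^+ 4 by rewrite exprn_ge0.
  by split; apply: (@le_trans _ _ 1); rewrite ?lerDl// exprn_ile1.
have H k : (k <= 4)%N -> a ^+ k <= 1 + a ^+ 4.
  by move=> k4; apply: (@le_trans _ _ (a ^+ 4)); rewrite ?lerDr// ler_weXn2l// ltW.
by split; exact: H.
Qed.

Lemma cube_le (a b : R) : 0 <= a -> 0 <= b ->
  (a + b) ^+ 3 <= 8 * (1 + a ^+ 4 + b ^+ 3).
Proof.
move=> a0 b0; have [_ H] := pow4_ge a0.
have [ab|ba] := leP a b.
  apply: (@le_trans _ _ ((2 * b) ^+ 3)).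
    by rewrite ler_pXn2r ?nnegrE ?addr_ge0 ?mulr_ge0//; lra.
  have a4 : 0 <= a ^+ 4 by rewrite exprn_ge0.
  by rewrite exprMn; lra.
apply: (@le_trans _ _ ((2 * a) ^+ 3)).
  by rewrite ler_pXn2r ?nnegrE ?addr_ge0 ?mulr_ge0//; lra.
have b3 : 0 <= b ^+ 3 by rewrite exprn_ge0.
by rewrite exprMn; lra.
Qed.

(* Multinomial weights are the counts of a uniform tuple of indices, so this is
   the conditional distribution function of the bootstrap error. *)
Definition boot_cdf n d m (X : 'M[R]_(n, d)) (y : 'cV[R]_n) lam
    (s : 'I_m -> 'cV[R]_n) (t : R) : R :=
  avg (fun phi : m.-tuple 'I_m => (boot_err X y lam s (cnt phi) <= t)%R%:R).

Definition col_norms d (L : 'M[R]_d) : R := \sum_k frobenius (col k L).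

Lemma avg_rademacher_cube d (L : 'M[R]_d) c :
  avg (fun s => frobenius (rademacher L c s) ^+ 3) <= `|c| ^+ 3 * col_norms L ^+ 3.
Proof.
rewrite -[leRHS](@avg_cst R {ffun 'I_d -> bool}) ?card_signs//.
apply: ler_avg => s; rewrite -exprMn.
have M0 : 0 <= col_norms L by apply: sumr_ge0 => k _; exact: frobenius_ge0.
by rewrite ler_pXn2r ?nnegrE ?frobenius_ge0 ?mulr_ge0// rademacher_le.
Qed.

(** Each of the [m] steps has covariance error [e / m] and cubic error of order [m^(-3/2)], so the
    total is of order [e + m^(-1/2)]. *)
Lemma iter_avop_walk d (L : 'M[R]_d) (f : 'cV[R]_d -> R) : taylor3 f ->
  exists2 C : R, 0 <= C & forall m (v : 'I_m -> 'cV[R]_d) e b, (0 < m)%N ->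
  \sum_i v i = 0 -> (forall i j, `|(covmx v - L *m L^T) i j| <= e) ->
  avg (fun i => frobenius (v i) ^+ 3) <= b ->
  `|avg (fun phi : m.-tuple 'I_m =>
       f ((Num.sqrt m%:R)^-1 *: \sum_(k < m) v (tnth phi k))) - walk L m f|
  <= C * (d%:R ^+ 2 * e + (b + col_norms L ^+ 3) / Num.sqrt m%:R).
Proof.
move=> fT; have [C C0 HC] := taylor3_swap fT; exists C => // m v e b m0 v0 ve vb.
set c := (Num.sqrt m%:R)^-1.
have s0 : 0 < Num.sqrt m%:R :> R by rewrite sqrtr_gt0 ltr0n.
have c_gt0 : 0 < c by rewrite invr_gt0.
have mc : m%:R * c ^+ 2 = 1 :> R.
  by rewrite exprVn sqr_sqrtr// mulfV// pnatr_eq0 -lt0n.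
have -> : avg (fun phi : m.-tuple 'I_m => f (c *: \sum_(k < m) v (tnth phi k))) =
    iter m (avop (fun i => c *: v i)) f 0.
  rewrite -avg_resample; apply: eq_avg => phi; rewrite add0r; congr f.
  by rewrite scaler_sumr.
have I0 : (0 < #|'I_m|)%N by rewrite card_ord.
have step x : `|avop (fun i => c *: v i) f x - avop (rademacher L c) f x| <=
    C * (d%:R ^+ 2 * (c ^+ 2 * e) + avg (fun i => frobenius (c *: v i) ^+ 3)
         + avg (fun i => frobenius (rademacher L c i) ^+ 3)).
  apply: HC => //; first exact: card_signs.
  - move=> j.
    have -> : avg (fun i => (c *: v i) j 0) = c * avg (fun i => v i j 0).
      by rewrite -avgZ; apply: eq_avg => i; rewrite mxE.
    by move/matrixP: v0 => /(_ j 0); rewrite summxE mxE /avg => ->; rewrite !mulr0.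
  - exact: avg_rademacher.
  - move=> i j; rewrite covmx_rademacher.
    have -> : covmx (fun i => c *: v i) = c ^+ 2 *: covmx v.
      apply/matrixP => a a'; rewrite !mxE -avgZ; apply: eq_avg => k.
      by rewrite !mxE; ring.
    by rewrite -scalerBr mxE normrM ger0_norm ?sqr_ge0// ler_wpM2l ?sqr_ge0.
apply: le_trans (iter_avop_telescope m I0 (card_signs d) step 0) _.
rewrite mulrCA ler_wpM2l//.
have H1 : avg (fun i => frobenius (c *: v i) ^+ 3) <= c ^+ 3 * b.
  apply: le_trans (ler_wpM2l _ vb); last by rewrite exprn_ge0// ltW.
  rewrite -avgZ; apply: ler_avg => i; rewrite frobeniusZ exprMn ger0_norm//.
  exact: ltW.
have H2 := avg_rademacher_cube L c; rewrite ger0_norm ?(ltW c_gt0)// in H2.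
apply: (@le_trans _ _ (m%:R * (d%:R ^+ 2 * (c ^+ 2 * e) + c ^+ 3 * b
  + c ^+ 3 * col_norms L ^+ 3))).
  by rewrite ler_wpM2l// !lerD.
rewrite le_eqVlt; apply/orP; left; apply/eqP.
rewrite (_ : _ * _ = (m%:R * c ^+ 2) * (d%:R ^+ 2 * e + (b + col_norms L ^+ 3) * c)).
  by rewrite mc mul1r.
by ring.
Qed.

End BootClose.

Section BootCloseMain.
Variable R : realType.

Lemma ler_indicator (p q b : bool) : (p -> q || b) -> p%:R <= q%:R + b%:R :> R.
Proof. by rewrite -natrD ler_nat; case: p q b => [] [] [] //= /(_ isT). Qed.

Lemma avg_chebyshev_ge0 (I : finType) (F : I -> R) e : 0 < e ->
  (forall i, 0 <= F i) ->
  avg (fun i => (e <= F i)%R%:R) <= e ^- 2 * avg (fun i => F i ^+ 2).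
Proof.
move=> e0 F0; apply: le_trans (avg_chebyshev F e0).
by apply: ler_avg => i; rewrite ger0_norm.
Qed.

(** Nothing about the sketch is random here: the hypotheses from [frobenius (sketchH X s - ridgeH X)
    <= eta] on describe the sketches for which the bootstrap works, and only the index tuple is
    averaged. The constant precedes the dimensions and data. *)
Lemma boot_close d (L : 'M[R]_d) k0 (t delta : R) :
  0 < delta -> 2 * delta <= t -> col k0 L != 0 ->
  exists2 C : R, 0 <= C &
  forall n m (X : 'M[R]_(n, d)) (y : 'cV[R]_n) lam (s : 'I_m -> 'cV[R]_n)
    (c0 eta Ks Kb K4 : R),
  (0 < m)%N -> 0 < c0 -> coercive c0 (ridgeH X + lam%:M) ->
  0 < eta -> 2 * eta <= c0 / 2 -> 0 <= Ks -> 0 < Kb ->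
  2 / c0 * (2 * eta * Kb + eta * (2 * Ks)) <= delta ->
  frobenius (sketchH X s - ridgeH X) <= eta ->
  frobenius (sketch_sum X y lam s) <= Ks ->
  avg (fun i => frobenius (zrow X (s i) *m (zrow X (s i))^T - ridgeH X) ^+ 2) <= K4 ->
  avg (fun i => frobenius (influence X y lam (s i)) ^+ 4) <= K4 ->
  (forall i j, `|(covmx (fun i => influence X y lam (s i)) - L *m L^T) i j| <= eta) ->
  `|boot_cdf X y lam s t - walk_cdf L m t| <=
    C * (d%:R ^+ 2 * (eta + Ks ^+ 2 / m%:R)
         + (8 * (1 + K4 + Ks ^+ 3) + col_norms L ^+ 3) / Num.sqrt m%:R)
    + ((2 * K4 + 2 * eta ^+ 2) / eta ^+ 2 / m%:R
       + (2 * (1 + K4) + 2 * Ks ^+ 2) / Kb ^+ 2)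
    + (Num.sqrt (8 * t * delta) / frobenius (col k0 L) + 2 / Num.sqrt m%:R).
Proof.
move=> d0 dt L0.
have [C1 C1_0 H1] := iter_avop_walk L (taylor3_upper d d0 dt).
have [C2 C2_0 H2] := iter_avop_walk L (taylor3_lower d d0 dt).
exists (C1 + C2); first exact: addr_ge0.
move=> n m X y lam s c0 eta Ks Kb K4 m0 c0_gt0 cK eta0 eta_c0 Ks0 Kb0 etad.
set z := fun i => zrow X (s i); set psi := fun i => influence X y lam (s i).
move=> G1 G2 G3 G4 G5.
have J0 : (0 < #|'I_m|)%N by rewrite card_ord.
have m_neq0 : m%:R != 0 :> R by rewrite pnatr_eq0 -lt0n.
have s0 : 0 < Num.sqrt m%:R :> R by rewrite sqrtr_gt0 ltr0n.
set c := (Num.sqrt m%:R)^-1.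
have c_gt0 : 0 < c by rewrite invr_gt0.
have c_le1 : c <= 1.
  by rewrite invf_le1// -[leLHS]sqrtr1 ler_sqrt ?ler1n.
have c2 : c ^+ 2 = m%:R^-1 by rewrite exprVn sqr_sqrtr.
pose pb : 'cV[R]_d := c *: sketch_sum X y lam s.
have pbE : pb = m%:R^-1 *: \sum_i psi i by rewrite /pb scalerA -expr2 c2.
have pb_le : frobenius pb <= Ks.
  rewrite frobeniusZ ger0_norm ?(ltW c_gt0)//; apply: le_trans G2.
  by rewrite ler_piMl ?frobenius_ge0.
pose v i := psi i - pb.
have v0 : \sum_i v i = 0.
  rewrite sumrB sumr_const card_ord pbE -scaler_nat scalerA mulfV// scale1r.
  exact: subrr.
(* Centering at the empirical mean changes the covariance by a rank-one term of size at most
   [Ks ^+ 2 / m]. *)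
have covv : covmx v = covmx psi - pb *m pb^T.
  apply/matrixP => i j; rewrite !mxE big_ord1 [pb^T _ _]mxE.
  have av k : avg (fun i => psi i k 0) = pb k 0.
    by rewrite pbE mxE summxE /avg card_ord.
  rewrite [LHS](@eq_avg _ 'I_m _ (fun l => psi l i 0 * psi l j 0 -
    (pb i 0 * psi l j 0 + (pb j 0 * psi l i 0 - pb i 0 * pb j 0)))).
    rewrite avgB avgD avgB (avgZ (pb i 0)) (avgZ (pb j 0)) !av avg_cst//.
    by rewrite [pb j 0 * _]mulrC; ring.
  by move=> l; rewrite !mxE; ring.
have ve i j : `|(covmx v - L *m L^T) i j| <= eta + Ks ^+ 2 / m%:R.
  rewrite covv addrAC mxE; apply: le_trans (ler_normD _ _) _; apply: lerD => //.
  apply: le_trans (ler_entry_frobenius _ _ _) _; rewrite frobeniusN.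
  apply: le_trans (ler_frobeniusM _ _) _.
  have -> : frobenius pb^T = frobenius pb.
    by rewrite /frobenius exchange_big; congr Num.sqrt; apply: eq_bigr => a _;
      apply: eq_bigr => b _; rewrite mxE.
  rewrite -expr2 frobeniusZ exprMn real_normK ?num_real// c2 mulrC.
  by rewrite ler_wpM2r ?invr_ge0// ler_pXn2r ?nnegrE ?frobenius_ge0.
have v3 : avg (fun i => frobenius (v i) ^+ 3) <= 8 * (1 + K4 + Ks ^+ 3).
  apply: (@le_trans _ _ (avg (fun i => 8 * ((1 + Ks ^+ 3) + frobenius (psi i) ^+ 4)))).
    apply: ler_avg => i.
    apply: (@le_trans _ _ ((frobenius (psi i) + Ks) ^+ 3)).
      rewrite ler_pXn2r ?nnegrE ?addr_ge0 ?frobenius_ge0//.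
      have := ler_frobeniusD (psi i) (- pb); rewrite frobeniusN.
      by rewrite -/(v i) => /le_trans; apply; rewrite lerD2l.
    apply: le_trans (cube_le (frobenius_ge0 _) Ks0) _.
    by rewrite ler_wpM2l//; lra.
  rewrite avgZ avgD avg_cst// ler_wpM2l//.
  by rewrite -/psi in G4; move: G4; clear; lra.
have v2 : avg (fun i => frobenius (v i) ^+ 2) <= 2 * (1 + K4) + 2 * Ks ^+ 2.
  apply: (@le_trans _ _ (avg (fun i => (2 + 2 * Ks ^+ 2) + 2 * frobenius (psi i) ^+ 4))).
    apply: ler_avg => i; apply: le_trans (sqr_frobeniusB_le _ _) _.
    have [P2 _] := pow4_ge (frobenius_ge0 (psi i)).
    have : frobenius pb ^+ 2 <= Ks ^+ 2.
      by rewrite ler_pXn2r ?nnegrE ?frobenius_ge0.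
    by lra.
  rewrite avgD avg_cst// avgZ.
  by rewrite -/psi in G4; move: G4; clear; lra.
pose Sphi (phi : m.-tuple 'I_m) := c *: \sum_(k < m) v (tnth phi k).
have SphiE phi : boot_sum X y lam s (cnt phi) = Sphi phi.
  rewrite /boot_sum /Sphi; congr (_ *: _).
  rewrite sum_cnt_scale sumrB sumr_const card_ord pbE -scaler_nat scalerA.
  by rewrite mulfV// scale1r.
pose Y i := z i *m (z i)^T - sketchH X s.
have Y0 : \sum_i Y i = 0.
  rewrite sumrB sumr_const card_ord /sketchH -scaler_nat scalerA mulfV//.
  by rewrite scale1r subrr.
have Y2 : avg (fun i => frobenius (Y i) ^+ 2) <= 2 * K4 + 2 * eta ^+ 2.
  apply: (@le_trans _ _ (avg (fun i => 2 * eta ^+ 2 +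
     2 * frobenius (z i *m (z i)^T - ridgeH X) ^+ 2))).
    apply: ler_avg => i.
    have -> : Y i = (z i *m (z i)^T - ridgeH X) - (sketchH X s - ridgeH X).
      by rewrite opprB addrA subrK.
    apply: le_trans (sqr_frobeniusB_le _ _) _.
    have : frobenius (sketchH X s - ridgeH X) ^+ 2 <= eta ^+ 2.
      by rewrite ler_pXn2r ?nnegrE ?frobenius_ge0// ltW.
    by lra.
  rewrite avgD avg_cst// avgZ.
  by move: G3; rewrite -/z; clear; lra.
have bootHE phi : bootH X s (cnt phi) - sketchH X s =
    m%:R^-1 *: \sum_(k < m) Y (tnth phi k).
  rewrite /bootH sum_cnt_scale sumrB sumr_const card_ord scalerBr; congr (_ - _).
  by rewrite -[sketchH X s *+ _]scaler_nat scalerA mulVf// scale1r.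
(* The two ways in which a resample defeats linearization: a poor Gram matrix, or a large linear
   part. Each is rare by Chebyshev's inequality over the index tuples. *)
pose bad1 (phi : m.-tuple 'I_m) := eta <= frobenius (bootH X s (cnt phi) - sketchH X s).
pose bad2 (phi : m.-tuple 'I_m) := Kb <= frobenius (Sphi phi).
have a1 : avg (fun phi => (bad1 phi)%:R : R) <=
    (2 * K4 + 2 * eta ^+ 2) / eta ^+ 2 / m%:R.
  apply: le_trans (avg_chebyshev_ge0 eta0 _) _ => [phi|]; first exact: frobenius_ge0.
  under eq_avg do rewrite bootHE frobeniusZ exprMn.
  rewrite avgZ avg_frobenius_resample// ger0_norm ?invr_ge0//.
  have -> : eta ^- 2 * (m%:R^-1 ^+ 2 * (m%:R * avg (fun j => frobenius (Y j) ^+ 2))) =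
      avg (fun j => frobenius (Y j) ^+ 2) / eta ^+ 2 / m%:R.
    by field; rewrite m_neq0 gt_eqF.
  by rewrite ler_wpM2r ?invr_ge0// ler_wpM2r ?invr_ge0 ?sqr_ge0.
have a2 : avg (fun phi => (bad2 phi)%:R : R) <=
    (2 * (1 + K4) + 2 * Ks ^+ 2) / Kb ^+ 2.
  apply: le_trans (avg_chebyshev_ge0 Kb0 _) _ => [phi|]; first exact: frobenius_ge0.
  under eq_avg do rewrite /Sphi frobeniusZ exprMn real_normK ?num_real//.
  rewrite avgZ avg_frobenius_resample// c2 [m%:R^-1 * _]mulrA mulVf// mul1r mulrC.
  by rewrite ler_wpM2r// invr_ge0 sqr_ge0.
(* With this factor the linearization error is at most half of [Ks], so the scaled sketch error is
   within [2 * Ks]. *)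
have hc : 2 / c0 * eta <= 1 / 2.
  by rewrite mulrAC ler_pdivrMr//; move: eta_c0; clear; lra.
have eta_c0' : eta <= c0 / 2 by move: eta0 eta_c0; clear; lra.
have c20 : 0 <= 2 / c0 by rewrite divr_ge0// ltW.
have Dn : frobenius (Num.sqrt m%:R *: (sketch_beta X y lam s - ridge_beta X y lam))
    <= 2 * Ks.
  have := sketch_delta y m0 c0_gt0 cK (le_trans G1 eta_c0').
  have : 2 / c0 * (frobenius (sketchH X s - ridgeH X) * frobenius (sketch_sum X y lam s))
      <= 1 / 2 * Ks.
    rewrite mulrA; apply: ler_pM => //.
    - by apply: mulr_ge0 => //; exact: frobenius_ge0.
    - exact: frobenius_ge0.
    - by apply: le_trans hc; rewrite ler_wpM2l.
  have := ler_dist_frobenius (Num.sqrt m%:R *: (sketch_beta X y lam s - ridge_beta X y lam))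
    (sketch_sum X y lam s).
  move=> /ler_normlP[_ +] + +; move: G2 Ks0.
  by clear; lra.
have good phi : ~~ bad1 phi -> ~~ bad2 phi ->
    `|boot_err X y lam s (cnt phi) - frobenius (Sphi phi)| <= delta.
  rewrite -!ltNge => /ltW b1 /ltW b2.
  have HB : frobenius (bootH X s (cnt phi) - ridgeH X) <= 2 * eta.
    have -> : bootH X s (cnt phi) - ridgeH X =
      (bootH X s (cnt phi) - sketchH X s) + (sketchH X s - ridgeH X).
      by rewrite addrA subrK.
    by apply: le_trans (ler_frobeniusD _ _) _; move: b1 G1; clear; lra.
  rewrite boot_errE// -SphiE; apply: le_trans (ler_dist_frobenius _ _) _.
  apply: le_trans (boot_delta y m0 c0_gt0 cK (sum_cnt phi) (le_trans G1 eta_c0')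
    (le_trans HB eta_c0)) _.
  apply: le_trans etad; rewrite ler_wpM2l// lerD//.
    by rewrite SphiE; apply: ler_pM => //; exact: frobenius_ge0.
  by apply: ler_pM => //; exact: frobenius_ge0.
pose bad : R := avg (fun phi => (bad1 phi || bad2 phi)%:R).
have bad_le : bad <= (2 * K4 + 2 * eta ^+ 2) / eta ^+ 2 / m%:R +
    (2 * (1 + K4) + 2 * Ks ^+ 2) / Kb ^+ 2.
  apply: le_trans (lerD a1 a2); rewrite -avgD; apply: ler_avg => phi.
  by apply: ler_indicator.
set E0 := d%:R ^+ 2 * _ + _.
have E0_ge0 : 0 <= E0.
  have K40 : 0 <= K4.
    by apply: le_trans G4; apply: avg_ge0 => i; rewrite exprn_ge0// frobenius_ge0.
  have M0 : 0 <= col_norms L by apply: sumr_ge0 => k _; exact: frobenius_ge0.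
  rewrite /E0 !addr_ge0// ?mulr_ge0 ?invr_ge0 ?addr_ge0 ?mulr_ge0 ?exprn_ge0 ?invr_ge0//.
  - by rewrite ltW.
  - by rewrite !addr_ge0// exprn_ge0.
have U := H1 m v _ _ m0 v0 ve v3; have V := H2 m v _ _ m0 v0 ve v3.
set up := avg _ in U; set lo := avg _ in V.
have pu : boot_cdf X y lam s t <= up + bad.
  rewrite -avgD; apply: ler_avg => phi.
  have /andP[+ _] := upper_step_bounds d0 dt (Sphi phi).
  rewrite -(lerD2r (bad1 phi || bad2 phi)%:R); apply: le_trans.
  apply: ler_indicator => et; case: (boolP (bad1 phi || bad2 phi)) => [|nb].
    by rewrite orbT.
  move: nb; rewrite negb_or => /andP[nb1 nb2].
  have /ler_normlP[] := good phi nb1 nb2.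
  by move: et; rewrite orbF; clear; lra.
have pl : lo - bad <= boot_cdf X y lam s t.
  rewrite lerBlDr -avgD; apply: ler_avg => phi.
  have /andP[_ +] := lower_step_bounds d0 dt (Sphi phi).
  move=> /le_trans; apply; apply: ler_indicator => et.
  case: (boolP (bad1 phi || bad2 phi)) => [|nb]; first by rewrite orbT.
  move: nb; rewrite negb_or => /andP[nb1 nb2].
  have /ler_normlP[] := good phi nb1 nb2.
  by move: et; rewrite orbF; clear; lra.
have CU : `|up - walk L m (upper_step t delta)| <= (C1 + C2) * E0.
  by apply: le_trans U _; rewrite ler_wpM2r// lerDl.
have CV : `|lo - walk L m (lower_step t delta)| <= (C1 + C2) * E0.
  by apply: le_trans V _; rewrite ler_wpM2r// lerDr.
apply: le_trans (walk_sandwich d0 dt m0 L0 pu pl CU CV) _.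
by rewrite lerD2r lerD2l.
Qed.

End BootCloseMain.

(** * Independent samples *)

Section RealExpectation.
Context {disp : measure_display} {T : measurableType disp} {R : realType}.
Variable P : probability T R.
Implicit Types f g : T -> R.

Definition itg (f : T -> R) : Prop := P.-integrable [set: T] (EFin \o f).

(** Real-valued, so that linear arithmetic applies directly; it is informative in the presence of
    [itg], since an infinite integral is sent to 0. *)
Definition mean (f : T -> R) : R := \int[P]_x f x.

Definition Pr (A : set T) : R := fine (P A).

Lemma PrE A : measurable A -> P A = (Pr A)%:E.
Proof. by move=> mA; rewrite fineK ?fin_num_measure. Qed.

Lemma itg_measurable f : itg f -> measurable_fun [set: T] f.
Proof. by move=> /measurable_int/measurable_EFinP. Qed.

Lemma itgD f g : itg f -> itg g -> itg (fun x => f x + g x).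
Proof. by move=> hf hg; exact: (integrableD measurableT hf hg). Qed.

Lemma itgZ a f : itg f -> itg (fun x => a * f x).
Proof. by move=> hf; exact: (integrableZl measurableT a hf). Qed.

Lemma itgB f g : itg f -> itg g -> itg (fun x => f x - g x).
Proof. by move=> hf hg; exact: (integrableB measurableT hf hg). Qed.

Lemma itg_cst a : itg (fun=> a).
Proof. exact: finite_measure_integrable_cst. Qed.

Lemma itg_le f g : measurable_fun [set: T] f -> (forall x, `|f x| <= g x) ->
  itg g -> itg f.
Proof.
move=> mf fg hg; apply: le_integrable hg => //; first exact/measurable_EFinP.
by move=> x _; rewrite !abse_EFin lee_fin; apply: le_trans (fg x) _; exact: ler_norm.
Qed.

Lemma itg_bounded f b : measurable_fun [set: T] f -> (forall x, `|f x| <= b) -> itg f.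
Proof. by move=> mf fb; apply: itg_le mf fb _; exact: itg_cst. Qed.

Lemma itg_sum (I : finType) (f : I -> T -> R) :
  (forall i, itg (f i)) -> itg (fun x => \sum_i f i x).
Proof.
move=> hf; have := integrable_sum measurableT (index_enum I) (P := xpredT)
  (fun i _ => hf i).
apply: eq_integrable => // x _; by rewrite /= sumEFin.
Qed.

Lemma meanD f g : itg f -> itg g -> mean (fun x => f x + g x) = mean f + mean g.
Proof. by move=> hf hg; exact: RintegralD. Qed.

Lemma meanB f g : itg f -> itg g -> mean (fun x => f x - g x) = mean f - mean g.
Proof. by move=> hf hg; exact: RintegralB. Qed.

Lemma meanZ a f : itg f -> mean (fun x => a * f x) = a * mean f.
Proof. by move=> hf; exact: RintegralZl. Qed.

Lemma mean_cst a : mean (fun=> a) = a.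
Proof.
rewrite /mean Rintegral_cst//; transitivity (a * fine (P [set: T])) => //.
by rewrite probability_setT mulr1.
Qed.

Lemma ler_mean f g : itg f -> itg g -> (forall x, f x <= g x) -> mean f <= mean g.
Proof. by move=> hf hg fg; apply: le_Rintegral. Qed.

Lemma ler_norm_mean f : itg f -> `|mean f| <= mean (fun x => `|f x|).
Proof. by move=> hf; exact: le_normr_Rintegral. Qed.

Lemma itg_norm f : itg f -> itg (fun x => `|f x|).
Proof. by move=> hf; exact: (integrable_abse hf). Qed.

Lemma eq_mean f g : f =1 g -> mean f = mean g.
Proof. by move=> fg; apply: eq_Rintegral => x _. Qed.

Lemma mean_sum (I : finType) (f : I -> T -> R) : (forall i, itg (f i)) ->
  mean (fun x => \sum_i f i x) = \sum_i mean (f i).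
Proof.
move=> hf; rewrite /mean /Rintegral.
rewrite (eq_integral (fun x => \sum_(i <- index_enum I) (f i x)%:E)%E); last first.
  by move=> x _; rewrite sumEFin.
rewrite integral_sum // sum_fine // => i _.
exact: (integrable_fin_num measurableT (hf i)).
Qed.

Lemma mean_ge0 f : (forall x, 0 <= f x) -> 0 <= mean f.
Proof. by move=> f0; exact: Rintegral_ge0. Qed.

Lemma EFin_mean f : itg f -> (mean f)%:E = (\int[P]_x (f x)%:E)%E.
Proof. by move=> hf; rewrite fineK//; exact: integrable_fin_num. Qed.

Lemma indicE_bool (p : T -> bool) x : (\1_[set x | p x] x : R) = (p x)%:R.
Proof.
by rewrite indicE; congr ((nat_of_bool _)%:R); apply/idP/idP; rewrite inE.
Qed.

Lemma measurable_boolr (p : T -> bool) : measurable [set x | p x] ->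
  measurable_fun [set: T] (fun x => (p x)%:R : R).
Proof.
move=> mp; have : measurable_fun [set: T] (\1_[set x | p x] : T -> R).
  exact: measurable_indic.
by apply: eq_measurable_fun => x _; rewrite indicE_bool.
Qed.

Lemma mean_bool (p : T -> bool) : measurable [set x | p x] ->
  mean (fun x => (p x)%:R) = Pr [set x | p x].
Proof.
move=> mp; rewrite /mean /Rintegral /Pr; congr fine.
rewrite (eq_integral (fun x => (\1_[set x | p x] x)%:E)); last first.
  by move=> x _; rewrite indicE_bool.
by rewrite integral_indic// setIT.
Qed.

Lemma itg_bool (p : T -> bool) : measurable [set x | p x] ->
  itg (fun x => (p x)%:R).
Proof.
move=> mp; apply: (@itg_bounded _ 1); first exact: measurable_boolr.
by move=> x; rewrite ger0_norm// lern1 leq_b1.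
Qed.

Lemma Pr_ge0 A : 0 <= Pr A.
Proof. by rewrite fine_ge0. Qed.

Lemma le_Pr A B : measurable A -> measurable B -> A `<=` B -> Pr A <= Pr B.
Proof.
move=> mA mB AB; rewrite fine_le ?fin_num_measure//.
by rewrite le_measure// inE.
Qed.

Lemma PrU_le A B : measurable A -> measurable B -> Pr (A `|` B) <= Pr A + Pr B.
Proof.
move=> mA mB; rewrite -lee_fin EFinD -!PrE//; last exact: measurableU.
exact: measureU2.
Qed.

Lemma Pr_bigcup_le (I : eqType) (r : seq I) (A : I -> set T) :
  (forall i, measurable (A i)) ->
  measurable [set x | exists2 i, i \in r & A i x] /\
  Pr [set x | exists2 i, i \in r & A i x] <= \sum_(i <- r) Pr (A i).
Proof.
move=> mA; elim: r => [|i r [mr IH]].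
  rewrite big_nil (_ : [set x | _] = set0); last first.
    by apply/seteqP; split => x //= [].
  by rewrite /Pr measure0; split.
have -> : [set x | exists2 j, j \in i :: r & A j x] =
    A i `|` [set x | exists2 j, j \in r & A j x].
  apply/seteqP; split => x /=.
    by move=> [j]; rewrite inE => /orP[/eqP ->|jr] Aj; [left|right; exists j].
  by move=> [Ai|[j jr Aj]]; [exists i; rewrite ?mem_head|exists j; rewrite // inE jr orbT].
split; first exact: measurableU.
by rewrite big_cons; apply: le_trans (PrU_le _ _) _ => //; rewrite lerD2l.
Qed.

Lemma measurable_set_le f g : measurable_fun [set: T] f ->
  measurable_fun [set: T] g -> measurable [set x | f x <= g x].
Proof.
by move=> mf mg; rewrite -[X in measurable X]setTI; exact: measurable_fun_le.
Qed.

Lemma measurable_set_lt f g : measurable_fun [set: T] f ->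
  measurable_fun [set: T] g -> measurable [set x | f x < g x].
Proof.
move=> mf mg; rewrite (_ : [set x | _] = ~` [set x | g x <= f x]).
  by apply: measurableC; exact: measurable_set_le.
by apply/seteqP; split => x /=; rewrite ltNge => /negP.
Qed.

Lemma markov_Pr f a : itg f -> (forall x, 0 <= f x) -> 0 < a ->
  measurable [set x | a <= f x] /\ Pr [set x | a <= f x] <= mean f / a.
Proof.
move=> hf f0 a0.
have mA : measurable [set x | a <= f x].
  exact: measurable_set_le (measurable_cst a) (itg_measurable hf).
split=> //; rewrite ler_pdivlMr// mulrC -mean_bool// -meanZ; last exact: itg_bool.
apply: ler_mean => //; first by apply: itgZ; exact: itg_bool.
by move=> x; case: (leP a (f x)) => /=; rewrite ?mulr1 ?mulr0.
Qed.

End RealExpectation.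

(** * Each row is independent of the rows before it *)

Section Independence.
Context {disp disp' : measure_display} {T : measurableType disp}
  {S : measurableType disp'} {R : realType}.
Variables (P : probability T R) (m : nat) (s : 'I_m -> {mfun T >-> S}).
Hypothesis indep : mutually_independent P s.

Definition prefix_idx (k : 'I_m) (i : 'I_k) : 'I_m := widen_ord (ltnW (ltn_ord k)) i.

Definition prefix (k : 'I_m) (x : T) : k.-tuple S :=
  [tuple s (prefix_idx i) x | i < k].

Lemma measurable_prefix k : measurable_fun [set: T] (prefix k).
Proof.
apply/measurable_fun_tnthP => i.
rewrite (_ : _ \o _ = s (prefix_idx i)); first exact: measurable_funPT.
by apply/funext => x /=; rewrite tnth_mktuple.
Qed.

HB.instance Definition _ k :=
  isMeasurableFun.Build _ _ _ _ (prefix k) (@measurable_prefix k).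

Definition rect k (A : 'I_k -> set S) : set (k.-tuple S) :=
  [set t | forall i, A i (tnth t i)].

Lemma measurable_rect k (A : 'I_k -> set S) :
  (forall i, measurable (A i)) -> measurable (rect A).
Proof.
move=> mA; rewrite (_ : rect A = \bigcap_i ((@tnth _ S ^~ i) @^-1` (A i))).
  apply: fin_bigcap_measurable => [|i _]; first exact: finite_finset.
  by rewrite -[X in measurable X]setTI; exact: measurable_tnth.
by apply/seteqP; split => t /= At i => [_|]; exact: At.
Qed.

Lemma measurable_tupleE k : @measurable _ (k.-tuple S) =
  <<s [set D | exists2 A : 'I_k -> set S, (forall i, measurable (A i)) & D = rect A] >>.
Proof.
apply/seteqP; split; last first.
  apply: smallest_sub; first exact: sigma_algebra_measurable.
  by move=> D [A mA ->]; exact: measurable_rect.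
rewrite /measurable /=; apply: smallest_sub.
  exact: smallest_sigma_algebra.
move=> D; rewrite -bigcup_seq => -[i _ [B mB <-]].
apply: sub_sigma_algebra; exists (fun j => if j == i then B else setT).
  by move=> j; case: ifP => _ //; exact: measurableT.
apply/seteqP; split => t /=.
  by move=> [_ Bt] j; case: eqP => [->|//].
by move=> /(_ i); rewrite eqxx => Bt; split.
Qed.

(** For fixed [B] both sides are finite measures in [A]. They agree on rectangles, which are stable
    under intersection and generate the sigma-algebra of tuples. *)
Lemma prefix_indep (k : 'I_m) A B : measurable A -> measurable B ->
  P (prefix k @^-1` A `&` s k @^-1` B) = (P (prefix k @^-1` A) * P (s k @^-1` B))%E.
Proof.
move=> mA mB.
have mE : measurable (s k @^-1` B) by rewrite -[X in measurable X]setTI; exact: measurable_funPT.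
have c0 : 0 <= Pr P (s k @^-1` B) by exact: Pr_ge0.
pose m1 : {measure set (k.-tuple S) -> \bar R} :=
  measure_function_pushforward__canonical__measure_function_Measure
    (mrestr P mE) (@measurable_prefix k).
pose m2 := mscale (NngNum c0) (distribution P (prefix k)).
have mX C : measurable C -> measurable (prefix k @^-1` C).
  by move=> mC; rewrite -[X in measurable X]setTI; exact: measurable_prefix.
suff H : m1 A = m2 A.
  transitivity (m1 A) => //; rewrite H.
  transitivity ((Pr P (s k @^-1` B))%:E * P (prefix k @^-1` A))%E => //.
  by rewrite -PrE// muleC.
apply: (measure_unique _ (fun=> setT) (measurable_tupleE k)) => //.
- move=> _ _ [C mC ->] [D mD ->]; exists (fun i => C i `&` D i).
    by move=> i; exact: measurableI.
  by apply/seteqP; split => t /= => [[Ct Dt] i|CDt]; [|split => i; case: (CDt i)].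
- by move=> _; exists (fun=> setT) => //; apply/seteqP; split.
- by rewrite bigcup_const//; exists 0%N.
- move=> _ [C mC ->].
  (* Mutual independence is stated for all [m] rows at once, so rows after [k] receive the full
     space; [insub] detects the rows before [k]. [D'] differs from [D] only in leaving row [k]
     unconstrained. *)
  pose D (j : 'I_m) : set S := if insub (val j) is Some i then C i else
    if j == k then B else setT.
  have mD j : measurable (D j).
    by rewrite /D; case: insubP => [i _ _|_]; [exact: mC|case: ifP => _ //; exact: measurableT].
  pose D' (j : 'I_m) : set S := if insub (val j) is Some i then C i else setT.
  have mD' j : measurable (D' j).
    by rewrite /D'; case: insubP => [i _ _|_]; [exact: mC|exact: measurableT].
  have insubk : insub (val k) = None :> option 'I_k by rewrite insubF ?ltnn.
  have insub_prefix (i : 'I_k) : insub (val (prefix_idx i)) = Some i :> option 'I_k.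
    by rewrite (_ : val (prefix_idx i) = val i)// valK.
  have prefixD (E : 'I_m -> set S) : (forall i, E (prefix_idx i) = C i) ->
      (forall j : 'I_m, (k < j)%N -> E j = setT) ->
      \bigcap_j (s j @^-1` E j) = prefix k @^-1` (rect C) `&` s k @^-1` E k.
    move=> EC ET; apply/seteqP; split => x /=.
      move=> H; split; last exact: H.
      by move=> i; rewrite tnth_mktuple -EC; exact: H.
    move=> [H Hk] j _; have [jk|kj|/val_inj ->//] := ltngtP j k; last by rewrite ET.
    have := H (Ordinal jk); rewrite tnth_mktuple -EC.
    by rewrite (_ : prefix_idx _ = j)//; exact: val_inj.
  have Dk : D k = B by rewrite /D insubk eqxx.
  have Dj (j : 'I_m) : (k < j)%N -> D j = setT.
    move=> kj; rewrite /D insubF; last by rewrite ltnNge ltnW.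
    by rewrite (_ : (j == k) = false)//; apply/negbTE; rewrite neq_ltn kj orbT.
  have D'k : D' k = setT by rewrite /D' insubk.
  have D'j (j : 'I_m) : (k < j)%N -> D' j = setT.
    by move=> kj; rewrite /D' insubF// ltnNge ltnW.
  have Di i : D (prefix_idx i) = C i by rewrite /D insub_prefix.
  have D'i i : D' (prefix_idx i) = C i by rewrite /D' insub_prefix.
  have H1 := indep mD; rewrite (prefixD D Di Dj) Dk in H1.
  have H2 := indep mD'; rewrite (prefixD D' D'i D'j) D'k preimage_setT setIT in H2.
  transitivity (P (prefix k @^-1` rect C `&` s k @^-1` B)) => //.
  transitivity (P (s k @^-1` B) * P (prefix k @^-1` rect C))%E; last first.
    by rewrite [P (s k @^-1` B)]PrE.
  rewrite H1 H2 (bigD1 k)//= Dk [in RHS](bigD1 k)//= D'k preimage_setT.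
  rewrite probability_setT mul1e; congr (_ * _)%E; apply: eq_bigr => j jk.
  by congr (P (_ @^-1` _)); rewrite /D /D'; case: insub => //; rewrite (negbTE jk).
- move=> _; have -> : m1 setT = P (s k @^-1` B).
    by rewrite /m1 /= /pushforward /mrestr preimage_setT setTI.
  by rewrite (PrE P mE) ltry.
Qed.

Section JointLaw.
Variable k : 'I_m.

Let J (x : T) : k.-tuple S * S := (prefix k x, s k x).

Let mJ : measurable_fun [set: T] J.
Proof. by apply: measurable_fun_pair; exact: measurable_funPT. Qed.

HB.instance Definition _ := isMeasurableFun.Build _ _ _ _ J mJ.

Let m1 := distribution P (prefix k).
Let m2 := distribution P (s k).

Let joint_product (C : set (k.-tuple S * S)) : measurable C ->
  (m1 \x m2)%E C = distribution P J C.
Proof.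
apply: product_measure_unique => A B mA mB.
exact: (prefix_indep mA mB).
Qed.

Let integral_joint (g : k.-tuple S * S -> \bar R) :
  (\int[m1 \x m2]_z g z = \int[distribution P J]_z g z)%E.
Proof. by apply: eq_measure_integral => C mC _; exact: joint_product. Qed.

Let integrable_joint (g : k.-tuple S * S -> R) : measurable_fun [set: _] g ->
  itg P (fun x => g (J x)) -> (m1 \x m2)%E.-integrable [set: _] (EFin \o g).
Proof.
move=> mg /integrableP[_ hg]; apply/integrableP; split; first exact/measurable_EFinP.
rewrite integral_joint ge0_integral_distribution//.
by apply: measurableT_comp => //; exact/measurable_EFinP.
Qed.

Lemma mean_prefix_mul (V : k.-tuple S -> R) (a : S -> R) :
  measurable_fun [set: _] V -> measurable_fun [set: _] a ->
  itg P (fun x => V (prefix k x)) -> itg P (fun x => a (s k x)) ->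
  itg P (fun x => V (prefix k x) * a (s k x)) ->
  mean P (fun x => V (prefix k x) * a (s k x)) =
  mean P (fun x => V (prefix k x)) * mean P (fun x => a (s k x)).
Proof.
move=> mV ma iV ia iVa; pose g (z : k.-tuple S * S) := V z.1 * a z.2.
have mg : measurable_fun [set: _] g.
  apply: measurable_funM; [apply: measurableT_comp mV _|apply: measurableT_comp ma _];
  [exact: measurable_fst|exact: measurable_snd].
have ig := integrable_joint mg iVa.
have ia2 : m2.-integrable [set: S] (EFin \o a).
  apply: (integrable_pushforward (phi := s k)) => //.
  exact/measurable_EFinP.
have iV1 : m1.-integrable [set: _] (EFin \o V).
  apply: (integrable_pushforward (phi := prefix k)) => //.
  exact/measurable_EFinP.
have Ea : (\int[m2]_y (a y)%:E = (mean P (fun x => a (s k x)))%:E)%E.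
  rewrite EFin_mean// (integral_distribution (X := s k))//.
  exact/measurable_EFinP.
have EV : (\int[m1]_t (V t)%:E = (mean P (fun x => V (prefix k x)))%:E)%E.
  rewrite EFin_mean// (integral_distribution (X := prefix k))//.
  exact/measurable_EFinP.
apply: EFin_inj; rewrite EFin_mean//.
transitivity (\int[distribution P J]_z (g z)%:E)%E.
  by rewrite integral_distribution//; exact/measurable_EFinP.
rewrite -integral_joint -integral12_prod_meas1//.
transitivity (\int[m1]_t ((mean P (fun x => a (s k x)))%:E * (V t)%:E))%E.
  apply: eq_integral => t _; rewrite /fubini_F /= /g /=.
  under eq_integral do rewrite EFinM.
  by rewrite integralZl// Ea muleC.
by rewrite integralZl// EV -EFinM mulrC.
Qed.

(** Freezing: by Fubini, row [k] may be integrated out with the earlier rows held fixed. This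
    replaces conditioning in the swapping argument. *)
Lemma mean_prefix_bounded (g : k.-tuple S * S -> R) b :
  measurable_fun [set: _] g -> (forall z, `|g z| <= b) ->
  itg P (fun x => mean P (fun x' => g (prefix k x, s k x'))) /\
  mean P (fun x => g (prefix k x, s k x)) =
  mean P (fun x => mean P (fun x' => g (prefix k x, s k x'))).
Proof.
move=> mg gb; pose h t := mean P (fun x' => g (t, s k x')).
have mgt t : measurable_fun [set: S] (fun y => g (t, y)).
  by apply: measurableT_comp mg _; exact: pair1_measurable.
have igt t : itg P (fun x' => g (t, s k x')).
  by apply: (@itg_bounded _ _ _ P _ b) => //; apply: measurableT_comp (mgt t) _.
have igJ : itg P (fun x => g (J x)).
  by apply: (@itg_bounded _ _ _ P _ b) => //; apply: measurableT_comp mg mJ.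
have ig := integrable_joint mg igJ.
have inner_h : (fun t => \int[m2]_y (g (t, y))%:E)%E = EFin \o h.
  apply/funext => t /=; rewrite EFin_mean// integral_distribution//; last exact: igt.
  exact/measurable_EFinP.
have mh : measurable_fun [set: _] h.
  apply/measurable_EFinP; rewrite -inner_h; exact: (measurable_fubini_F ig).
have hb t : `|h t| <= b.
  apply: le_trans (ler_norm_mean (igt t)) _; rewrite -[leRHS](mean_cst P b).
  by apply: ler_mean => //; [exact: itg_norm|exact: itg_cst].
have ih : itg P (fun x => h (prefix k x)).
  by apply: (@itg_bounded _ _ _ P _ b) => //; apply: measurableT_comp mh _.
split => //; apply: EFin_inj; rewrite !EFin_mean//.
transitivity (\int[distribution P J]_z (g z)%:E)%E.
  by rewrite integral_distribution//; exact/measurable_EFinP.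
rewrite -integral_joint -integral12_prod_meas1//.
rewrite -(integral_distribution (X := prefix k) (f := EFin \o h))//; last first.
  exact/measurable_EFinP.
by apply: eq_integral => t _; have := congr1 (fun f => f t) inner_h.
Qed.

End JointLaw.
End Independence.

(** * Measurability of functions of vectors *)

Section VectorMeasurability.
Variable R : realType.

Definition measurable_vec d' (U : measurableType d') d (F : U -> 'cV[R]_d) : Prop :=
  forall j, measurable_fun [set: U] (fun x => F x j 0).

(** Tested along every entrywise measurable family, so that no sigma-algebra on column vectors is
    involved. *)
Definition measurable_on_vec d (f : 'cV[R]_d -> R) : Prop :=
  forall d' (U : measurableType d') (F : U -> 'cV[R]_d), measurable_vec F ->
  measurable_fun [set: U] (fun x => f (F x)).

Lemma measurable_on_vec_avop d (I : finType) (h : I -> 'cV[R]_d) f :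
  measurable_on_vec f -> measurable_on_vec (avop h f).
Proof.
move=> mf d' U F mF; apply: measurable_funM; first exact: measurable_cst.
apply: measurable_sum => i; apply: mf => j.
by under eq_fun do rewrite mxE; apply: measurable_funD.
Qed.

Lemma measurable_on_vec_iter d (I : finType) (h : I -> 'cV[R]_d) n f :
  measurable_on_vec f -> measurable_on_vec (iter n (avop h) f).
Proof. by move=> mf; elim: n => //= n; exact: measurable_on_vec_avop. Qed.

Lemma measurable_frobenius d' (U : measurableType d') p q (F : U -> 'M[R]_(p, q)) :
  (forall i j, measurable_fun [set: U] (fun x => F x i j)) ->
  measurable_fun [set: U] (fun x => frobenius (F x)).
Proof.
move=> mF; have msq : measurable_fun [set: R] (@Num.sqrt R).
  by apply: continuous_measurable_fun; exact: sqrt_continuous.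
apply: (measurableT_comp msq).
apply: measurable_sum => i; apply: measurable_sum => j.
exact: measurable_funX.
Qed.

Lemma measurable_on_vec_step d a e : measurable_on_vec (@smooth_step R d a e).
Proof.
move=> d' U F mF.
have mfr : measurable_fun [set: U] (fun x => frobenius (F x)).
  by apply: measurable_frobenius => i j; rewrite (ord1 j).
have mb b : measurable_fun [set: U] (fun x => bump b (F x)).
  apply: measurable_funX; apply: measurable_maxr; first exact: measurable_cst.
  by apply: measurable_funB => //; exact: measurable_funX.
apply: measurable_funM => //; apply: measurable_funB => //.
apply: measurable_funD; last exact: measurable_funM.
by apply: measurable_funB => //; exact: measurable_funM.
Qed.

End VectorMeasurability.

(** * Second moments and averages of independent, identically distributed rows *)

Section IID.
Context {disp disp' : measure_display} {T : measurableType disp}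
  {S : measurableType disp'} {R : realType}.
Variables (P : probability T R) (m : nat) (s : 'I_m -> {mfun T >-> S}).
Hypothesis indep : mutually_independent P s.
Hypothesis ident : identically_distributed P s.
Implicit Types a : S -> R.

Let eq_distribution i j (g : S -> \bar R) :
  (\int[distribution P (s i)]_y g y = \int[distribution P (s j)]_y g y)%E.
Proof. by apply: eq_measure_integral => C mC _; exact: ident. Qed.

Lemma ident_itg i j a : measurable_fun [set: S] a ->
  itg P (fun x => a (s i x)) -> itg P (fun x => a (s j x)).
Proof.
move=> ma /integrableP[_ ai].
have mas : measurable_fun [set: T] (fun x => a (s j x)).
  by apply: measurableT_comp ma _; exact: measurable_funPT.
apply/integrableP; split; first exact/measurable_EFinP.
have mabs : measurable_fun [set: S] (fun y => `|(a y)%:E|)%E.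
  by apply: measurableT_comp => //; exact/measurable_EFinP.
move: ai; rewrite -(ge0_integral_distribution (s i) mabs)//.
by rewrite -(ge0_integral_distribution (s j) mabs)// (eq_distribution i j).
Qed.

Lemma ident_mean i j a : measurable_fun [set: S] a ->
  itg P (fun x => a (s i x)) ->
  mean P (fun x => a (s i x)) = mean P (fun x => a (s j x)).
Proof.
move=> ma ai; have aj := ident_itg j ma ai.
apply: EFin_inj; rewrite !EFin_mean//.
rewrite -(integral_distribution (X := s i) (f := EFin \o a))//; last exact/measurable_EFinP.
rewrite -(integral_distribution (X := s j) (f := EFin \o a))//; last exact/measurable_EFinP.
Qed.

Let ms a i : measurable_fun [set: S] a -> measurable_fun [set: T] (fun x => a (s i x)).
Proof. by move=> ma; apply: measurableT_comp ma _; exact: measurable_funPT. Qed.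

Lemma sum_prefix (V : nmodType) (F : S -> V) (k : 'I_m) x :
  \sum_(i < m | (i < k)%N) F (s i x) = \sum_(i < k) F (tnth (prefix s k x) i).
Proof.
rewrite (big_ord_narrow (ltnW (ltn_ord k))); apply: eq_bigr => i _.
by rewrite tnth_mktuple; congr (F (s _ x)); apply/val_inj.
Qed.

Lemma sum_prefixS (V : nmodType) (F : 'I_m -> V) (k : 'I_m) :
  \sum_(i < m | (i < k.+1)%N) F i = \sum_(i < m | (i < k)%N) F i + F k.
Proof.
rewrite (bigD1 k)//= addrC; congr (_ + _); apply: eq_bigl => i.
by rewrite ltnS leq_eqVlt -val_eqE /=; lia.
Qed.

Lemma itg_from_sqr (f : T -> R) : measurable_fun [set: T] f ->
  itg P (fun x => f x ^+ 2) -> itg P f.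
Proof.
move=> mf f2; apply: (itg_le mf) (itgD (itg_cst P 1) f2) => x.
have H := sqr_ge0 (`|f x| - 1); have : `|f x| ^+ 2 = f x ^+ 2.
  by rewrite real_normK ?num_real.
by move: H; have := sqr_ge0 (f x); rewrite sqrrB; lra.
Qed.

Lemma itg_mul_sqr (f g : T -> R) : measurable_fun [set: T] f ->
  measurable_fun [set: T] g -> itg P (fun x => f x ^+ 2) ->
  itg P (fun x => g x ^+ 2) -> itg P (fun x => f x * g x).
Proof.
move=> mf mg f2 g2; apply: (itg_le (measurable_funM mf mg)) (itgD f2 g2) => x.
rewrite normrM; have H := sqr_ge0 (`|f x| - `|g x|).
have a1 : `|f x| ^+ 2 = f x ^+ 2 by rewrite real_normK ?num_real.
have a2 : `|g x| ^+ 2 = g x ^+ 2 by rewrite real_normK ?num_real.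
move: H; have := sqr_ge0 (`|f x| + `|g x|); rewrite sqrrB sqrrD.
have := mulr_ge0 (normr_ge0 (f x)) (normr_ge0 (g x)).
by lra.
Qed.

(** Rows are added one at a time; the cross term factors because the partial sum is a function of
    the prefix, and then vanishes since the new row has mean zero. Row [o] stands for the common
    law. *)
Lemma mean_sqr_sum a (o : 'I_m) : measurable_fun [set: S] a ->
  itg P (fun x => a (s o x) ^+ 2) -> mean P (fun x => a (s o x)) = 0 ->
  itg P (fun x => (\sum_i a (s i x)) ^+ 2) /\
  mean P (fun x => (\sum_i a (s i x)) ^+ 2) =
  m%:R * mean P (fun x => a (s o x) ^+ 2).
Proof.
move=> ma a2 a0; pose F x i := a (s i x).
have ma2 : measurable_fun [set: S] (fun y => a y ^+ 2) by exact: measurable_funX.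
suff H k : (k <= m)%N ->
    [/\ measurable_fun [set: T] (fun x => \sum_(i < m | (i < k)%N) F x i),
    itg P (fun x => (\sum_(i < m | (i < k)%N) F x i) ^+ 2) &
    mean P (fun x => (\sum_(i < m | (i < k)%N) F x i) ^+ 2) =
    k%:R * mean P (fun x => a (s o x) ^+ 2)].
  have [_ H1 H2] := H m (leqnn m).
  have E x : \sum_(i < m | (i < m)%N) F x i = \sum_i a (s i x).
    by apply: eq_bigl => i; rewrite ltn_ord.
  split; first by move: H1; apply: eq_integrable => // x _; rewrite /= E.
  by rewrite -H2; apply: eq_mean => x; rewrite E.
elim: k => [_|k IH km].
  have E x : \sum_(i < m | (i < 0)%N) F x i = 0 by rewrite big_pred0.
  under eq_fun do rewrite E; split; first exact: measurable_cst.
    by under eq_fun do rewrite E; exact: itg_cst.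
  by rewrite mul0r -[RHS](mean_cst P); apply: eq_mean => x; rewrite E expr0n.
have [mV V2 EV] := IH (ltnW km); pose k' := Ordinal km.
have ak2 : itg P (fun x => a (s k' x) ^+ 2) by exact: ident_itg ma2 a2.
have ak := itg_from_sqr (ms k' ma) ak2.
pose V x := \sum_(i < m | (i < k)%N) F x i.
have E x : \sum_(i < m | (i < k.+1)%N) F x i = V x + a (s k' x).
  by rewrite (sum_prefixS (F x) k').
have iVa := itg_mul_sqr mV (ms k' ma) V2 ak2.
have E2 x : (\sum_(i < m | (i < k.+1)%N) F x i) ^+ 2 =
    V x ^+ 2 + (2 * (V x * a (s k' x)) + a (s k' x) ^+ 2) by rewrite E; ring.
split.
- by under eq_fun do rewrite E; apply: measurable_funD => //; exact: ms.
- by under eq_fun do rewrite E2; apply: itgD => //; apply: itgD => //; exact: itgZ.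
under eq_mean do rewrite E2.
rewrite meanD//; last by apply: itgD => //; exact: itgZ.
rewrite meanD//; last exact: itgZ.
rewrite meanZ// EV -(natr1 k) [(k%:R + 1) * _]mulrDl mul1r -(ident_mean o ma2 ak2).
congr (_ + _).
suff -> : mean P (fun x => V x * a (s k' x)) = 0 by rewrite mulr0 add0r.
pose G (t : k'.-tuple S) := \sum_(i < k') a (tnth t i).
have VG x : V x = G (prefix s k' x) by exact: (sum_prefix a k' x).
have mG : measurable_fun [set: k'.-tuple S] G.
  apply: measurable_sum => i; apply: measurableT_comp ma _.
  exact: measurable_tnth.
rewrite (_ : (fun x => V x * _) = fun x => G (prefix s k' x) * a (s k' x)); last first.
  by apply/funext => x; rewrite VG.
rewrite (mean_prefix_mul indep mG ma)//.
- by rewrite (ident_mean o ma ak) a0 mulr0.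
- by have := itg_from_sqr mV V2; under eq_fun do rewrite -/(V _) VG.
- by move: iVa; under eq_fun do rewrite -/(V _) VG.
Qed.

Lemma weak_lln a (o : 'I_m) mu v e : (0 < m)%N -> measurable_fun [set: S] a ->
  itg P (fun x => a (s o x)) ->
  itg P (fun x => (a (s o x) - mu) ^+ 2) -> mean P (fun x => a (s o x)) = mu ->
  mean P (fun x => (a (s o x) - mu) ^+ 2) <= v -> 0 < e ->
  measurable [set x | e <= `|avg (fun i => a (s i x)) - mu|] /\
  Pr P [set x | e <= `|avg (fun i => a (s i x)) - mu|] <= v / (m%:R * e ^+ 2).
Proof.
move=> m0 ma a1 a2 amu av e0.
have mb : measurable_fun [set: S] (fun y => a y - mu) by exact: measurable_funB.
have b0 : mean P (fun x => a (s o x) - mu) = 0.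
  by rewrite meanB ?mean_cst ?amu ?subrr//; exact: itg_cst.
have [i2 E2] := mean_sqr_sum mb a2 b0.
have m_neq0 : m%:R != 0 :> R by rewrite pnatr_eq0 -lt0n.
have avE x : avg (fun i => a (s i x)) - mu = m%:R^-1 * \sum_i (a (s i x) - mu).
  rewrite sumrB sumr_const card_ord mulrBr /avg card_ord; congr (_ - _).
  by rewrite -[mu *+ m]mulr_natl mulKf.
have s_ge0 x : 0 <= (\sum_i (a (s i x) - mu)) ^+ 2 by exact: sqr_ge0.
have me0 : 0 < (m%:R * e) ^+ 2 by rewrite exprn_gt0// mulr_gt0// ltr0n.
have [mset H] := markov_Pr i2 s_ge0 me0.
have -> : [set x | e <= `|avg (fun i => a (s i x)) - mu|] =
    [set x | (m%:R * e) ^+ 2 <= (\sum_i (a (s i x) - mu)) ^+ 2].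
  have HE x : (e <= `|avg (fun i => a (s i x)) - mu|) =
      ((m%:R * e) ^+ 2 <= (\sum_i (a (s i x) - mu)) ^+ 2).
    rewrite avE normrM ger0_norm ?invr_ge0// mulrC ler_pdivlMr ?ltr0n//.
    rewrite -[X in _ = (_ <= X)]real_normK ?num_real//.
    by rewrite ler_pXn2r ?nnegrE ?mulr_ge0 ?(ltW e0)// mulrC.
  by apply/seteqP; split => x /=; rewrite HE.
split => //; apply: le_trans H _; rewrite E2 ler_pdivrMr//.
have -> : v / (m%:R * e ^+ 2) * (m%:R * e) ^+ 2 = m%:R * v.
  by field; rewrite gt_eqF ?m_neq0.
by rewrite ler_wpM2l.
Qed.

Lemma markov_avg a (o : 'I_m) K : (0 < m)%N -> measurable_fun [set: S] a ->
  itg P (fun x => a (s o x)) -> (forall y, 0 <= a y) -> 0 < K ->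
  measurable [set x | K <= avg (fun i => a (s i x))] /\
  Pr P [set x | K <= avg (fun i => a (s i x))] <= mean P (fun x => a (s o x)) / K.
Proof.
move=> m0 ma ao a0 K0.
have ai i : itg P (fun x => a (s i x)) by exact: ident_itg ma ao.
have iavg : itg P (fun x => avg (fun i => a (s i x))) by apply: itgZ; exact: itg_sum.
have avg0 x : 0 <= avg (fun i => a (s i x)) by exact: avg_ge0.
have [mA H] := markov_Pr iavg avg0 K0; split => //.
apply: le_trans H _; rewrite ler_wpM2r ?invr_ge0 ?(ltW K0)//.
rewrite /avg meanZ ?mean_sum//; last exact: itg_sum.
rewrite (eq_bigr (fun=> mean P (fun x => a (s o x)))); last first.
  by move=> i _; apply: ident_mean.
by rewrite sumr_const card_ord -[mean P _ *+ m]mulr_natl mulKf// pnatr_eq0 -lt0n.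
Qed.

End IID.

(** * Swapping independent rows for walk steps *)

Section Lindeberg.
Variables (R : realType) (d : nat).

Lemma mean_taylor (disp : measure_display) (T : measurableType disp)
    (P : probability T R) (h : T -> 'cV[R]_d) f C l (q : 'cV[R]_d -> 'M[R]_d) x :
  (forall x h, `|f (x + h) - f x - dot (l x) h - quad (q x) h|
               <= C * frobenius h ^+ 3) ->
  (forall j, itg P (fun w => h w j 0)) -> (forall j, mean P (fun w => h w j 0) = 0) ->
  (forall i j, itg P (fun w => h w i 0 * h w j 0)) ->
  itg P (fun w => frobenius (h w) ^+ 3) -> itg P (fun w => f (x + h w)) ->
  `|mean P (fun w => f (x + h w)) - f x
    - mxdot (q x) (\matrix_(i, j) mean P (fun w => h w i 0 * h w j 0))|
  <= C * mean P (fun w => frobenius (h w) ^+ 3).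
Proof.
move=> fT h1 h0 h2 h3 fi.
have id1 : itg P (fun w => dot (l x) (h w)) by apply: itg_sum => j; exact: itgZ.
have id2 : itg P (fun w => quad (q x) (h w)).
  by apply: itg_sum => i; apply: itg_sum => j; exact: itgZ.
have i1 : itg P (fun w => f (x + h w) - f x) by apply: itgB => //; exact: itg_cst.
have i2 : itg P (fun w => f (x + h w) - f x - dot (l x) (h w)) by exact: itgB.
have -> : mean P (fun w => f (x + h w)) - f x
    - mxdot (q x) (\matrix_(i, j) mean P (fun w => h w i 0 * h w j 0)) =
   mean P (fun w => f (x + h w) - f x - dot (l x) (h w) - quad (q x) (h w)).
  have Edot : mean P (fun w => dot (l x) (h w)) = 0.
    rewrite /dot mean_sum; last by move=> j; exact: itgZ.
    by rewrite big1// => j _; rewrite meanZ// h0 mulr0.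
  have Equad : mean P (fun w => quad (q x) (h w)) =
      mxdot (q x) (\matrix_(i, j) mean P (fun w => h w i 0 * h w j 0)).
    rewrite /quad mean_sum; last by move=> i; apply: itg_sum => j; exact: itgZ.
    apply: eq_bigr => i _; rewrite mean_sum; last by move=> j; exact: itgZ.
    by apply: eq_bigr => j _; rewrite meanZ// mxE.
  rewrite (meanB i2 id2) (meanB i1 id1) (meanB fi (itg_cst P (f x))) mean_cst.
  by rewrite Edot Equad subr0.
have i3 := itgB i2 id2.
apply: le_trans (ler_norm_mean (itgB i2 id2)) _; rewrite -meanZ//.
by apply: ler_mean => //; [exact: itg_norm (itgB i2 id2)|exact: itgZ].
Qed.

Lemma mean_iter_avop (disp : measure_display) (T : measurableType disp)
    (P : probability T R) (I : finType) (k : I -> 'cV[R]_d) (h : T -> 'cV[R]_d)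
    (f : 'cV[R]_d -> R) b n x : (0 < #|I|)%N ->
  measurable_on_vec f -> (forall x, `|f x| <= b) -> measurable_vec h ->
  mean P (fun w => iter n (avop k) f (x + h w)) =
  iter n (avop k) (fun x => mean P (fun w => f (x + h w))) x.
Proof.
move=> I0 mf fb mh; elim: n x => // n IH x.
have mxh y : measurable_vec (fun w => y + h w).
  move=> j; under eq_fun do rewrite mxE.
  by apply: measurable_funD => //; exact: mh.
have ii i : itg P (fun w => iter n (avop k) f (x + h w + k i)).
  apply: (@itg_bounded _ _ _ P _ b); last first.
    by move=> w; apply: iter_avop_norm.
  rewrite (_ : (fun w => _) = fun w => iter n (avop k) f ((x + k i) + h w)).
    exact: measurable_on_vec_iter mf _ _ _ _.
  by apply/funext => w; rewrite addrAC.
transitivity (mean P (fun w => avg (fun i => iter n (avop k) f (x + h w + k i)))) => //.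
rewrite /avg meanZ ?mean_sum//; last exact: itg_sum.
rewrite iterS /avop /avg; congr (_ * _); apply: eq_bigr => i _.
rewrite -[RHS]IH; apply: eq_mean => w; by rewrite addrAC.
Qed.

(** The random sum is swapped for the walk one row at a time. The walk steps are carried by iterates
    of the averaging operator, so no signs have to be realized on the probability space of the rows,
    and the constant is the same for all such spaces. *)
Lemma lindeberg (L : 'M[R]_d) (f : 'cV[R]_d -> R) : taylor3 f ->
  measurable_on_vec f -> (forall x, `|f x| <= 1) ->
  exists2 C : R, 0 <= C &
  forall (disp disp' : measure_display) (T : measurableType disp)
    (S : measurableType disp') (P : probability T R) (m : nat)
    (s : 'I_m -> {mfun T >-> S}) (psi : S -> 'cV[R]_d) (o : 'I_m) (e K4 : R),
  mutually_independent P s -> identically_distributed P s ->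
  measurable_vec psi -> (forall j, mean P (fun x => psi (s o x) j 0) = 0) ->
  itg P (fun x => frobenius (psi (s o x)) ^+ 4) ->
  mean P (fun x => frobenius (psi (s o x)) ^+ 4) <= K4 ->
  (forall i j, `|mean P (fun x => psi (s o x) i 0 * psi (s o x) j 0) -
                 (L *m L^T) i j| <= e) ->
  `|mean P (fun x => f ((Num.sqrt m%:R)^-1 *: \sum_i psi (s i x))) - walk L m f|
  <= C * (d%:R ^+ 2 * e + (1 + K4 + col_norms L ^+ 3) / Num.sqrt m%:R).
Proof.
move=> [C [l [q [C0 qC fT]]]] mf fb; exists C => //.
move=> disp disp' T S P m s psi o e K4 indep ident mpsi psi0 i4 m4 cov.
have m0 : (0 < m)%N by case: m s o {i4 m4 cov psi0 indep ident} => // ? [].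
set c := (Num.sqrt m%:R)^-1.
have s0 : 0 < Num.sqrt m%:R :> R by rewrite sqrtr_gt0 ltr0n.
have c_gt0 : 0 < c by rewrite invr_gt0.
have mc : m%:R * c ^+ 2 = 1 :> R.
  by rewrite exprVn sqr_sqrtr// mulfV// pnatr_eq0 -lt0n.
have mentry i j : measurable_fun [set: S] (fun y => psi y i 0 * psi y j 0).
  by apply: measurable_funM; exact: mpsi.
have mfrob : measurable_fun [set: S] (fun y => frobenius (psi y)).
  by apply: measurable_frobenius => i j; rewrite (ord1 j); exact: mpsi.
have msk (a : S -> R) k : measurable_fun [set: S] a -> measurable_fun [set: T] (fun x => a (s k x)).
  by move=> ma; apply: measurableT_comp ma _; exact: measurable_funPT.
have mf4 : measurable_fun [set: S] (fun y => frobenius (psi y) ^+ 4).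
  exact: measurable_funX.
have mf3 : measurable_fun [set: S] (fun y => frobenius (psi y) ^+ 3).
  exact: measurable_funX.
have i4k k : itg P (fun x => frobenius (psi (s k x)) ^+ 4) by exact: ident_itg mf4 i4.
have i3k k : itg P (fun x => frobenius (psi (s k x)) ^+ 3).
  apply: (itg_le (msk _ k mf3)) (itgD (itg_cst P 1) (i4k k)) => x.
  have [_ H] := pow4_ge (frobenius_ge0 (psi (s k x))).
  by rewrite ger0_norm// exprn_ge0// frobenius_ge0.
have i2k k i j : itg P (fun x => psi (s k x) i 0 * psi (s k x) j 0).
  apply: (itg_le (msk _ k (mentry i j))) (itgD (itg_cst P 1) (i4k k)) => x.
  have [H _] := pow4_ge (frobenius_ge0 (psi (s k x))).
  apply: le_trans H; rewrite normrM expr2.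
  by apply: ler_pM => //; exact: ler_entry_frobenius.
have i1k k j : itg P (fun x => psi (s k x) j 0).
  apply: itg_from_sqr; first exact: msk (mpsi j).
  by under eq_fun do rewrite expr2; exact: i2k.
pose h k x := c *: psi (s k x).
pose W := @avop R _ _ (rademacher L c).
have mh k : measurable_vec (h k).
  move=> j; under eq_fun do rewrite mxE.
  by apply: measurable_funM => //; exact: msk (mpsi j).
have fhi k x : itg P (fun w => f (x + h k w)).
  apply: (@itg_bounded _ _ _ P _ 1) => //; apply: mf => j.
  by under eq_fun do rewrite mxE; apply: measurable_funD => //; exact: mh.
pose E := C * (d%:R ^+ 2 * (c ^+ 2 * e) + c ^+ 3 * (1 + K4) + c ^+ 3 * col_norms L ^+ 3).
have step k x : `|mean P (fun w => f (x + h k w)) - W f x| <= E.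
  have Hh : `|mean P (fun w => f (x + h k w)) - f x - mxdot (q x)
      (\matrix_(i, j) mean P (fun w => h k w i 0 * h k w j 0))|
      <= C * mean P (fun w => frobenius (h k w) ^+ 3).
    apply: mean_taylor => //.
    - by move=> j; under eq_fun do rewrite mxE; exact: itgZ.
    - move=> j; under eq_mean do rewrite mxE.
      by rewrite meanZ// (ident_mean ident o (mpsi j) (i1k k j)) psi0 mulr0.
    - move=> i j; have := itgZ (c * c) (i2k k i j); apply: eq_integrable => // w _.
      by rewrite /= !mxE; congr EFin; ring.
    - have := itgZ (c ^+ 3) (i3k k); apply: eq_integrable => // w _.
      by rewrite /= frobeniusZ exprMn ger0_norm// ltW.
  have Hk := avop_taylor (card_signs d) fT (avg_rademacher L c) x.
  rewrite -/(W f x) in Hk.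
  have Hq : `|mxdot (q x) (\matrix_(i, j) mean P (fun w => h k w i 0 * h k w j 0))
      - mxdot (q x) (covmx (rademacher L c))| <= C * (d%:R ^+ 2 * (c ^+ 2 * e)).
    rewrite -mxdotB; apply: mxdot_le => // i j; rewrite covmx_rademacher.
    have -> : ((\matrix_(i, j) mean P (fun w => h k w i 0 * h k w j 0)) -
       c ^+ 2 *: (L *m L^T)) i j =
       c ^+ 2 * (mean P (fun x => psi (s o x) i 0 * psi (s o x) j 0) - (L *m L^T) i j).
      move: (L *m L^T) => M; rewrite mulrBr !mxE.
      congr (_ - _); rewrite (ident_mean ident k (mentry i j) (i2k o i j)).
      by rewrite -meanZ//; apply: eq_mean => w; rewrite !mxE; ring.
    by rewrite normrM ger0_norm ?sqr_ge0// ler_wpM2l ?sqr_ge0.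
  have -> : mean P (fun w => f (x + h k w)) - W f x =
    (mxdot (q x) (\matrix_(i, j) mean P (fun w => h k w i 0 * h k w j 0))
      - mxdot (q x) (covmx (rademacher L c))) +
    (mean P (fun w => f (x + h k w)) - f x - mxdot (q x)
      (\matrix_(i, j) mean P (fun w => h k w i 0 * h k w j 0))) -
    (W f x - f x - mxdot (q x) (covmx (rademacher L c))) by ring.
  apply: le_trans (ler_normB _ _) _; rewrite /E mulrDr lerD//; last first.
    apply: le_trans Hk _; rewrite ler_wpM2l//.
    by have := avg_rademacher_cube L c; rewrite ger0_norm ?(ltW c_gt0).
  apply: le_trans (ler_normD _ _) _; rewrite mulrDr lerD//.
  apply: le_trans Hh _; rewrite ler_wpM2l//.
  have -> : mean P (fun w => frobenius (h k w) ^+ 3) =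
     c ^+ 3 * mean P (fun w => frobenius (psi (s k w)) ^+ 3).
    rewrite -meanZ//; apply: eq_mean => w.
    by rewrite frobeniusZ exprMn ger0_norm// ltW.
  rewrite ler_wpM2l ?exprn_ge0 ?(ltW c_gt0)//.
  apply: (@le_trans _ _ (mean P (fun w => 1 + frobenius (psi (s k w)) ^+ 4))).
    apply: ler_mean => //; first by apply: itgD => //; exact: itg_cst.
    by move=> w; case: (pow4_ge (frobenius_ge0 (psi (s k w)))).
  rewrite meanD// ?mean_cst ?lerD2l; last exact: itg_cst.
  by rewrite -(ident_mean ident k mf4 i4).
(* The hybrid at stage [k] has [k] genuine rows in [Y k] and [m - k] walk steps in the operator: it
   is the walk at [k = 0] and the full sum at [k = m]. *)
pose Y k x := \sum_(i < m | (i < k)%N) h i x.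
have mY k : measurable_vec (Y k).
  move=> j; under eq_fun do rewrite summxE big_mkcond.
  apply: measurable_sum => i.
  by case: (i < k)%N; [exact: mh|exact: measurable_cst].
have H k : (k <= m)%N ->
    `|mean P (fun x => iter (m - k) W f (Y k x)) - walk L m f| <= k%:R * E.
  elim: k => [_|k IH km].
    rewrite mul0r (_ : mean _ _ = walk L m f) ?subrr ?normr0// -[RHS](mean_cst P).
    by apply: eq_mean => x; rewrite /Y big_pred0// subn0.
  pose k' := Ordinal km; pose g := iter (m - k.+1) W f.
  have mg : measurable_on_vec g by exact: measurable_on_vec_iter.
  have gb x : `|g x| <= 1 by apply: iter_avop_norm => //; exact: card_signs.
  have YS x : Y k.+1 x = Y k x + h k' x by rewrite /Y (sum_prefixS (fun i => h i x) k').
  have Wg : iter (m - k) W f = W g by rewrite -iterS -subSn.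
  pose V (t : k'.-tuple S) : 'cV[R]_d := \sum_(i < k') c *: psi (tnth t i).
  have YV x : Y k x = V (prefix s k' x).
    exact: (sum_prefix s (fun y => c *: psi y) k' x).
  pose G (z : k'.-tuple S * S) := g (V z.1 + c *: psi z.2).
  have mG : measurable_fun [set: _] G.
    apply: mg => j; under eq_fun do rewrite !mxE summxE.
    apply: measurable_funD.
      apply: measurable_sum => i; under eq_fun do rewrite mxE.
      apply: measurable_funM => //; apply: measurableT_comp (mpsi j) _.
      by apply: measurableT_comp (@measurable_tnth _ _ _ i) _.
    by apply: measurable_funM => //; apply: measurableT_comp (mpsi j) _.
  have [iG EG] := mean_prefix_bounded indep (k := k') mG (fun z => gb _).
  have Dk : mean P (fun x => g (Y k.+1 x)) =
      mean P (fun x => mean P (fun x' => G (prefix s k' x, s k' x'))).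
    by rewrite -EG; apply: eq_mean => x; rewrite YS YV.
  have iW : itg P (fun x => W g (Y k x)).
    apply: (@itg_bounded _ _ _ P _ 1).
      exact: (measurable_on_vec_avop _ mg) (mY k).
    by move=> x; apply: avop_norm_le => //; exact: card_signs.
  (* With the earlier rows frozen, the mean over row [k] commutes with the remaining walk steps, so
     the one-step bound [step] passes through them unchanged. *)
  have close x : `|mean P (fun x' => G (prefix s k' x, s k' x')) - W g (Y k x)| <= E.
    rewrite /G /= -YV /g.
    rewrite (mean_iter_avop P _ (h := h k') (b := 1)) //; [|exact: card_signs].
    rewrite -iterS iterSr -iter_avopB; apply: iter_avop_norm => [|y]; first exact: card_signs.
    exact: step.
  have D : `|mean P (fun x => g (Y k.+1 x)) - mean P (fun x => W g (Y k x))| <= E.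
    rewrite Dk -meanB//; apply: le_trans (ler_norm_mean (itgB iG iW)) _.
    rewrite -[leRHS](mean_cst P E); apply: ler_mean => //; last exact: itg_cst.
    exact: itg_norm (itgB iG iW).
  have := IH (ltnW km); rewrite Wg => IH'.
  rewrite -/g (_ : _ - _ = (mean P (fun x => g (Y k.+1 x)) - mean P (fun x => W g (Y k x)))
    + (mean P (fun x => W g (Y k x)) - walk L m f)); last by ring.
  by apply: le_trans (ler_normD _ _) _; rewrite -natr1 mulrDl mul1r addrC lerD.
have := H m (leqnn m); rewrite subnn /=.
have -> : mean P (fun x => f (Y m x)) =
    mean P (fun x => f (c *: \sum_i psi (s i x))).
  apply: eq_mean => x; congr f; rewrite scaler_sumr /Y.
  by apply: eq_bigl => i; rewrite ltn_ord.
move=> /le_trans; apply; rewrite /E mulrCA ler_wpM2l//.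
rewrite le_eqVlt; apply/orP; left; apply/eqP.
transitivity ((m%:R * c ^+ 2) * (d%:R ^+ 2 * e + (1 + K4 + col_norms L ^+ 3) * c)).
  by ring.
by rewrite mc mul1r.
Qed.

End Lindeberg.

(** * Entrywise measurability of matrix operations *)

Section MatrixMeasurability.
Context {disp : measure_display} {U : measurableType disp} {R : realType}.

Definition measurable_mx p q (F : U -> 'M[R]_(p, q)) : Prop :=
  forall i j, measurable_fun [set: U] (fun x => F x i j).

Lemma measurable_mx_cst p q (M : 'M[R]_(p, q)) : measurable_mx (fun=> M).
Proof. by move=> i j; exact: measurable_cst. Qed.

Lemma measurable_mxD p q (F G : U -> 'M[R]_(p, q)) :
  measurable_mx F -> measurable_mx G -> measurable_mx (fun x => F x + G x).
Proof.
by move=> mF mG i j; under eq_fun do rewrite mxE; exact: measurable_funD.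
Qed.

Lemma measurable_mxZ p q (a : U -> R) (F : U -> 'M[R]_(p, q)) : measurable_fun [set: U] a ->
  measurable_mx F -> measurable_mx (fun x => a x *: F x).
Proof.
by move=> ma mF i j; under eq_fun do rewrite mxE; exact: measurable_funM.
Qed.

Lemma measurable_mxB p q (F G : U -> 'M[R]_(p, q)) :
  measurable_mx F -> measurable_mx G -> measurable_mx (fun x => F x - G x).
Proof.
by move=> mF mG i j; under eq_fun do rewrite !mxE; exact: measurable_funB.
Qed.

Lemma measurable_mxM p q r (F : U -> 'M[R]_(p, q)) (G : U -> 'M[R]_(q, r)) :
  measurable_mx F -> measurable_mx G -> measurable_mx (fun x => F x *m G x).
Proof.
move=> mF mG i j; under eq_fun do rewrite mxE.
by apply: measurable_sum => k; exact: measurable_funM.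
Qed.

Lemma measurable_mxT p q (F : U -> 'M[R]_(p, q)) :
  measurable_mx F -> measurable_mx (fun x => (F x)^T).
Proof. by move=> mF i j; under eq_fun do rewrite mxE; exact: mF. Qed.

Lemma measurable_mx_sum (I : finType) p q (F : I -> U -> 'M[R]_(p, q)) :
  (forall i, measurable_mx (F i)) -> measurable_mx (fun x => \sum_i F i x).
Proof.
move=> mF i j; under eq_fun do rewrite summxE.
by apply: measurable_sum => k; exact: mF.
Qed.

Lemma measurable_det d (F : U -> 'M[R]_d) : measurable_mx F ->
  measurable_fun [set: U] (fun x => \det (F x)).
Proof.
move=> mF; apply: measurable_sum => s; apply: measurable_funM => //.
by apply: measurable_prod => i _; exact: mF.
Qed.

(** The inverse is written as [f / f^2] with [1 / f^2 = exp (- ln (f^2))], a composite of measurable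
    functions for either sign of [f]. *)
Lemma measurable_inv (f : U -> R) : measurable_fun [set: U] f ->
  (forall x, f x != 0) -> measurable_fun [set: U] (fun x => (f x)^-1).
Proof.
move=> mf f0.
have f2 x : 0 < f x ^+ 2 by rewrite exprn_even_gt0//= f0.
rewrite (_ : (fun x => (f x)^-1) = fun x => f x * expR (- ln (f x ^+ 2))).
  apply: measurable_funM => //; apply: measurableT_comp => //.
  apply: measurable_funN; apply: measurableT_comp; first exact: measurable_ln.
  exact: measurable_funX.
apply/funext => x; rewrite expRN lnK ?posrE//.
by rewrite expr2 invfM mulrA mulfV// mul1r.
Qed.

Lemma measurable_cofactor d (F : U -> 'M[R]_d) i j : measurable_mx F ->
  measurable_fun [set: U] (fun x => cofactor (F x) i j).
Proof.
move=> mF; apply: measurable_funM => //; apply: measurable_det => a b.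
by under eq_fun do rewrite !mxE; exact: mF.
Qed.

Lemma measurable_invmx d (F : U -> 'M[R]_d) : measurable_mx F ->
  (forall x, F x \in unitmx) -> measurable_mx (fun x => invmx (F x)).
Proof.
move=> mF Fu i j.
have E x : invmx (F x) i j = (\det (F x))^-1 * cofactor (F x) j i.
  by rewrite /invmx Fu !mxE.
under eq_fun do rewrite E; apply: measurable_funM; last exact: measurable_cofactor.
apply: measurable_inv; first exact: measurable_det.
by move=> x; have := Fu x; rewrite unitmxE unitfE.
Qed.

End MatrixMeasurability.

(** * Measurability of the sketched and bootstrapped quantities *)

Section SketchMeasurability.
Variables (R : realType) (n d m : nat) (X : 'M[R]_(n, d)) (y : 'cV[R]_n) (lam : R).
Hypothesis lam_gt0 : 0 < lam.

Lemma coercive_psd (H : 'M[R]_d) : (forall v, 0 <= quad H v) ->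
  coercive lam (H + lam%:M).
Proof. by move=> Hp v; rewrite quadD quad_scalar lerDr. Qed.

Lemma quad_outer_sum (c : 'I_m -> R) (z : 'I_m -> 'cV[R]_d) v : (forall i, 0 <= c i) ->
  0 <= quad (m%:R^-1 *: \sum_i c i *: (z i *m (z i)^T)) v.
Proof.
move=> c0; rewrite quad_dot -scalemxAl dotZr mulr_ge0 ?invr_ge0//.
rewrite mulmx_suml (_ : dot v _ = \sum_i c i * dot v (z i) ^+ 2).
  by apply: sumr_ge0 => i _; rewrite mulr_ge0 ?sqr_ge0.
rewrite {1}/dot; under eq_bigr do rewrite summxE big_distrr /=.
rewrite exchange_big /=; apply: eq_bigr => i _.
rewrite -[LHS]/(dot v (c i *: (z i *m (z i)^T) *m v)) -scalemxAl dotZr; congr (_ * _).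
rewrite -mulmxA [(z i)^T *m v]mx11_scalar -dot_mx mul_mx_scalar dotZr.
by rewrite (dotC v) expr2.
Qed.

(** A positive [lam] makes the regularized matrices invertible for every outcome, so measurability
    of [invmx] requires no case split. *)
Lemma bootK_unit s (w : m.-tuple nat) : bootH X s w + lam%:M \in unitmx.
Proof.
by apply: (coercive_unit lam_gt0); apply: coercive_psd => v; exact: quad_outer_sum.
Qed.

Lemma sketchK_unit (s : 'I_m -> 'cV[R]_n) : sketchH X s + lam%:M \in unitmx.
Proof.
apply: (coercive_unit lam_gt0); apply: coercive_psd => v.
have := @quad_outer_sum (fun=> 1) (fun i => zrow X (s i)) v (fun=> ler01).
by rewrite /sketchH; under eq_bigr do rewrite scale1r.
Qed.

Section Fun.
Context {disp : measure_display} {U : measurableType disp}.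
Variable s : U -> 'I_m -> 'cV[R]_n.
Hypothesis ms : forall i, measurable_mx (fun x => s x i).

Lemma measurable_zrow i : measurable_mx (fun x => zrow X (s x i)).
Proof.
apply: measurable_mxZ; first exact: measurable_cst.
by apply: measurable_mxM => //; exact: measurable_mx_cst.
Qed.

Lemma measurable_urow i : measurable_fun [set: U] (fun x => urow y (s x i)).
Proof.
apply: measurable_funM; first exact: measurable_cst.
by apply: (@measurable_mxM _ _ _ _ _ _ (fun=> y^T)) => //; exact: measurable_mx_cst.
Qed.

Lemma measurable_zz i : measurable_mx (fun x => zrow X (s x i) *m (zrow X (s x i))^T).
Proof.
by apply: measurable_mxM; [|apply: measurable_mxT]; exact: measurable_zrow.
Qed.

Lemma measurable_sketchH : measurable_mx (fun x => sketchH X (s x)).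
Proof.
apply: measurable_mxZ; first exact: measurable_cst.
by apply: measurable_mx_sum => i; exact: measurable_zz.
Qed.

Lemma measurable_bootH w : measurable_mx (fun x => bootH X (s x) w).
Proof.
apply: measurable_mxZ; first exact: measurable_cst.
apply: measurable_mx_sum => i; apply: measurable_mxZ; last exact: measurable_zz.
exact: measurable_cst.
Qed.

Lemma measurable_sketch_beta : measurable_mx (fun x => sketch_beta X y lam (s x)).
Proof.
apply: measurable_mxM.
  apply: measurable_invmx; last by move=> x; exact: sketchK_unit.
  by apply: measurable_mxD; [exact: measurable_sketchH|exact: measurable_mx_cst].
apply: measurable_mxZ; first exact: measurable_cst.
apply: measurable_mx_sum => i.
by apply: measurable_mxZ; [exact: measurable_urow|exact: measurable_zrow].
Qed.

Lemma measurable_boot_beta w : measurable_mx (fun x => boot_beta X y lam (s x) w).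
Proof.
apply: measurable_mxM.
  apply: measurable_invmx; last by move=> x; exact: bootK_unit.
  by apply: measurable_mxD; [exact: measurable_bootH|exact: measurable_mx_cst].
apply: measurable_mxZ; first exact: measurable_cst.
apply: measurable_mx_sum => i; apply: measurable_mxZ; last exact: measurable_zrow.
by apply: measurable_funM; [exact: measurable_cst|exact: measurable_urow].
Qed.

Lemma measurable_sketch_err :
  measurable_fun [set: U] (fun x => sketch_err X y lam (s x)).
Proof.
apply: measurable_funM; first exact: measurable_cst.
apply: measurable_frobenius; apply: measurable_mxB; last exact: measurable_mx_cst.
exact: measurable_sketch_beta.
Qed.

Lemma measurable_boot_err w :
  measurable_fun [set: U] (fun x => boot_err X y lam (s x) w).
Proof.
apply: measurable_funM; first exact: measurable_cst.
apply: measurable_frobenius; apply: measurable_mxB.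
  exact: measurable_boot_beta.
exact: measurable_sketch_beta.
Qed.

Lemma measurable_boot_cdf t :
  measurable_fun [set: U] (fun x => boot_cdf X y lam (s x) t).
Proof.
apply: measurable_funM; first exact: measurable_cst.
apply: measurable_sum => phi; apply: measurable_boolr.
by apply: measurable_set_le; [exact: measurable_boot_err|exact: measurable_cst].
Qed.

Lemma measurable_influence i : measurable_mx (fun x => influence X y lam (s x i)).
Proof.
apply: measurable_mxM; first exact: measurable_mx_cst.
apply: measurable_mxB; last exact: measurable_mx_cst.
apply: measurable_mxZ; last exact: measurable_zrow.
apply: measurable_funB; first exact: measurable_urow.
apply: (measurable_mxM (G := fun=> _)); last exact: measurable_mx_cst.
by apply: measurable_mxT; exact: measurable_zrow.
Qed.

Lemma measurable_sketch_sum : measurable_mx (fun x => sketch_sum X y lam (s x)).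
Proof.
apply: measurable_mxZ; first exact: measurable_cst.
by apply: measurable_mx_sum => i; exact: measurable_influence.
Qed.

End Fun.
End SketchMeasurability.

(** * Conditional law of the bootstrap *)

Section BootLaw.
Context {disp disp' : measure_display} {T : measurableType disp}
  {S : measurableType disp'} {R : realType}.
Variables (P : probability T R) (m : nat) (s : 'I_m -> {mfun T >-> S}).
Hypothesis m_gt0 : (0 < m)%N.

Let G := g_sigma_preimage (fun i => s i : T -> S).

Definition bundle (x : T) : m.-tuple S := [tuple s i x | i < m].

Lemma measurable_bundle : measurable_fun [set: T] bundle.
Proof.
apply/measurable_fun_tnthP => i.
rewrite (_ : _ \o _ = s i); first exact: measurable_funPT.
by apply/funext => x /=; rewrite tnth_mktuple.
Qed.

Lemma bundle_sigma (D : set (m.-tuple S)) : measurable D -> G (bundle @^-1` D).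
Proof.
move=> mD; have := g_sigma_preimage_comp (fun i (t : m.-tuple S) => tnth t i) bundle.
rewrite (_ : (fun i => _ \o bundle) = fun i => s i : T -> S); last first.
  by apply/funext => i; apply/funext => x /=; rewrite tnth_mktuple.
by rewrite /G => ->; exists D => //; rewrite setTI.
Qed.

Lemma sigma_measurable C : G C -> measurable C.
Proof.
have := g_sigma_preimage_comp (fun i (t : m.-tuple S) => tnth t i) bundle.
rewrite (_ : (fun i => _ \o bundle) = fun i => s i : T -> S); last first.
  by apply/funext => i; apply/funext => x /=; rewrite tnth_mktuple.
rewrite /G => -> [D mD <-]; exact: measurable_bundle.
Qed.

Lemma sigmaI A B : G A -> G B -> G (A `&` B).
Proof. exact: (@measurableI _ (g_sigma_algebraType _)). Qed.

Lemma sigmaC A : G A -> G (~` A).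
Proof. exact: (@measurableC _ (g_sigma_algebraType _)). Qed.

Variables (B : nat) (w : 'I_B -> T -> m.-tuple nat).
Hypothesis mw : forall b, measurable_fun [set: T] (w b).
Hypothesis w_boot : bootstrap_weights P G w.

Definition weights (x : T) : B.-tuple (m.-tuple nat) := [tuple w b x | b < B].

Definition counts (phi : B.-tuple (m.-tuple 'I_m)) : B.-tuple (m.-tuple nat) :=
  [tuple cnt (tnth phi b) | b < B].

Lemma weights_eq (k : B.-tuple (m.-tuple nat)) :
  [set x | weights x == k] = [set x | forall b, w b x = tnth k b].
Proof.
apply/seteqP; split => x /= => [/eqP <- b|H]; first by rewrite tnth_mktuple.
by apply/eqP/eq_from_tnth => b; rewrite tnth_mktuple.
Qed.

Lemma measurable_tuple_nat1 (k : m.-tuple nat) : measurable [set k].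
Proof.
rewrite (_ : [set k] = \bigcap_i ((@tnth _ nat ^~ i) @^-1` [set tnth k i])).
  apply: fin_bigcap_measurable => [|i _]; first exact: finite_finset.
  by rewrite -[X in measurable X]setTI; exact: measurable_tnth.
apply/seteqP; split => [t -> i _ //|t H].
by apply: eq_from_tnth => i; exact: (H i).
Qed.

Lemma measurable_weights_eq k : measurable [set x | weights x == k].
Proof.
rewrite weights_eq (_ : [set x | _] = \bigcap_b (w b @^-1` [set tnth k b])).
  apply: fin_bigcap_measurable => [|b _]; first exact: finite_finset.
  rewrite -[X in measurable X]setTI; apply: mw => //.
  exact: measurable_tuple_nat1.
by apply/seteqP; split => x /= H => [b _|b]; exact: H.
Qed.

(** The [B] conditionally independent multinomial vectors become the counts of one uniform element
    of [B.-tuple (m.-tuple 'I_m)], independent of the sketch events. *)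
Lemma Pr_weights k C : G C ->
  Pr P ([set x | weights x == k] `&` C) =
  avg (fun phi : B.-tuple (m.-tuple 'I_m) => (counts phi == k)%:R) * Pr P C.
Proof.
move=> GC; have mC := sigma_measurable GC.
have [_ /(_ C GC)] := w_boot (fun b => tnth k b).
rewrite integral_cst// -weights_eq /Pr => <-.
rewrite fineM ?fin_num_measure//; congr (_ * _) => /=.
under eq_bigr do rewrite multinomial_pmfE//.
rewrite -avg_prod; apply: eq_avg => phi; rewrite -natr_prod.
have -> : (counts phi == k) = [forall b, cnt (tnth phi b) == tnth k b].
  apply/eqP/forallP => [<- b|H]; first by rewrite tnth_mktuple.
  by apply: eq_from_tnth => b; rewrite tnth_mktuple; apply/eqP.
case: forallP => [H|/forallP]; first by rewrite big1// => b _; rewrite H.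
by rewrite negb_forall => /existsP[b /negbTE H]; rewrite (bigD1 b)//= H mul0n.
Qed.

(* Weights that are not the counts of a tuple of indices are simply discarded;
   applying this to [E] and to its complement then gives equality. *)
Lemma boot_law_ge (E : B.-tuple (m.-tuple nat) -> T -> bool) :
  (forall k, G [set x | E k x]) -> measurable [set x | E (weights x) x] ->
  avg (fun phi => Pr P [set x | E (counts phi) x]) <= Pr P [set x | E (weights x) x].
Proof.
move=> GE mE.
pose r := undup [seq counts phi | phi : B.-tuple (m.-tuple 'I_m)].
have mEk k : measurable [set x | (weights x == k) && E k x].
  rewrite (_ : [set x | _] = [set x | weights x == k] `&` [set x | E k x]).
    by apply: measurableI; [exact: measurable_weights_eq|exact: sigma_measurable].
  by apply/seteqP; split => x /= => [/andP[]|[-> ->]].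
have H k : Pr P [set x | (weights x == k) && E k x] =
    avg (fun phi => (counts phi == k)%:R) * Pr P [set x | E k x].
  rewrite -Pr_weights//; congr (Pr P _).
  by apply/seteqP; split => x /= => [/andP[]|[-> ->]].
have -> : avg (fun phi => Pr P [set x | E (counts phi) x]) =
    \sum_(k : seq_sub r) Pr P [set x | (weights x == ssval k) && E (ssval k) x].
  under eq_bigr do rewrite H mulrC -avgZ.
  rewrite -avg_sum; apply: eq_avg => phi.
  have kr : counts phi \in r by rewrite mem_undup map_f// mem_enum.
  rewrite (bigD1 (SeqSub kr))//= eqxx mulr1 big1 ?addr0// => k.
  by rewrite -val_eqE /= eq_sym => /negbTE ->; rewrite mulr0.
under eq_bigr do rewrite -mean_bool//.
rewrite -mean_sum; last by move=> k; exact: itg_bool.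
rewrite -mean_bool//; apply: ler_mean.
- by apply: itg_sum => k; exact: itg_bool.
- exact: itg_bool.
move=> x; have [wr|wr] := boolP (weights x \in r).
  rewrite (bigD1 (SeqSub wr))//= eqxx big1 ?addr0// => k.
  by rewrite -val_eqE /= eq_sym => /negbTE ->.
rewrite big1 ?ler0n// => k _; case: eqP => // wk.
by case/negP: wr; rewrite wk; exact: valP.
Qed.

Lemma measurable_weights_event (E : B.-tuple (m.-tuple nat) -> T -> bool) :
  (forall k, G [set x | E k x]) -> measurable [set x | E (weights x) x].
Proof.
move=> GE; rewrite (_ : [set x | _] =
  \bigcup_(k : B.-tuple (m.-tuple nat)) ([set x | weights x == k] `&` [set x | E k x])).
  apply: countable_bigcupT_measurable => [|k]; first exact: countableP.
  by apply: measurableI; [exact: measurable_weights_eq|exact: sigma_measurable].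
apply/seteqP; split => x /= => [Ex|[k _ [/eqP -> //]]].
by exists (weights x) => //; split => //=; exact: eqxx.
Qed.

(** Integrates the weights out of any event whose section at each weight value is a sketch event.
    What is left is a finite average of probabilities about the sketch alone. *)
Lemma boot_law (E : B.-tuple (m.-tuple nat) -> T -> bool) :
  (forall k, G [set x | E k x]) ->
  Pr P [set x | E (weights x) x] = avg (fun phi => Pr P [set x | E (counts phi) x]).
Proof.
move=> GE; have mE := measurable_weights_event GE.
have GEC k : G [set x | ~~ E k x].
  rewrite (_ : [set x | _] = ~` [set x | E k x]); first exact: sigmaC.
  by apply/seteqP; split => x /= /negP.
have PrC (q : T -> bool) : measurable [set x | q x] ->
    Pr P [set x | ~~ q x] = 1 - Pr P [set x | q x].
  move=> mq; have mqC : measurable [set x | ~~ q x].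
    rewrite (_ : [set x | _] = ~` [set x | q x]); first exact: measurableC.
    by apply/seteqP; split => x /= /negP.
  rewrite -!mean_bool// -[X in X - _](mean_cst P 1) -meanB//; last 2 first.
  - exact: itg_cst.
  - exact: itg_bool.
  by apply: eq_mean => x; case: (q x); rewrite ?subrr ?subr0.
have A := boot_law_ge GE mE.
have := boot_law_ge (E := fun k x => ~~ E k x) GEC.
have mEC : measurable [set x | ~~ E (weights x) x].
  exact: (measurable_weights_event (E := fun k x => ~~ E k x)).
move=> /(_ mEC); rewrite PrC//.
have -> : avg (fun phi => Pr P [set x | ~~ E (counts phi) x]) =
   1 - avg (fun phi => Pr P [set x | E (counts phi) x]).
  rewrite -[X in X - _](@avg_cst R (B.-tuple (m.-tuple 'I_m)) 1); last first.
    by rewrite !card_tuple card_ord !expn_gt0 m_gt0.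
  by rewrite -avgB; apply: eq_avg => phi; rewrite PrC//; exact: sigma_measurable.
by move=> A'; apply/eqP; rewrite eq_le A andbT; move: A'; lra.
Qed.

End BootLaw.

(** * The conditional and the empirical bootstrap distribution functions *)

Section CondLaw.
Context {disp : measure_display} {T : measurableType disp} {R : realType}.
Variables (P : probability T R) (n d m B : nat) (X : 'M[R]_(n, d)) (y : 'cV[R]_n) (lam : R).
Variables (s : 'I_m -> {mfun T >-> n.-tuple R}) (w : 'I_B -> T -> m.-tuple nat).
Hypotheses (m_gt0 : (0 < m)%N) (lam_gt0 : 0 < lam).
Hypothesis mw : forall b, measurable_fun [set: T] (w b).

Let G := g_sigma_preimage (fun i => s i : T -> n.-tuple R).
(** The same outcomes with only the sketch events measurable: measurability on [GT] delivers
    membership in [G]. *)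
Let GT := g_sigma_algebraType
  (\big[setU/set0]_(i < m) preimage_set_system [set: T] (s i) measurable).

Hypothesis w_boot : bootstrap_weights P G w.

Definition sketch_rows (x : T) (i : 'I_m) : 'cV[R]_n := cvec (s i x).

Definition tuple_rows (v : m.-tuple (n.-tuple R)) (i : 'I_m) : 'cV[R]_n :=
  cvec (tnth v i).

Lemma sketch_rows_bundle x : sketch_rows x = tuple_rows (bundle s x).
Proof.
by apply/funext => i; rewrite /sketch_rows /tuple_rows tnth_mktuple.
Qed.

Lemma measurable_sketch_rows i : measurable_mx (fun x => sketch_rows x i).
Proof.
move=> j k; rewrite /sketch_rows /cvec; under eq_fun do rewrite mxE.
apply: (measurableT_comp (measurable_tnth j)); exact: measurable_funPT.
Qed.

Lemma measurable_tuple_rows i : measurable_mx (fun v => tuple_rows v i).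
Proof.
move=> j k; rewrite /tuple_rows /cvec; under eq_fun do rewrite mxE.
by apply: (measurableT_comp (measurable_tnth j)); exact: measurable_tnth.
Qed.

Lemma sigma_set_le (f g : T -> R) : measurable_fun [set: GT] f ->
  measurable_fun [set: GT] g -> G [set x | f x <= g x].
Proof. by move=> mf mg; exact: (@measurable_set_le _ GT). Qed.

Lemma sigma_fun (h : m.-tuple (n.-tuple R) -> R) : measurable_fun setT h ->
  measurable_fun [set: GT] (fun x => h (bundle s x)).
Proof.
move=> mh _ A mA; rewrite setTI.
suff H : G (bundle s @^-1` (h @^-1` A)) by exact: H.
apply: bundle_sigma; by rewrite -[X in measurable X]setTI; exact: mh.
Qed.

Lemma sigma_boot_err k : measurable_fun [set: GT]
  (fun x => boot_err X y lam (sketch_rows x) k).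
Proof.
rewrite (_ : (fun x => _) = fun x => boot_err X y lam (tuple_rows (bundle s x)) k).
  apply: (sigma_fun (h := fun v => boot_err X y lam (tuple_rows v) k)).
  by apply: measurable_boot_err => // i; exact: measurable_tuple_rows.
by apply/funext => x; rewrite sketch_rows_bundle.
Qed.

Lemma sigma_boot_cdf t : measurable_fun [set: GT]
  (fun x => boot_cdf X y lam (sketch_rows x) t).
Proof.
rewrite (_ : (fun x => _) = fun x => boot_cdf X y lam (tuple_rows (bundle s x)) t).
  apply: (sigma_fun (h := fun v => boot_cdf X y lam (tuple_rows v) t)).
  by apply: measurable_boot_cdf => // i; exact: measurable_tuple_rows.
by apply/funext => x; rewrite sketch_rows_bundle.
Qed.

Lemma boot_cdf_ge0 (s0 : 'I_m -> 'cV[R]_n) t : 0 <= boot_cdf X y lam s0 t.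
Proof. exact: avg_ge0. Qed.

Lemma boot_cdf_le1 (s0 : 'I_m -> 'cV[R]_n) t : boot_cdf X y lam s0 t <= 1.
Proof.
rewrite -(@avg_cst R (m.-tuple 'I_m) 1) ?card_tuple ?card_ord ?expn_gt0 ?m_gt0//.
by apply: ler_avg => phi; rewrite lern1 leq_b1.
Qed.

Let itg_boot_cdf t : itg P (fun x => boot_cdf X y lam (sketch_rows x) t).
Proof.
apply: (@itg_bounded _ _ _ P _ 1).
  by apply: measurable_boot_cdf => // i; exact: measurable_sketch_rows.
by move=> x; rewrite ger0_norm ?boot_cdf_ge0 ?boot_cdf_le1.
Qed.

(** The defining identity of a conditional probability given the sketch, with [boot_cdf] as the
    version. *)
Lemma mean_boot_cdf b t (c : T -> bool) : G [set x | c x] ->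
  Pr P [set x | (boot_err X y lam (sketch_rows x) (w b x) <= t) && c x] =
  mean P (fun x => (c x)%:R * boot_cdf X y lam (sketch_rows x) t).
Proof.
move=> Gc.
pose E (k : B.-tuple (m.-tuple nat)) x :=
  (boot_err X y lam (sketch_rows x) (tnth k b) <= t) && c x.
have GE k : G [set x | E k x].
  rewrite (_ : [set x | _] = [set x | boot_err X y lam (sketch_rows x) (tnth k b) <= t]
    `&` [set x | c x]); last by apply/seteqP; split => x /= => [/andP[]|[]] // ? ?; apply/andP.
  apply: sigmaI => //; apply: sigma_set_le; first exact: sigma_boot_err.
  exact: measurable_cst.
rewrite (_ : [set x | _] = [set x | E (weights w x) x]); last first.
  by apply/seteqP; split => x; rewrite /E /= tnth_mktuple.
rewrite (boot_law _ mw w_boot)//.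
have J0 : (0 < #|{: m.-tuple 'I_m}|)%N by rewrite card_tuple card_ord expn_gt0 m_gt0.
transitivity (avg (fun phi : B.-tuple (m.-tuple 'I_m) =>
    Pr P [set x | (boot_err X y lam (sketch_rows x) (cnt (tnth phi b)) <= t) && c x])).
  by apply: eq_avg => phi; rewrite /E tnth_mktuple.
rewrite (avg_marginal (fun phi : m.-tuple 'I_m =>
    Pr P [set x | (boot_err X y lam (sketch_rows x) (cnt phi) <= t) && c x]) b J0).
have mE (phi : m.-tuple 'I_m) :
    measurable [set x | (boot_err X y lam (sketch_rows x) (cnt phi) <= t) && c x].
  have := sigma_measurable (GE [tuple cnt phi | _ < B]).
  by rewrite /E tnth_mktuple.
rewrite /avg; under eq_bigr do rewrite -mean_bool//.
rewrite -mean_sum; last by move=> phi; exact: itg_bool.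
rewrite -meanZ; last by apply: itg_sum => phi; exact: itg_bool.
apply: eq_mean => x; rewrite mulrCA; congr (_ * _); rewrite big_distrr /=.
by apply: eq_bigr => phi _; rewrite -natrM mulnb andbC.
Qed.

(* Both sides have the same integral over every sketch event, in particular
   over the event that one of them exceeds the other by [e]. *)
Lemma boot_cond_law b (k : R.-pker T ~> R) t (e : R) : 0 < e ->
  is_cond_distribution P G (fun x => boot_err X y lam (sketch_rows x) (w b x)) k ->
  Pr P [set x | e <= `|boot_cdf X y lam (sketch_rows x) t - fine (k x `]-oo, t]%classic)|]
    = 0.
Proof.
move=> e0 /(_ `]-oo, t]%classic) [|Gk Ik]; first exact: measurable_itv.
pose f x := fine (k x `]-oo, t]%classic).
pose h x := boot_cdf X y lam (sketch_rows x) t.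
have k1 x : (k x `]-oo, t]%classic <= 1)%E.
  rewrite -(@prob_kernel _ _ _ _ _ k x); apply: (@le_measure _ _ _ (k x)); rewrite ?inE//.
have kE x : k x `]-oo, t]%classic = (f x)%:E.
  by rewrite /f fineK// ge0_fin_numE// (le_lt_trans (k1 x))// ltry.
have f0 x : 0 <= f x by rewrite fine_ge0.
have f1 x : f x <= 1.
  by rewrite -lee_fin -kE.
have sf : measurable_fun [set: GT] f.
  apply: (measurableT_comp (f := fine)); first exact: fine_measurable.
  by move=> _ A mA; rewrite setTI; exact: Gk.
have mf : measurable_fun [set: T] f.
  apply: (measurableT_comp (f := fine)); first exact: fine_measurable.
  exact: measurable_kernel.
have If : itg P f.
  by apply: (@itg_bounded _ _ _ P _ 1) => // x; rewrite ger0_norm.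
have Ih : itg P h := itg_boot_cdf t.
have sh : measurable_fun [set: GT] h := sigma_boot_cdf t.
have key (c : T -> bool) : G [set x | c x] ->
    mean P (fun x => (c x)%:R * f x) = mean P (fun x => (c x)%:R * h x).
  move=> Gc; rewrite -(mean_boot_cdf b)//.
  have mc := sigma_measurable Gc.
  have := Ik _ Gc; rewrite /Pr.
  rewrite (_ : _ `&` _ = [set x | (boot_err X y lam (sketch_rows x) (w b x) <= t) && c x]).
    move=> <-; rewrite /mean /Rintegral; congr fine.
    rewrite [RHS]integral_mkcond; apply: eq_integral => x _.
    rewrite patchE kE; case: ifPn; rewrite ?inE ?notin_setE /=.
      by move=> ->; rewrite mul1r.
    by move=> /negP/negbTE ->; rewrite mul0r.
  by apply/seteqP; split => x /=; rewrite in_itv /=; [move=> [-> ->]|move=> /andP[]].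
have zero (f1' f2' : T -> R) : itg P f1' -> itg P f2' ->
    measurable_fun [set: GT] f1' -> measurable_fun [set: GT] f2' ->
    (forall c : T -> bool, G [set x | c x] ->
      mean P (fun x => (c x)%:R * f1' x) = mean P (fun x => (c x)%:R * f2' x)) ->
    measurable [set x | f1' x + e <= f2' x] /\ Pr P [set x | f1' x + e <= f2' x] = 0.
  move=> I1 I2 s1 s2 E.
  have Gc : G [set x | f1' x + e <= f2' x].
    by apply: sigma_set_le => //; apply: measurable_funD => //; exact: measurable_cst.
  have mc := sigma_measurable Gc; split => //.
  have Ic (q : T -> R) : itg P q -> itg P (fun x => (f1' x + e <= f2' x)%R%:R * q x).
    move=> Iq; apply: itg_le (itg_norm Iq).
      by apply: measurable_funM; [exact: measurable_boolr|exact: itg_measurable Iq].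
    move=> x; rewrite normrM ler_piMl// ger0_norm// lern1; exact: leq_b1.
  have := E _ Gc; move=> Ec.
  have : mean P (fun x => e * (f1' x + e <= f2' x)%R%:R) <=
      mean P (fun x => (f1' x + e <= f2' x)%R%:R * f2' x -
                       (f1' x + e <= f2' x)%R%:R * f1' x).
    apply: ler_mean.
    - by apply: itgZ; exact: itg_bool.
    - by apply: itgB; exact: Ic.
    move=> x; rewrite -mulrBr mulrC; case: (leP (f1' x + e) (f2' x)) => [|_].
      by rewrite !mul1r lerBrDl.
    by rewrite !mul0r.
  rewrite meanB; [|exact: Ic|exact: Ic].
  rewrite Ec subrr meanZ; last exact: itg_bool.
  rewrite mean_bool// pmulr_rle0// => PE; apply/eqP; rewrite eq_le PE; exact: Pr_ge0.
have [m1 z1] := zero f h If Ih sf sh key.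
have [m2 z2] := zero h f Ih If sh sf (fun c Gc => esym (key c Gc)).
apply/eqP; rewrite eq_le Pr_ge0 andbT.
have U0 : Pr P ([set x | f x + e <= h x] `|` [set x | h x + e <= f x]) <= 0.
  by apply: le_trans (PrU_le P m1 m2) _; rewrite z1 z2 addr0.
apply: le_trans U0; apply: le_Pr.
- apply: measurable_set_le; first exact: measurable_cst.
  by apply: measurableT_comp => //; apply: measurable_funB => //; exact: itg_measurable Ih.
- exact: measurableU.
move=> x /=; rewrite -/(f x) -/(h x) ler_normr => /orP[H|H]; [left|right]; move: H; lra.
Qed.

(** Given the sketch, the indicators of the [B] draws are independent with mean [boot_cdf] and
    variance at most 1. Measurability rests on the weights taking countably many values. *)
Lemma boot_emp_law t (e : R) : (0 < B)%N -> 0 < e ->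
  measurable_fun [set: T] (fun x => cdf_boot_emp X y lam s w x t) /\
  Pr P [set x | e <= `|boot_cdf X y lam (sketch_rows x) t - cdf_boot_emp X y lam s w x t|]
    <= (B%:R * e ^+ 2)^-1.
Proof.
move=> B0 e0.
pose emp (k : B.-tuple (m.-tuple nat)) x : R :=
  B%:R^-1 * \sum_b (boot_err X y lam (sketch_rows x) (tnth k b) <= t)%R%:R.
have empE x : cdf_boot_emp X y lam s w x t = emp (weights w x) x.
  by congr (_ * _); apply: eq_bigr => b _; rewrite tnth_mktuple.
have semp k : measurable_fun [set: GT] (emp k).
  apply: measurable_funM; first exact: measurable_cst.
  apply: measurable_sum => b; apply: (@measurable_boolr _ GT).
  by apply: sigma_set_le; [exact: sigma_boot_err|exact: measurable_cst].
split.
  rewrite (_ : (fun x => _) = fun x => emp (weights w x) x); last exact/funext.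
  apply: (measurability _ (RGenOInfty.measurableE R)) => // _ [_ [a ->] <-].
  rewrite setTI (_ : _ @^-1` _ = [set x | a < emp (weights w x) x]); last first.
    by apply/seteqP; split => x /=; rewrite in_itv /= andbT.
  apply: (measurable_weights_event (s := s) mw (E := fun k x => a < emp k x)) => k.
  exact: (@measurable_set_lt _ GT R (cst a) (emp k) (measurable_cst _) (semp k)).
pose E k x := e <= `|boot_cdf X y lam (sketch_rows x) t - emp k x|.
have GE k : G [set x | E k x].
  apply: sigma_set_le; first exact: measurable_cst.
  apply: measurableT_comp => //; apply: measurable_funB => //; exact: sigma_boot_cdf.
rewrite (_ : [set x | _] = [set x | E (weights w x) x]); last first.
  by apply/seteqP; split => x; rewrite /E /= empE.
rewrite (boot_law _ mw w_boot)//.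
have J0 : (0 < #|{: m.-tuple 'I_m}|)%N by rewrite card_tuple card_ord expn_gt0 m_gt0.
have mEc phi := sigma_measurable (GE (counts phi)).
rewrite (eq_avg (G := fun phi => mean P (fun x => (E (counts phi) x)%:R))); last first.
  by move=> phi; rewrite mean_bool//; exact: mEc.
rewrite /avg -mean_sum; last by move=> phi; apply: itg_bool; exact: mEc.
rewrite -meanZ; last by apply: itg_sum => phi; apply: itg_bool; exact: mEc.
rewrite -[leRHS](mean_cst P); apply: ler_mean.
- by apply/itgZ/itg_sum => phi; apply: itg_bool; exact: mEc.
- exact: itg_cst.
(* The mean over the sketch and the average over tuples have been exchanged, so Chebyshev's
   inequality is applied for each fixed [x]. *)
move=> x; rewrite -/(avg _).
set q := boot_cdf X y lam (sketch_rows x) t.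
pose a (phi : m.-tuple 'I_m) : R := (boot_err X y lam (sketch_rows x) (cnt phi) <= t)%R%:R - q.
have a0 : avg a = 0 by rewrite avgB avg_cst// subrr.
have emp_a phi : q - emp (counts phi) x = - (B%:R^-1 * \sum_b a (tnth phi b)).
  rewrite /emp sumrB sumr_const card_ord mulrBr -[q *+ B]mulr_natl mulKf; last first.
    by rewrite pnatr_eq0 -lt0n.
  rewrite opprB; congr (_ - _ * _).
  by apply: eq_bigr => b _; rewrite tnth_mktuple.
rewrite (eq_avg (G := fun phi : B.-tuple (m.-tuple 'I_m) =>
    (B%:R * e <= `|\sum_b a (tnth phi b)|)%R%:R)); last first.
  move=> phi; rewrite /E emp_a normrN normrM ger0_norm ?invr_ge0//.
  by rewrite ler_pdivlMl ?ltr0n.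
have Be0 : 0 < B%:R * e by rewrite mulr_gt0 ?ltr0n.
apply: le_trans (avg_chebyshev (fun phi : B.-tuple _ => \sum_b a (tnth phi b)) Be0) _.
rewrite avg_sqr_resample//.
have a1 : avg (fun phi => a phi ^+ 2) <= 1.
  rewrite -[leRHS](@avg_cst R (m.-tuple 'I_m) 1)//; apply: ler_avg => phi.
  rewrite /a; have := boot_cdf_ge0 (sketch_rows x) t.
  have := boot_cdf_le1 (sketch_rows x) t; rewrite -/q.
  by case: (_ <= t); rewrite /=; nra.
have BR : 0 < B%:R :> R by rewrite ltr0n.
set v := avg _ in a1 *.
have -> : (B%:R * e) ^- 2 * (B%:R * v) = (B%:R * e ^+ 2)^-1 * v.
  by field; rewrite !gt_eqF.
by rewrite ler_piMr// invr_ge0 mulr_ge0 ?sqr_ge0// ltW.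
Qed.

End CondLaw.

(** * From pointwise to uniform closeness *)

Section Cdf.
Context {R : realType}.

Definition cdf_like (F : R -> R) :=
  [/\ {homo F : s t / s <= t}, forall t, 0 <= F t <= 1 &
      forall t e, 0 < e -> exists2 r, 0 < r & F (t + r) <= F t + e].

(** Stated for a measure of total mass 1 so as to cover both the law of the sketch and each measure
    [kappa n x]. *)
Lemma cdf_like_measure (disp : measure_display) (T : measurableType disp)
    (mu : {measure set T -> \bar R}) (Y : T -> R) :
  mu [set: T] = 1%E -> measurable_fun [set: T] Y -> cdf_like (fun t => fine (mu [set x | Y x <= t])).
Proof.
move=> mu1 mY.
have mA t : measurable [set x | Y x <= t] by apply: measurable_set_le => //; exact: measurable_cst.
have muA1 t : (mu [set x | (Y x <= t)%R] <= 1)%E.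
  by rewrite -mu1; apply: le_measure; rewrite ?inE.
have finA t : mu [set x | Y x <= t] \is a fin_num.
  by rewrite ge0_fin_numE// (le_lt_trans (muA1 t))// ltry.
split.
- move=> s t st; rewrite fine_le//; apply: le_measure; rewrite ?inE// => x /= /le_trans; exact.
- by move=> t; rewrite fine_ge0//= -lee_fin fineK.
move=> t e e0; pose A k := [set x | Y x <= t + k.+1%:R^-1].
(* Right continuity is continuity of the measure along the decreasing events [A k]. *)
have AE : \bigcap_k A k = [set x | Y x <= t].
  apply/seteqP; split => x /=; last by move=> xt k _; rewrite /A /=; apply: le_trans xt _; rewrite lerDl invr_ge0.
  move=> xA; apply/ler_addgt0Pr => q q0.
  have [k kq] : exists k, k.+1%:R^-1 < q.
    by have [k _ H] := near_infty_natSinv_lt (PosNum q0); exists k; exact: (H k (leqnn k)).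
  by apply: le_trans (xA k I) _; rewrite lerD2l ltW.
have : mu \o A @ \oo --> mu (\bigcap_k A k).
  apply: nonincreasing_cvg_mu; rewrite ?AE//.
  - by rewrite (le_lt_trans (muA1 _))// ltry.
  - by move=> k; exact: mA.
  - move=> i j ij; apply/subsetPset => x /= /le_trans; apply.
    by rewrite lerD2l lef_pV2 ?posrE ?ltr0n// ler_nat ltnS.
rewrite AE -(fineK (finA t)) => /fine_cvgP[_] /cvgrPdist_le/(_ e e0)[k _ /(_ k (leqnn k))] /=.
rewrite ler_norml => /andP[H _].
by exists k.+1%:R^-1; rewrite ?invr_gt0//; move: H; rewrite /A; lra.
Qed.

Lemma cdf_like_avg (I : finType) (a : I -> R) : (0 < #|I|)%N ->
  cdf_like (fun t => avg (fun i => (a i <= t)%R%:R)).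
Proof.
move=> I0; split.
- by move=> s t st; apply: ler_avg => i; apply: ler_bool_nat => /le_trans; apply.
- move=> t; rewrite avg_ge0//= -[leRHS](@avg_cst R I 1)//.
  by apply: ler_avg => i; rewrite lern1 leq_b1.
move=> t e e0.
(* Half the distance from [t] to the next jump, so the function is constant up to [t + r]; the
   default 1 serves when no jump lies to the right. *)
exists (\big[Order.min/1]_(i | t < a i) (a i - t) / 2).
  by rewrite divr_gt0//; elim/big_ind: _ => // [u v|i]; [rewrite lt_min => -> ->|rewrite subr_gt0].
apply: le_trans (_ : avg (fun i => (a i <= t)%R%:R) <= _); last by rewrite lerDl ltW.
apply: ler_avg => i; apply: ler_bool_nat => ai; rewrite leNgt; apply/negP => ta.
have : \big[Order.min/1]_(i | t < a i) (a i - t) <= a i - t by exact: bigmin_le_cond.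
by move: ai ta; lra.
Qed.

Section SupDist.
Variables F G : R -> R.
Hypotheses (cF : cdf_like F) (cG : cdf_like G).

Lemma cdf_dist_le1 t : `|F t - G t| <= 1.
Proof.
have [_ /(_ t) /andP[a b] _] := cF; have [_ /(_ t) /andP[c d] _] := cG.
by rewrite ler_norml; lra.
Qed.

(* Right continuity makes the supremum a countable one, hence measurable. *)
Lemma sup_dist_gtP eps : 0 <= eps ->
  eps < `|sup_dist F G - 0| <-> exists q : rat, eps < `|F (ratr q) - G (ratr q)|.
Proof.
move=> eps0.
have hs : has_sup (range (fun t => `|F t - G t|)).
  split; first by exists `|F 0 - G 0|, 0.
  by exists 1 => _ [t _ <-]; exact: cdf_dist_le1.
have le t : `|F t - G t| <= sup_dist F G by apply: sup_upper_bound hs _ _; exists t.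
have sd0 : 0 <= sup_dist F G by apply: le_trans (le 0).
rewrite subr0 (ger0_norm sd0); split=> [|[q /lt_le_trans]]; last by apply.
move=> /(sup_gt hs.1)[_ [t _ <-] H].
have e0 : 0 < (`|F t - G t| - eps) / 2 by rewrite divr_gt0// subr_gt0.
have [Fnd _ /(_ t _ e0)[r r0 Fr]] := cF; have [Gnd _ /(_ t _ e0)[r' r'0 Gr]] := cG.
have [q] : exists q, ratr q \in `]t, t + Num.min r r'[.
  by apply: rat_in_itvoo; rewrite ltrDl lt_min r0.
rewrite in_itv /= => /andP[tq qr]; exists q.
have [qr1 qr2] : ratr q <= t + r /\ ratr q <= t + r'.
  by split; apply: le_trans (ltW qr) _; rewrite lerD2l ge_min lexx ?orbT.
have := Fnd _ _ (ltW tq); have := Gnd _ _ (ltW tq).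
have := Fnd _ _ qr1; have := Gnd _ _ qr2.
by move: Fr Gr H; case: (ger0P (F t - G t)) => ?;
  case: (ger0P (F (ratr q) - G (ratr q))) => ?; lra.
Qed.

(** Between neighboring grid points monotonicity costs one increment of [Q] and one comparison with
    [Q] for each of [F] and [G], hence [3 * e]. Beyond the ends, the near-extreme values of [Q] take
    over. *)
Lemma polya_grid (Q : R -> R) (t : nat -> R) N e :
  (forall j, (j <= N)%N -> `|F (t j) - Q (t j)| <= e) ->
  (forall j, (j <= N)%N -> `|G (t j) - Q (t j)| <= e) ->
  Q (t 0%N) <= e -> (forall j, (j < N)%N -> Q (t j.+1) - Q (t j) <= e) ->
  1 - e <= Q (t N) -> forall u, `|F u - G u| <= 3 * e.
Proof.
move=> FQ GQ Q0 Qi QN u.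
have [Fnd Fb _] := cF; have [Gnd Gb _] := cG.
have H j : (j <= N)%N -> [/\ F (t j) - Q (t j) <= e, Q (t j) - F (t j) <= e,
    G (t j) - Q (t j) <= e & Q (t j) - G (t j) <= e].
  by move=> /[dup] /FQ + /GQ; rewrite !ler_norml => /andP[? ?] /andP[? ?]; split; lra.
have /andP[Fu0 Fu1] := Fb u; have /andP[Gu0 Gu1] := Gb u.
have [u0|t0u] := ltP u (t 0%N).
  have [a b c d] := H 0%N isT; have := Fnd _ _ (ltW u0); have := Gnd _ _ (ltW u0).
  by rewrite ler_norml; lra.
have [utN|tNu] := ltP u (t N); last first.
  have [a b c d] := H N (leqnn N); have := Fnd _ _ tNu; have := Gnd _ _ tNu.
  by rewrite ler_norml; lra.
have [j jN [tj tj1]] : exists2 j, (j < N)%N & t j <= u /\ u < t j.+1.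
  elim: N utN {FQ GQ Qi QN H} => [|N IH] utN; first by move: t0u; rewrite leNgt utN.
  have [/IH[j jN tj]|tNu] := ltP u (t N); first by exists j => //; exact: ltnW.
  by exists N.
have [a b c d] := H j (ltnW jN); have [a' b' c' d'] := H j.+1 jN.
have := Fnd _ _ tj; have := Gnd _ _ tj; have := Fnd _ _ (ltW tj1); have := Gnd _ _ (ltW tj1).
by have := Qi j jN; rewrite ler_norml; lra.
Qed.

End SupDist.

Lemma inv_sqrt_small (c e : R) : 0 <= c -> 0 < e ->
  exists M, forall m, (M <= m)%N -> c / Num.sqrt m%:R <= e.
Proof.
move=> c0 e0; exists (Num.truncn ((c / e) ^+ 2)).+1 => m Mm.
have ce0 : 0 <= c / e by rewrite divr_ge0// ltW.
have cm : (c / e) ^+ 2 <= m%:R.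
  by apply: le_trans (ltW (truncnS_gt _)) _; rewrite ler_nat.
have m0 : 0 < Num.sqrt m%:R :> R by rewrite sqrtr_gt0 ltr0n (leq_ltn_trans _ Mm).
rewrite ler_pdivrMr// mulrC -ler_pdivrMr//.
by rewrite -(ger0_norm ce0) -sqrtr_sqr ler_wsqrtr.
Qed.

Lemma walk_small d (L : 'M[R]_d) k0 m a : (0 < m)%N -> col k0 L != 0 -> 0 <= a ->
  walk_cdf L m a <= a / frobenius (col k0 L) + 2 / Num.sqrt m%:R.
Proof.
move=> m0 L0 a0; have a2 : 0 <= a ^+ 2 := sqr_ge0 a.
have := rademacher_anticoncentration 0 m0 L0 a2.
rewrite subr0 sqrtr_sqr (ger0_norm a0); apply: le_trans; apply: iter_avop_le => x.
by apply: ler_bool_nat => xa; rewrite sqr_ge0 ler_pXn2r ?nnegrE ?frobenius_ge0.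
Qed.

(** The grid is fixed before [m], although the comparison function changes with [m]: the
    anti-concentration and tail bounds are uniform in [m] up to [2 / Num.sqrt m%:R], which is made
    at most [e / 2]. *)
Lemma walk_grid d (L : 'M[R]_d) k0 e : col k0 L != 0 -> 0 < e ->
  exists N (t : nat -> R), (forall j, 0 < t j) /\ exists M, forall m, (M <= m)%N ->
    [/\ walk_cdf L m (t 0%N) <= e,
        forall j, (j < N)%N -> walk_cdf L m (t j.+1) - walk_cdf L m (t j) <= e &
        1 - e <= walk_cdf L m (t N)].
Proof.
move=> L0 e0; pose c := frobenius (col k0 L).
have c0 : 0 < c by rewrite lt_def frobenius_ge0 frobenius_eq0 L0.
pose V := \tr (L *m L^T).
have V0 : 0 <= V.
  rewrite /V /mxtrace sumr_ge0// => i _; rewrite mxE sumr_ge0// => k _.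
  by rewrite mxE -expr2 sqr_ge0.
pose S := Num.sqrt (V / e) + 1.
have Ve0 : 0 <= V / e by rewrite divr_ge0// ltW.
have S0 : 0 < S by rewrite ltr_wpDl ?sqrtr_ge0.
have SV : V / S ^+ 2 <= e.
  rewrite ler_pdivrMr ?exprn_gt0// mulrC -ler_pdivrMr//.
  rewrite -{1}(sqr_sqrtr Ve0) ler_pXn2r ?nnegrE ?sqrtr_ge0 ?(ltW S0)//.
  by rewrite lerDl.
have ec2 : 0 < (e * c / 2) ^+ 2 by rewrite exprn_gt0// divr_gt0// mulr_gt0.
(* [S] comes from Chebyshev's tail and the mesh is [a = S / N.+1]. The first summand makes the
   increments of the squared grid points, at most [3 * S * a], small against [(e * c / 2) ^+ 2]; the
   second makes the innermost ball small. The point of index [j] is [a * j.+1], so the last one is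
   exactly [S]. *)
pose N := Num.truncn (3 * S ^+ 2 / (e * c / 2) ^+ 2 + 2 * S / (e * c)).
have NS : 3 * S ^+ 2 / (e * c / 2) ^+ 2 + 2 * S / (e * c) <= N.+1%:R.
  exact: ltW (truncnS_gt _).
have p1 : 0 <= 3 * S ^+ 2 / (e * c / 2) ^+ 2.
  by apply: divr_ge0; [apply: mulr_ge0 => //; exact: sqr_ge0|exact: ltW].
have p2 : 0 <= 2 * S / (e * c).
  by apply: divr_ge0; apply: mulr_ge0 => //; exact: ltW.
have N0 : 0 < N.+1%:R :> R by [].
pose a := S / N.+1%:R.
have a0 : 0 < a by rewrite divr_gt0.
have aN : a * N.+1%:R = S by rewrite divfK// gt_eqF.
have a1 : a / c <= e / 2.
  rewrite ler_pdivrMr// /a ler_pdivrMr//.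
  have H : 2 * S / (e * c) <= N.+1%:R by move: NS p1; lra.
  by move: H; rewrite ler_pdivrMr ?mulr_gt0//; lra.
have a2 : 3 * S * a <= (e * c / 2) ^+ 2.
  rewrite /a mulrA ler_pdivrMr// [leRHS]mulrC -ler_pdivrMr//.
  by rewrite -mulrA -expr2; move: NS p2; lra.
have [M Mm] := inv_sqrt_small (ler0n _ 2) (divr_gt0 e0 (ltr0n _ 2)).
exists N, (fun j => a * j.+1%:R); split; first by move=> j; rewrite mulr_gt0.
exists M.+1 => m Mm1; have m0 : (0 < m)%N by exact: leq_ltn_trans Mm1.
have small := Mm m (ltnW Mm1).
split.
- rewrite mulr1; apply: le_trans (walk_small m0 L0 (ltW a0)) _.
  by rewrite -/c; move: a1 small; lra.
- move=> j jN.
  have j0 : 0 <= a * j.+1%:R by rewrite mulr_ge0// ltW.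
  have jj : a * j.+1%:R <= a * j.+2%:R by rewrite ler_pM2l// ler_nat.
  apply: le_trans (walk_increment m0 L0 j0 jj) _; rewrite -/c.
  have q : Num.sqrt ((a * j.+2%:R) ^+ 2 - (a * j.+1%:R) ^+ 2) <= e * c / 2.
    have ec0 : 0 <= e * c / 2 by rewrite divr_ge0// mulr_ge0// ltW.
    rewrite -[leRHS](ger0_norm ec0) -sqrtr_sqr ler_wsqrtr//.
    apply: le_trans a2.
    have jS : a * j.+2%:R <= S by rewrite -aN ler_pM2l// ler_nat.
    have j1 : a * j.+2%:R = a * j.+1%:R + a by rewrite -[j.+2%:R]natr1 mulrDr mulr1.
    have aS : a <= S by move: j0 jS; rewrite j1; lra.
    rewrite subr_sqr j1 addrAC subrr add0r.
    by rewrite mulrC ler_pM2r//; move: jS; rewrite j1; lra.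
  have : Num.sqrt ((a * j.+2%:R) ^+ 2 - (a * j.+1%:R) ^+ 2) / c <= e / 2.
    by rewrite ler_pdivrMr//; move: q; lra.
  by move: small; lra.
rewrite aN; apply: le_trans (walk_tail L m0 S0).
by rewrite -/V; move: SV; lra.
Qed.

End Cdf.

(** * Uniform closeness in probability from closeness at each level *)

Section PolyaInProbability.
Context {R : realType} {disp : nat -> measure_display}
  {T : forall n, measurableType (disp n)}.
Variable P : forall n, probability (T n) R.

(** The data are only constrained at positive sample sizes. *)
Lemma near_pos (p : nat -> Prop) : (forall n, (0 < n)%N -> p n) ->
  \forall n \near \oo, p n.
Proof. by move=> H; exists 1%N => // n /= /H. Qed.

Lemma cvg_in_probP (Z : forall n, T n -> R) c :
  (forall n eps, (0 < n)%N -> 0 < eps -> measurable [set x | eps < `|Z n x - c|]) ->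
  (forall eps eta, 0 < eps -> 0 < eta ->
    \forall n \near \oo, Pr (P n) [set x | eps < `|Z n x - c|] <= eta) ->
  cvg_in_prob P Z c.
Proof.
move=> mZ H eps eps0; apply/fine_cvgP; split.
  by apply: near_pos => n n0; rewrite fin_num_measure//; exact: mZ.
apply/cvgrPdist_le => eta eta0; have := H eps eta eps0 eta0.
apply: filterS => n Hn; rewrite sub0r normrN ger0_norm//; exact: Pr_ge0.
Qed.

Lemma sup_dist_cvg_in_prob (F : nat -> R -> R) (G : forall n, T n -> R -> R)
    (Q : nat -> R -> R) :
  (forall n, (0 < n)%N -> cdf_like (F n)) ->
  (forall n x, (0 < n)%N -> cdf_like (G n x)) ->
  (forall n t, (0 < n)%N -> measurable_fun setT (fun x => G n x t)) ->
  (forall t e, 0 < t -> 0 < e -> \forall n \near \oo, `|F n t - Q n t| <= e) ->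
  (forall t e eta, 0 < t -> 0 < e -> 0 < eta ->
    \forall n \near \oo, Pr (P n) [set x | e <= `|G n x t - Q n t|] <= eta) ->
  (forall e, 0 < e -> exists N (t : nat -> R), (forall j, 0 < t j) /\
    \forall n \near \oo, [/\ Q n (t 0%N) <= e,
        forall j, (j < N)%N -> Q n (t j.+1) - Q n (t j) <= e & 1 - e <= Q n (t N)]) ->
  cvg_in_prob P (fun n x => sup_dist (F n) (G n x)) 0.
Proof.
move=> cF cG mG FQ GQ grid.
have supE n eps : (0 < n)%N -> 0 < eps -> [set x | eps < `|sup_dist (F n) (G n x) - 0|] =
    \bigcup_(q : rat) [set x | eps < `|F n (ratr q) - G n x (ratr q)|].
  move=> n0 eps0; apply/seteqP; split => x /=.
    by move=> /(sup_dist_gtP (cF n n0) (cG n x n0) (ltW eps0))[q Hq]; exists q.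
  move=> [q _ Hq]; apply/(sup_dist_gtP (cF n n0) (cG n x n0) (ltW eps0)).
  by exists q.
have msup n eps : (0 < n)%N -> 0 < eps ->
    measurable [set x | eps < `|sup_dist (F n) (G n x) - 0|].
  move=> n0 eps0; rewrite supE//.
  apply: countable_bigcupT_measurable => [|q]; first exact: countableP.
  apply: measurable_set_lt; first exact: measurable_cst.
  apply: measurableT_comp => //; apply: measurable_funB; [exact: measurable_cst|exact: mG].
apply: cvg_in_probP => // eps eta eps0 eta0.
(* The grid argument yields [3 * e], which must fall strictly below [eps]; the probability [eta] is
   shared among the [N.+1] grid points. *)
pose e := eps / 4; have e0 : 0 < e by rewrite divr_gt0.
have [N [t [t0 Qg]]] := grid e e0.
have eta'0 : 0 < eta / N.+1%:R by rewrite divr_gt0.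
have FQN : \forall n \near \oo, forall j : 'I_N.+1, `|F n (t j) - Q n (t j)| <= e.
  by apply: filter_forall => j; exact: FQ.
have GQN : \forall n \near \oo, forall j : 'I_N.+1,
    Pr (P n) [set x | e <= `|G n x (t j) - Q n (t j)|] <= eta / N.+1%:R.
  by apply: filter_forall => j; exact: GQ.
have npos : \forall n \near \oo, (0 < n)%N by exact: near_pos.
near=> n.
have n0 : (0 < n)%N by near: n.
have [Q0 Qi QN] : [/\ Q n (t 0%N) <= e,
    forall j, (j < N)%N -> Q n (t j.+1) - Q n (t j) <= e & 1 - e <= Q n (t N)] by near: n.
have Fn : forall j : 'I_N.+1, `|F n (t j) - Q n (t j)| <= e by near: n.
have Gn : forall j : 'I_N.+1,
    Pr (P n) [set x | e <= `|G n x (t j) - Q n (t j)|] <= eta / N.+1%:R by near: n.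
pose A (j : 'I_N.+1) := [set x | e <= `|G n x (t j) - Q n (t j)|].
have mA j : measurable (A j).
  apply: measurable_set_le; first exact: measurable_cst.
  apply: measurableT_comp => //; apply: measurable_funB; [exact: mG|exact: measurable_cst].
have [mU PU] := Pr_bigcup_le (P n) (enum 'I_N.+1) mA.
apply: le_trans (_ : \sum_(j <- enum 'I_N.+1) Pr (P n) (A j) <= _); last first.
  apply: le_trans (_ : \sum_(j : 'I_N.+1) eta / N.+1%:R <= _).
    by rewrite big_enum /=; apply: ler_sum => j _; exact: Gn.
  by rewrite sumr_const card_ord -[_ *+ _]mulr_natr divfK.
apply: le_trans PU; apply: le_Pr => //; first exact: msup.
move=> x /= H; apply: contrapT => nA.
have GA j : (j <= N)%N -> `|G n x (t j) - Q n (t j)| <= e.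
  move=> jN; rewrite leNgt; apply/negP => ltj; apply: nA.
  by exists (Ordinal (jN : (j < N.+1)%N)); rewrite ?mem_enum// /A /= ltW.
have FA j : (j <= N)%N -> `|F n (t j) - Q n (t j)| <= e.
  by move=> jN; exact: (Fn (Ordinal (jN : (j < N.+1)%N))).
have := polya_grid (cF n n0) (cG n x n0) FA GA Q0 Qi QN.
have /(sup_dist_gtP (cF n n0) (cG n x n0) (ltW eps0))[q Hq] := H.
by move=> /(_ (ratr q)); move: Hq e0; rewrite /e; lra.
Unshelve. all: by end_near. Qed.

End PolyaInProbability.

(** * Moments of the compressed rows *)

Section Isotropic.
Context {disp : measure_display} {T : measurableType disp} {R : realType}.
Variables (P : probability T R) (n : nat) (V : T -> 'cV[R]_n).
Hypothesis mV : measurable_mx V.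
Hypothesis iso : mx_expectation P (fun x => V x *m (V x)^T) = 1%:M.

Lemma expectation_fine (f : T -> R) : fine 'E_P[f] = mean P f.
Proof. by rewrite unlock. Qed.

Let outerE j k x : (V x *m (V x)^T) j k = V x j 0 * V x k 0.
Proof. by rewrite mxE big_ord1 mxE. Qed.

Let isoE j k : mean P (fun x => V x j 0 * V x k 0) = (j == k)%:R.
Proof.
have := congr1 (fun M : 'M[R]_n => M j k) iso; rewrite !mxE => <-.
by rewrite expectation_fine; apply: eq_mean => x; rewrite outerE.
Qed.

(** An infinite second moment would be read as 0 by [fine], contradicting the diagonal entry 1 of
    the identity. Square-integrability of the coordinates then gives all products. *)
Lemma isotropic_mul j k : itg P (fun x => V x j 0 * V x k 0) /\
  mean P (fun x => V x j 0 * V x k 0) = (j == k)%:R.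
Proof.
split=> //.
have sq i : itg P (fun x => V x i 0 ^+ 2).
  have m2 : measurable_fun [set: T] (fun x => V x i 0 ^+ 2) by exact: measurable_funX.
  apply/integrableP; split; first exact/measurable_EFinP.
  under eq_integral do rewrite /= ger0_norm ?sqr_ge0//.
  have := isoE i i; rewrite eqxx /mean /Rintegral.
  under eq_integral do rewrite -expr2.
  by case: (\int[P]_x _)%E => [r||] /= H; rewrite ?ltry//; move: H => /eqP; rewrite eq_sym oner_eq0.
exact: itg_mul_sqr.
Qed.

Lemma isotropic_dot (a b : 'cV[R]_n) :
  itg P (fun x => dot a (V x) * dot b (V x)) /\
  mean P (fun x => dot a (V x) * dot b (V x)) = dot a b.
Proof.
have E x : dot a (V x) * dot b (V x) =
    \sum_j \sum_k (a j 0 * b k 0) * (V x j 0 * V x k 0).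
  rewrite /dot big_distrl /=; apply: eq_bigr => j _; rewrite big_distrr /=.
  by apply: eq_bigr => k _; rewrite mulrACA.
have I j k : itg P (fun x => (a j 0 * b k 0) * (V x j 0 * V x k 0)).
  by apply: itgZ; exact: (isotropic_mul j k).1.
rewrite (_ : (fun x => _) = fun x => \sum_j \sum_k (a j 0 * b k 0) * (V x j 0 * V x k 0)); last exact/funext.
have I' j : itg P (fun x => \sum_k (a j 0 * b k 0) * (V x j 0 * V x k 0)) by exact: itg_sum.
split; first exact: itg_sum.
rewrite mean_sum//; apply: eq_bigr => j _; rewrite mean_sum// (bigD1 j)//= big1 ?addr0.
  by rewrite meanZ ?(isotropic_mul j j).2 ?eqxx ?mulr1//; exact: (isotropic_mul j j).1.
move=> k kj; rewrite meanZ; last exact: (isotropic_mul j k).1.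
by rewrite (isotropic_mul j k).2 eq_sym (negbTE kj) mulr0.
Qed.

Variables (d : nat) (X : 'M[R]_(n, d)) (y : 'cV[R]_n).

Definition dH (v : 'cV[R]_n) : 'M[R]_d := zrow X v *m (zrow X v)^T - ridgeH X.

Definition dg (v : 'cV[R]_n) : 'cV[R]_d := urow y v *: zrow X v - ridgeg X y.

Let c : R := (Num.sqrt n%:R)^-1.

Let cc : c * c = n%:R^-1.
Proof. by rewrite -expr2 exprVn sqr_sqrtr. Qed.

Let zrow_dot v i : zrow X v i 0 = c * dot (col i X) v.
Proof.
by rewrite !mxE; congr (_ * _); apply: eq_bigr => k _; rewrite !mxE.
Qed.

Let urow_dot v : urow y v = c * dot y v.
Proof. by rewrite /urow dot_mx. Qed.

Lemma dH_mean i j : itg P (fun x => dH (V x) i j) /\ mean P (fun x => dH (V x) i j) = 0.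
Proof.
have [I E] := isotropic_dot (col i X) (col j X).
have dE x : dH (V x) i j =
    n%:R^-1 * (dot (col i X) (V x) * dot (col j X) (V x)) - ridgeH X i j.
  transitivity ((zrow X (V x) *m (zrow X (V x))^T) i j - ridgeH X i j).
    by rewrite [LHS]mxE [X in _ + X = _]mxE.
  by congr (_ - _); rewrite mxE big_ord1 [_^T _ _]mxE !zrow_dot mulrACA cc.
rewrite (funext dE).
split; first by apply: itgB; [exact: itgZ|exact: itg_cst].
rewrite meanB; [|exact: itgZ|exact: itg_cst]; rewrite meanZ// E mean_cst.
apply/eqP; rewrite subr_eq0 !mxE; apply/eqP; congr (_ * _).
by apply: eq_bigr => k _; rewrite !mxE.
Qed.

Lemma dg_mean i : itg P (fun x => dg (V x) i 0) /\ mean P (fun x => dg (V x) i 0) = 0.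
Proof.
have [I E] := isotropic_dot (col i X) y.
have dE x : dg (V x) i 0 =
    n%:R^-1 * (dot (col i X) (V x) * dot y (V x)) - ridgeg X y i 0.
  transitivity (urow y (V x) * zrow X (V x) i 0 - ridgeg X y i 0).
    by rewrite [LHS]mxE [X in X + _ = _]mxE [X in _ + X = _]mxE.
  by congr (_ - _); rewrite zrow_dot urow_dot mulrACA cc [dot y _ * _]mulrC.
rewrite (funext dE).
split; first by apply: itgB; [exact: itgZ|exact: itg_cst].
rewrite meanB; [|exact: itgZ|exact: itg_cst]; rewrite meanZ// E mean_cst.
apply/eqP; rewrite subr_eq0 !mxE; apply/eqP; congr (_ * _).
by apply: eq_bigr => k _; rewrite !mxE.
Qed.

Variables (lam c0 : R).
Hypotheses (c0_gt0 : 0 < c0) (cK : coercive c0 (ridgeH X + lam%:M)).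

(** The normal equation for [beta] turns the ridge term into deviations of the row's products from
    [ridgeH X] and [ridgeg X y]. Both the vanishing mean and the fourth-moment bound are read off
    this form. *)
Lemma influenceE v :
  influence X y lam v = ridgeA X lam *m (dg v - dH v *m ridge_beta X y lam).
Proof.
rewrite /influence; congr (_ *m _).
set beta := ridge_beta X y lam; set z := zrow X v.
have Kb : ridgeH X *m beta + lam *: beta = ridgeg X y.
  rewrite -mul_scalar_mx -mulmxDl /beta /ridge_beta mulmxA mulmxV ?mul1mx//.
  exact: coercive_unit cK.
rewrite /dg /dH -/z mulmxBl -mulmxA.
have -> : z *m (z^T *m beta) = (z^T *m beta) 0 0 *: z.
  by rewrite {1}[z^T *m beta]mx11_scalar mul_mx_scalar.
rewrite -Kb scalerBl; move: (urow y v *: z) (_ *: z) (ridgeH X *m beta) (lam *: beta).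
by move=> p r h l; apply/matrixP => i j; rewrite !mxE; ring.
Qed.

Lemma influence_mean i : itg P (fun x => influence X y lam (V x) i 0) /\
  mean P (fun x => influence X y lam (V x) i 0) = 0.
Proof.
set beta := ridge_beta X y lam.
pose q k x := ridgeA X lam i k * (dg (V x) k 0 - \sum_l beta l 0 * dH (V x) k l).
have Iq' k : itg P (fun x => \sum_l beta l 0 * dH (V x) k l).
  by apply: itg_sum => l; apply: itgZ; exact: (dH_mean k l).1.
have Iq k : itg P (q k) by apply/itgZ/itgB; [exact: (dg_mean k).1|].
rewrite (_ : (fun x => _) = fun x => \sum_k q k x); last first.
  apply/funext => x; rewrite influenceE mxE; apply: eq_bigr => k _; rewrite /q.
  rewrite [X in _ * X]mxE [X in _ * (_ + X)]mxE [X in _ - X]mxE.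
  by congr (_ * (_ - _)); apply: eq_bigr => l _; rewrite mulrC.
split; first exact: itg_sum.
rewrite mean_sum// big1// => k _; rewrite meanZ; last by apply: itgB => //; exact: (dg_mean k).1.
rewrite meanB//; last exact: (dg_mean k).1.
rewrite (dg_mean k).2 mean_sum; last by move=> l; apply: itgZ; exact: (dH_mean k l).1.
rewrite big1 ?subr0 ?mulr0// => l _.
by rewrite meanZ ?(dH_mean k l).2 ?mulr0//; exact: (dH_mean k l).1.
Qed.

(** Coercivity bounds [ridgeA] by [c0^-1] and [beta] by [c0^-1 * Kg]. The 8 comes from
    [(a + w)^4 <= 8 (a^4 + w^4)]. *)
Lemma influence_pow4 Kg v : frobenius (ridgeg X y) <= Kg ->
  frobenius (influence X y lam v) ^+ 4 <=
  8 * c0^-1 ^+ 4 * (1 + (c0^-1 * Kg) ^+ 4) *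
  (frobenius (dH v) ^+ 4 + frobenius (dg v) ^+ 4).
Proof.
move=> gK; set beta := ridge_beta X y lam.
have ci0 : 0 < c0^-1 by rewrite invr_gt0.
have bK : frobenius beta <= c0^-1 * Kg.
  by apply: le_trans (coercive_inv _ c0_gt0 cK) _; rewrite ler_pM2l.
have Kg0 : 0 <= c0^-1 * Kg by apply: le_trans bK; exact: frobenius_ge0.
set a := frobenius (dg v); set b := frobenius (dH v).
have a0 : 0 <= a by exact: frobenius_ge0.
have b0 : 0 <= b by exact: frobenius_ge0.
have H1 : frobenius (influence X y lam v) <= c0^-1 * (a + b * (c0^-1 * Kg)).
  rewrite influenceE; apply: le_trans (coercive_inv _ c0_gt0 cK) _; rewrite ler_pM2l//.
  apply: le_trans (ler_frobeniusD _ _) _; rewrite frobeniusN lerD2l.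
  by apply: le_trans (ler_frobeniusM _ _) _; rewrite ler_wpM2l// frobenius_ge0.
apply: (@le_trans _ _ ((c0^-1 * (a + b * (c0^-1 * Kg))) ^+ 4)).
  rewrite ler_pXn2r ?nnegrE ?frobenius_ge0//.
  by apply: mulr_ge0; [exact: ltW|apply: addr_ge0 => //; exact: mulr_ge0].
set k := c0^-1 * Kg in Kg0 *.
have H2 : (a + b * k) ^+ 4 <= 8 * (a ^+ 4 + (b * k) ^+ 4).
  set w := b * k.
  have h1 : (a + w) ^+ 2 <= 2 * (a ^+ 2 + w ^+ 2) by have := sqr_ge0 (a - w); nra.
  have h2 : (a ^+ 2 + w ^+ 2) ^+ 2 <= 2 * (a ^+ 4 + w ^+ 4).
    have := sqr_ge0 (a ^+ 2 - w ^+ 2); rewrite sqrrB sqrrD -!exprM; lra.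
  have h3 : ((a + w) ^+ 2) ^+ 2 <= (2 * (a ^+ 2 + w ^+ 2)) ^+ 2.
    by rewrite ler_pXn2r ?nnegrE ?sqr_ge0 ?mulr_ge0 ?addr_ge0 ?sqr_ge0.
  by move: h3; rewrite -exprM [(2 * _) ^+ 2]exprMn; lra.
rewrite exprMn; have C0 : 0 <= c0^-1 ^+ 4 by rewrite exprn_ge0// ltW.
apply: le_trans (ler_wpM2l C0 H2) _; rewrite [(b * k) ^+ 4]exprMn.
have k4 : 0 <= k ^+ 4 by exact: exprn_ge0.
have a4 : 0 <= a ^+ 4 by exact: exprn_ge0.
have b4 : 0 <= b ^+ 4 by exact: exprn_ge0.
have := mulr_ge0 C0 b4; have := mulr_ge0 C0 (mulr_ge0 k4 a4).
move: (c0^-1 ^+ 4) (k ^+ 4) (a ^+ 4) (b ^+ 4) => p q r t'; nra.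
Qed.

End Isotropic.

Lemma mean_sqr_sum_mx (disp disp' : measure_display) (T : measurableType disp)
    (S : measurableType disp') (R : realType) (P : probability T R) m p q
    (s : 'I_m -> {mfun T >-> S}) (o : 'I_m) (F : S -> 'M[R]_(p, q)) :
  mutually_independent P s -> identically_distributed P s ->
  measurable_mx F -> itg P (fun x => frobenius (F (s o x)) ^+ 2) ->
  (forall i j, mean P (fun x => F (s o x) i j) = 0) ->
  itg P (fun x => frobenius (\sum_k F (s k x)) ^+ 2) /\
  mean P (fun x => frobenius (\sum_k F (s k x)) ^+ 2) =
  m%:R * mean P (fun x => frobenius (F (s o x)) ^+ 2).
Proof.
move=> indep ident mF IF F0.
have mFo i j : measurable_fun [set: T] (fun x => F (s o x) i j).
  by apply: (measurableT_comp (mF i j)); exact: measurable_funPT.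
have Fij i j : itg P (fun x => F (s o x) i j ^+ 2).
  apply: itg_le IF; first exact: measurable_funX.
  move=> x; rewrite ger0_norm ?sqr_ge0// sqr_frobenius (bigD1 i)//= (bigD1 j)//=.
  rewrite -addrA lerDl addr_ge0// ?sumr_ge0// => [k _|k _]; first exact: sqr_ge0.
  by rewrite sumr_ge0// => l _; exact: sqr_ge0.
have H i j := mean_sqr_sum indep ident (mF i j) (Fij i j) (F0 i j).
have E : (fun x => frobenius (\sum_k F (s k x)) ^+ 2) =
    fun x => \sum_i \sum_j (\sum_k F (s k x) i j) ^+ 2.
  apply/funext => x; rewrite sqr_frobenius; apply: eq_bigr => i _.
  by apply: eq_bigr => j _; rewrite summxE.
have I' i : itg P (fun x => \sum_j (\sum_k F (s k x) i j) ^+ 2).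
  by apply: itg_sum => j; exact: (H i j).1.
rewrite E; split; first exact: itg_sum.
rewrite mean_sum//.
have -> : mean P (fun x => frobenius (F (s o x)) ^+ 2) =
    \sum_i \sum_j mean P (fun x => F (s o x) i j ^+ 2).
  transitivity (mean P (fun x => \sum_i \sum_j F (s o x) i j ^+ 2)).
    by apply: eq_mean => x; rewrite sqr_frobenius.
  rewrite mean_sum; last by move=> i; exact: itg_sum.
  by apply: eq_bigr => i _; rewrite mean_sum.
rewrite big_distrr /=; apply: eq_bigr => i _.
rewrite mean_sum; last by move=> j; exact: (H i j).1.
by rewrite big_distrr /=; apply: eq_bigr => j _; exact: (H i j).2.
Qed.

(* The dummy index makes this a one-row family of sketch rows. *)
Lemma measurable_cvec (R : realType) n (_ : 'I_1) :
  measurable_mx (fun v : n.-tuple R => cvec v).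
Proof.
by move=> j k; rewrite /cvec; under eq_fun do rewrite mxE; exact: measurable_tnth.
Qed.

(** * Tail bounds and comparisons at one sample size *)

Section FixedN.
Context {disp : measure_display} {T : measurableType disp} {R : realType}.
Variables (P : probability T R) (n d m : nat) (X : 'M[R]_(n, d)) (y : 'cV[R]_n) (lam : R).
Variables (s : 'I_m -> {mfun T >-> n.-tuple R}) (o : 'I_m).
Variables (L : 'M[R]_d) (c0 M e : R).
Hypotheses (m_gt0 : (0 < m)%N) (lam_gt0 : 0 < lam).
Hypotheses (indep : mutually_independent P s) (ident : identically_distributed P s).
Hypothesis iso :
  mx_expectation P (fun x => cvec (s o x) *m (cvec (s o x))^T) = 1%:M.
Hypotheses (c0_gt0 : 0 < c0) (cK : coercive c0 (ridgeH X + lam%:M)).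
Hypothesis dH_itg : itg P (fun x => frobenius (dH X (cvec (s o x))) ^+ 2).
Hypothesis dH_le : mean P (fun x => frobenius (dH X (cvec (s o x))) ^+ 2) <= M.
Hypothesis psi_itg : itg P (fun x => frobenius (influence X y lam (cvec (s o x))) ^+ 4).
Hypothesis psi_le : mean P (fun x => frobenius (influence X y lam (cvec (s o x))) ^+ 4) <= M.
Hypothesis cov_le : forall i j,
  `|mean P (fun x => influence X y lam (cvec (s o x)) i 0 * influence X y lam (cvec (s o x)) j 0)
    - (L *m L^T) i j| <= e.

Let psi (v : n.-tuple R) := influence X y lam (cvec v).
Let Dh (v : n.-tuple R) := dH X (cvec v).

Let m0 : 0 < m%:R :> R. Proof. by rewrite ltr0n. Qed.
Let sq0 : 0 < Num.sqrt m%:R :> R. Proof. by rewrite sqrtr_gt0. Qed.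
Let J0 : (0 < #|'I_m|)%N. Proof. by rewrite card_ord. Qed.

Let mpsi : measurable_mx psi.
Proof. exact: (measurable_influence X y lam (@measurable_cvec R n) ord0). Qed.

Let mDh : measurable_mx Dh.
Proof.
apply: measurable_mxB; first exact: (measurable_zz X (@measurable_cvec R n) ord0).
exact: measurable_mx_cst.
Qed.

Let mV : measurable_mx (fun x => cvec (s o x)).
Proof.
move=> j k; rewrite /cvec; under eq_fun do rewrite mxE.
by apply: (measurableT_comp (measurable_tnth j)); exact: measurable_funPT.
Qed.

Let ms i : measurable_mx (fun x => sketch_rows s x i).
Proof. exact: measurable_sketch_rows. Qed.

Let sketchH_dH x : sketchH X (sketch_rows s x) - ridgeH X = m%:R^-1 *: \sum_k Dh (s k x).
Proof.
rewrite /Dh /dH sumrB sumr_const card_ord scalerBr; congr (_ - _).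
by rewrite -[ridgeH X *+ m]scaler_nat scalerA mulVf ?scale1r// gt_eqF.
Qed.

Let M0 : 0 <= M. Proof. by apply: le_trans dH_le; apply: mean_ge0 => x; exact: sqr_ge0. Qed.

Lemma sketchH_tail eta : 0 < eta ->
  measurable [set x | eta <= frobenius (sketchH X (sketch_rows s x) - ridgeH X)] /\
  Pr P [set x | eta <= frobenius (sketchH X (sketch_rows s x) - ridgeH X)]
    <= M / (m%:R * eta ^+ 2).
Proof.
move=> eta0.
have [I E] := mean_sqr_sum_mx indep ident mDh dH_itg (fun i j => (dH_mean mV iso X i j).2).
have me0 : 0 < (m%:R * eta) ^+ 2 by rewrite exprn_gt0// mulr_gt0.
have [mA PA] := markov_Pr I (fun x => sqr_ge0 _) me0.
have <- : [set x | (m%:R * eta) ^+ 2 <= frobenius (\sum_k Dh (s k x)) ^+ 2] =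
    [set x | eta <= frobenius (sketchH X (sketch_rows s x) - ridgeH X)].
  apply/seteqP; split => x /=; rewrite sketchH_dH frobeniusZ ger0_norm ?invr_ge0//;
    by rewrite ler_pXn2r ?nnegrE ?frobenius_ge0 ?mulr_ge0 ?(ltW eta0)// ler_pdivlMl.
split=> //; apply: le_trans PA _; rewrite E.
have -> a : m%:R * a / (m%:R * eta) ^+ 2 = a / (m%:R * eta ^+ 2).
  by field; rewrite !gt_eqF.
by rewrite ler_pM2r// invr_gt0 mulr_gt0// exprn_gt0.
Qed.

Let psi2_itg : itg P (fun x => frobenius (psi (s o x)) ^+ 2) /\
  mean P (fun x => frobenius (psi (s o x)) ^+ 2) <= 1 + M.
Proof.
have le x := (pow4_ge (frobenius_ge0 (psi (s o x)))).1.
have I : itg P (fun x => frobenius (psi (s o x)) ^+ 2).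
  apply: itg_le (itgD (itg_cst P 1) psi_itg).
    apply: measurable_funX; apply: measurable_frobenius => i j.
    by apply: (measurableT_comp (mpsi i j)); exact: measurable_funPT.
  by move=> x; rewrite ger0_norm ?sqr_ge0//; exact: le.
split=> //; apply: le_trans (ler_mean I (itgD (itg_cst P 1) psi_itg) le) _.
by rewrite meanD// ?mean_cst ?lerD2l//; exact: itg_cst.
Qed.

Lemma sketch_sum_tail Ks : 0 < Ks ->
  measurable [set x | Ks <= frobenius (sketch_sum X y lam (sketch_rows s x))] /\
  Pr P [set x | Ks <= frobenius (sketch_sum X y lam (sketch_rows s x))]
    <= (1 + M) / Ks ^+ 2.
Proof.
move=> Ks0.
have psi0 i j : mean P (fun x => psi (s o x) i j) = 0.
  by rewrite ord1; exact: (influence_mean mV iso y c0_gt0 cK i).2.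
have [I2 E2] := psi2_itg.
have [I E] := mean_sqr_sum_mx indep ident mpsi I2 psi0.
have me0 : 0 < m%:R * Ks ^+ 2 by rewrite mulr_gt0// exprn_gt0.
have [mA PA] := markov_Pr I (fun x => sqr_ge0 _) me0.
have <- : [set x | m%:R * Ks ^+ 2 <= frobenius (\sum_k psi (s k x)) ^+ 2] =
    [set x | Ks <= frobenius (sketch_sum X y lam (sketch_rows s x))].
  have -> : m%:R * Ks ^+ 2 = (Num.sqrt m%:R * Ks) ^+ 2 by rewrite exprMn sqr_sqrtr.
  apply/seteqP; split => x /=; rewrite frobeniusZ ger0_norm ?invr_ge0//;
    by rewrite ler_pXn2r ?nnegrE ?frobenius_ge0 ?mulr_ge0 ?(ltW Ks0)// ler_pdivlMl.
split=> //; apply: le_trans PA _; rewrite E -mulf_div divff ?gt_eqF// mul1r.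
by rewrite ler_pM2r// invr_gt0 exprn_gt0.
Qed.

Lemma dH_avg_tail K : 0 < K ->
  measurable [set x | K <= avg (fun i => frobenius (Dh (s i x)) ^+ 2)] /\
  Pr P [set x | K <= avg (fun i => frobenius (Dh (s i x)) ^+ 2)] <= M / K.
Proof.
move=> K0.
have mA : measurable_fun [set: n.-tuple R] (fun v => frobenius (Dh v) ^+ 2).
  by apply: measurable_funX; exact: measurable_frobenius.
have [m1 p1] := markov_avg ident m_gt0 mA dH_itg (fun v => sqr_ge0 _) K0.
by split=> //; apply: le_trans p1 _; rewrite ler_pM2r// invr_gt0.
Qed.

Lemma psi_avg_tail K : 0 < K ->
  measurable [set x | K <= avg (fun i => frobenius (psi (s i x)) ^+ 4)] /\
  Pr P [set x | K <= avg (fun i => frobenius (psi (s i x)) ^+ 4)] <= M / K.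
Proof.
move=> K0.
have mA : measurable_fun [set: n.-tuple R] (fun v => frobenius (psi v) ^+ 4).
  by apply: measurable_funX; exact: measurable_frobenius.
have [m1 p1] := markov_avg ident m_gt0 mA psi_itg
  (fun v => exprn_ge0 _ (frobenius_ge0 _)) K0.
by split=> //; apply: le_trans p1 _; rewrite ler_pM2r// invr_gt0.
Qed.

(** The gap [eta - e] is what remains for sampling fluctuation after the bias [e] of the population
    covariance. Fourth moments bound the variance of the products. *)
Lemma cov_tail i j eta : e < eta ->
  measurable [set x | eta <= `|(covmx (fun k => psi (s k x)) - L *m L^T) i j|] /\
  Pr P [set x | eta <= `|(covmx (fun k => psi (s k x)) - L *m L^T) i j|]
    <= (2 * M + 2 * (1 + M) ^+ 2) / (m%:R * (eta - e) ^+ 2).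
Proof.
move=> ee; have ee0 : 0 < eta - e by rewrite subr_gt0.
pose a (v : n.-tuple R) := psi v i 0 * psi v j 0.
pose mu := mean P (fun x => a (s o x)).
have ma : measurable_fun [set: n.-tuple R] a by apply: measurable_funM; exact: mpsi.
have mao : measurable_fun [set: T] (fun x => a (s o x)).
  by apply: (measurableT_comp ma); exact: measurable_funPT.
have al v : `|a v| <= frobenius (psi v) ^+ 2.
  by rewrite normrM expr2 ler_pM//; exact: ler_entry_frobenius.
have [I2 E2] := psi2_itg.
have aI : itg P (fun x => a (s o x)) by apply: itg_le mao _ I2 => x; exact: al.
have mu1 : `|mu| <= 1 + M.
  apply: le_trans (ler_norm_mean aI) _; apply: le_trans E2; apply: ler_mean => //.
  exact: itg_norm.
have a2 v : (a v - mu) ^+ 2 <= 2 * frobenius (psi v) ^+ 4 + 2 * (1 + M) ^+ 2.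
  have h1 : a v ^+ 2 <= frobenius (psi v) ^+ 4.
    rewrite -[a v ^+ 2]real_normK ?num_real// -[4%N]/(2 * 2)%N exprM.
    by rewrite ler_pXn2r ?nnegrE ?sqr_ge0.
  have h2 : mu ^+ 2 <= (1 + M) ^+ 2.
    by rewrite -[mu ^+ 2]real_normK ?num_real// ler_pXn2r ?nnegrE ?addr_ge0.
  by have := sqr_ge0 (a v + mu); rewrite sqrrD sqrrB; lra.
have bI : itg P (fun x => 2 * frobenius (psi (s o x)) ^+ 4 + 2 * (1 + M) ^+ 2).
  by apply: itgD; [exact: itgZ|exact: itg_cst].
have aI2 : itg P (fun x => (a (s o x) - mu) ^+ 2).
  apply: itg_le bI => [|x].
    by apply: measurable_funX; apply: measurable_funB => //; exact: measurable_cst.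
  by rewrite ger0_norm ?sqr_ge0.
have aE2 : mean P (fun x => (a (s o x) - mu) ^+ 2) <= 2 * M + 2 * (1 + M) ^+ 2.
  apply: le_trans (ler_mean aI2 bI (fun x => a2 _)) _.
  rewrite meanD; [|exact: itgZ|exact: itg_cst].
  by rewrite meanZ// mean_cst lerD2r ler_pM2l.
have [m1 p1] := weak_lln indep ident m_gt0 ma aI aI2 erefl aE2 ee0.
have mc : measurable [set x | eta <= `|(covmx (fun k => psi (s k x)) - L *m L^T) i j|].
  apply: measurable_set_le; first exact: measurable_cst.
  apply: measurableT_comp => //.
  under eq_fun do rewrite mxE [covmx _ _ _]mxE.
  apply: measurable_funD; last exact: measurable_cst.
  apply: measurable_funM; first exact: measurable_cst.
  by apply: measurable_sum => k; apply: (measurableT_comp ma); exact: measurable_funPT.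
split=> //; apply: le_trans p1; apply: le_Pr => // x /=.
rewrite mxE [covmx _ _ _]mxE [X in _ + X]mxE => H; rewrite lerBlDr; apply: le_trans H _.
rewrite -[X in `|X|](subrKA mu); apply: le_trans (ler_normD _ _) _.
by rewrite lerD2l; exact: cov_le.
Qed.

(** A union bound over the failures of the conditions in [good], which are those of [boot_close];
    the factor [d%:R ^+ 2] counts the covariance entries. *)
Lemma boot_tail t eta Ks K eps : 0 < eta -> e < eta -> 0 < Ks -> 0 < K ->
  (forall x, frobenius (sketchH X (sketch_rows s x) - ridgeH X) <= eta ->
    frobenius (sketch_sum X y lam (sketch_rows s x)) <= Ks ->
    avg (fun i => frobenius (Dh (s i x)) ^+ 2) <= K ->
    avg (fun i => frobenius (psi (s i x)) ^+ 4) <= K ->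
    (forall i j, `|(covmx (fun k => psi (s k x)) - L *m L^T) i j| <= eta) ->
    `|boot_cdf X y lam (sketch_rows s x) t - walk_cdf L m t| < eps) ->
  Pr P [set x | eps <= `|boot_cdf X y lam (sketch_rows s x) t - walk_cdf L m t|] <=
    M / (m%:R * eta ^+ 2) + (1 + M) / Ks ^+ 2 + (M / K + M / K)
    + d%:R ^+ 2 * ((2 * M + 2 * (1 + M) ^+ 2) / (m%:R * (eta - e) ^+ 2)).
Proof.
move=> eta0 ee Ks0 K0 good.
have [m1 p1] := sketchH_tail eta0; have [m2 p2] := sketch_sum_tail Ks0.
have [m3 p3] := dH_avg_tail K0; have [m4 p4] := psi_avg_tail K0.
pose A (ij : 'I_d * 'I_d) :=
  [set x | eta <= `|(covmx (fun k => psi (s k x)) - L *m L^T) ij.1 ij.2|].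
have [m5 p5] := Pr_bigcup_le P (enum {: 'I_d * 'I_d}) (fun ij => (cov_tail ij.1 ij.2 ee).1 : measurable (A ij)).
have p5' : \sum_(ij <- enum {: 'I_d * 'I_d}) Pr P (A ij) <=
    d%:R ^+ 2 * ((2 * M + 2 * (1 + M) ^+ 2) / (m%:R * (eta - e) ^+ 2)).
  rewrite big_enum /=; apply: (@le_trans _ _ (\sum_(ij : 'I_d * 'I_d)
      (2 * M + 2 * (1 + M) ^+ 2) / (m%:R * (eta - e) ^+ 2))).
    by apply: ler_sum => ij _; exact: (cov_tail ij.1 ij.2 ee).2.
  by rewrite sumr_const card_prod !card_ord -[_ *+ _]mulr_natl natrM.
have m12 := measurableU _ _ m1 m2; have m34 := measurableU _ _ m3 m4.
have m1234 := measurableU _ _ m12 m34.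
have U12 := PrU_le P m1 m2; have U34 := PrU_le P m3 m4.
have U1234 := PrU_le P m12 m34; have U := PrU_le P m1234 m5.
apply: le_trans (_ : _ <= _); last first.
  apply: le_trans U _; apply: lerD; last exact: le_trans p5 p5'.
  apply: le_trans U1234 _; apply: lerD.
    by apply: le_trans U12 _; exact: lerD.
  by apply: le_trans U34 _; exact: lerD.
apply: le_Pr.
- apply: measurable_set_le; first exact: measurable_cst.
  apply: measurableT_comp => //; apply: measurable_funB; last exact: measurable_cst.
  exact: measurable_boot_cdf.
- exact: measurableU.
move=> x /= H; apply: contrapT => nU.
have G1 : frobenius (sketchH X (sketch_rows s x) - ridgeH X) <= eta.
  by rewrite leNgt; apply/negP => /ltW h; apply: nU; left; left; left.
have G2 : frobenius (sketch_sum X y lam (sketch_rows s x)) <= Ks.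
  by rewrite leNgt; apply/negP => /ltW h; apply: nU; left; left; right.
have G3 : avg (fun i => frobenius (Dh (s i x)) ^+ 2) <= K.
  by rewrite leNgt; apply/negP => /ltW h; apply: nU; left; right; left.
have G4 : avg (fun i => frobenius (psi (s i x)) ^+ 4) <= K.
  by rewrite leNgt; apply/negP => /ltW h; apply: nU; left; right; right.
have G5 i j : `|(covmx (fun k => psi (s k x)) - L *m L^T) i j| <= eta.
  rewrite leNgt; apply/negP => /ltW h; apply: nU; right.
  by exists (i, j) => //; rewrite mem_enum.
by have := good x G1 G2 G3 G4 G5; rewrite ltNge H.
Qed.

(** The unconditional counterpart of [boot_close]: the indicator of the error event is trapped
    between the smoothed indicators of [sketch_sum], up to the indicators of a poor Gram matrix and
    of a large sum. *)
Lemma sketch_close k0 t delta eta Ks err :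
  0 < delta -> 2 * delta <= t -> col k0 L != 0 ->
  0 < eta -> eta <= c0 / 2 -> 0 < Ks -> 2 / c0 * (eta * Ks) <= delta ->
  `|mean P (fun x => upper_step t delta (sketch_sum X y lam (sketch_rows s x)))
    - walk L m (upper_step t delta)| <= err ->
  `|mean P (fun x => lower_step t delta (sketch_sum X y lam (sketch_rows s x)))
    - walk L m (lower_step t delta)| <= err ->
  `|Pr P [set x | sketch_err X y lam (sketch_rows s x) <= t] - walk_cdf L m t| <=
    err + (M / (m%:R * eta ^+ 2) + (1 + M) / Ks ^+ 2)
    + (Num.sqrt (8 * t * delta) / frobenius (col k0 L) + 2 / Num.sqrt m%:R).
Proof.
move=> delta0 dt L0 eta0 eta_c0 Ks0 small.
have [m1 p1] := sketchH_tail eta0; have [m2 p2] := sketch_sum_tail Ks0.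
set ss := fun x => sketch_sum X y lam (sketch_rows s x).
set hh := fun x => frobenius (sketchH X (sketch_rows s x) - ridgeH X).
set er := fun x => sketch_err X y lam (sketch_rows s x).
have mss : measurable_vec ss by move=> j; exact: measurable_sketch_sum.
have mer : measurable [set x | er x <= t].
  by apply: measurable_set_le; [exact: measurable_sketch_err|exact: measurable_cst].
have close x : hh x < eta -> frobenius (ss x) < Ks -> `|er x - frobenius (ss x)| <= delta.
  move=> h1 h2; rewrite /er sketch_errE//; apply: le_trans (ler_dist_frobenius _ _) _.
  apply: le_trans (sketch_delta y m_gt0 c0_gt0 cK (le_trans (ltW h1) eta_c0)) _.
  apply: le_trans small; rewrite ler_pM2l ?divr_gt0//.
  by apply: ler_pM; rewrite ?frobenius_ge0// ltW.
pose a x : R := (er x <= t)%R%:R; pose b x : R := (eta <= hh x)%R%:R.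
pose c x : R := (Ks <= frobenius (ss x))%R%:R.
have Ia : itg P a by exact: itg_bool.
have Ib : itg P b by exact: itg_bool.
have Ic : itg P c by exact: itg_bool.
have ub x := upper_step_bounds delta0 dt (ss x).
have lb x := lower_step_bounds delta0 dt (ss x).
have Iu : itg P (fun x => upper_step t delta (ss x)).
  apply: (@itg_bounded _ _ _ P _ 1); first exact: ((measurable_on_vec_step _ _ : measurable_on_vec (@upper_step R d t delta)) _ _ _ mss).
  move=> x; have /andP[u0 u1] := ub x.
  rewrite ger0_norm ?(le_trans _ u0)//; apply: le_trans u1 _; rewrite lern1; exact: leq_b1.
have Il : itg P (fun x => lower_step t delta (ss x)).
  apply: (@itg_bounded _ _ _ P _ 1); first exact: ((measurable_on_vec_step _ _ : measurable_on_vec (@lower_step R d t delta)) _ _ _ mss).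
  move=> x; have /andP[u0 u1] := lb x.
  rewrite ger0_norm ?(le_trans _ u0)//; apply: le_trans u1 _; rewrite lern1; exact: leq_b1.
have b0 x : 0 <= b x by []. have c_0 x : 0 <= c x by [].
have up x : a x <= upper_step t delta (ss x) + (b x + c x).
  have /andP[u0 _] := ub x; have u00 : 0 <= upper_step t delta (ss x) by exact: le_trans u0.
  rewrite /a; case: (leP (er x) t) => [et|_] /=; last by rewrite !addr_ge0.
  have cx := c_0 x; rewrite /c in cx; rewrite /b /c.
  case: (leP eta (hh x)) => [_|h1]; first by rewrite mulr1n; lra.
  case: (leP Ks (frobenius (ss x))) cx => [_|h2] _ /=; first by lra.
  rewrite !addr0; apply: le_trans u0; have := close x h1 h2.
  by rewrite ler_norml => /andP[h3 h4]; rewrite (_ : frobenius (ss x) <= t + delta = true)//; lra.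
have lo x : lower_step t delta (ss x) - (b x + c x) <= a x.
  have /andP[_ u1] := lb x.
  have u11 : lower_step t delta (ss x) <= 1.
    by apply: le_trans u1 _; rewrite lern1 leq_b1.
  have a0 : 0 <= a x by [].
  have cx := c_0 x; rewrite /c in cx; rewrite lerBlDr /b /c.
  case: (leP eta (hh x)) => [_|h1]; first by rewrite mulr1n; lra.
  case: (leP Ks (frobenius (ss x))) cx => [_|h2] _ /=; first by lra.
  rewrite !addr0; apply: le_trans u1 _; have := close x h1 h2.
  rewrite ler_norml => /andP[h3 h4]; apply: ler_bool_nat => h5; move: h4 h5; lra.
have bcE : mean P (fun x => b x + c x) <= M / (m%:R * eta ^+ 2) + (1 + M) / Ks ^+ 2.
  by rewrite meanD// !mean_bool// lerD.
have Ibc := itgD Ib Ic.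
have pu : Pr P [set x | er x <= t] <= mean P (fun x => upper_step t delta (ss x)) +
    (M / (m%:R * eta ^+ 2) + (1 + M) / Ks ^+ 2).
  rewrite -mean_bool//; apply: le_trans (ler_mean Ia (itgD Iu Ibc) up) _.
  by rewrite meanD// lerD2l.
have pl : mean P (fun x => lower_step t delta (ss x)) -
    (M / (m%:R * eta ^+ 2) + (1 + M) / Ks ^+ 2) <= Pr P [set x | er x <= t].
  rewrite -mean_bool//; apply: le_trans (ler_mean (itgB Il Ibc) Ia lo).
  by rewrite meanB// lerD2l lerN2.
move=> h1 h2; exact: (walk_sandwich delta0 dt m_gt0 L0 pu pl h1 h2).
Qed.

End FixedN.

(** * Limits uniform over all probability spaces and data *)

Section Uniform.
Context {R : realType}.

(** Everything the comparisons use about one sample size. [L], [c0] and [M] will not depend on [n],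
    whereas [e] may be taken arbitrarily small for large [n]. *)
Record regular (disp : measure_display) (T : measurableType disp)
    (P : probability T R) n d m (X : 'M[R]_(n, d)) (y : 'cV[R]_n) (lam : R)
    (s : 'I_m -> {mfun T >-> n.-tuple R}) (o : 'I_m) (L : 'M[R]_d) (c0 M e : R) : Prop :=
  Regular {
    reg_lam : 0 < lam;
    reg_indep : mutually_independent P s;
    reg_ident : identically_distributed P s;
    reg_iso : mx_expectation P (fun x => cvec (s o x) *m (cvec (s o x))^T) = 1%:M;
    reg_coercive : coercive c0 (ridgeH X + lam%:M);
    reg_dH_itg : itg P (fun x => frobenius (dH X (cvec (s o x))) ^+ 2);
    reg_dH : mean P (fun x => frobenius (dH X (cvec (s o x))) ^+ 2) <= M;
    reg_psi_itg : itg P (fun x => frobenius (influence X y lam (cvec (s o x))) ^+ 4);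
    reg_psi : mean P (fun x => frobenius (influence X y lam (cvec (s o x))) ^+ 4) <= M;
    reg_cov : forall i j,
      `|mean P (fun x => influence X y lam (cvec (s o x)) i 0 *
                         influence X y lam (cvec (s o x)) j 0) - (L *m L^T) i j| <= e }.

Lemma inv_small (c e : R) : 0 < e -> exists N, forall m, (N <= m)%N -> c / m%:R <= e.
Proof.
move=> e0; exists (Num.truncn (`|c| / e)).+1 => m Nm.
have cm : `|c| / e <= m%:R.
  by apply: le_trans (ltW (truncnS_gt _)) _; rewrite ler_nat.
have m0 : 0 < m%:R :> R by rewrite ltr0n (leq_ltn_trans _ Nm).
rewrite ler_pdivrMr// mulrC; apply: le_trans (ler_norm c) _.
by rewrite -ler_pdivrMr.
Qed.

Lemma inv_sqr_small (c e : R) : 0 <= c -> 0 < e -> exists2 K, 0 < K & c / K ^+ 2 <= e.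
Proof.
move=> c0 e0; have ce : 0 <= c / e by rewrite divr_ge0// ltW.
have K0 : 0 < Num.sqrt (c / e) + 1 by rewrite ltr_wpDl ?sqrtr_ge0.
exists (Num.sqrt (c / e) + 1) => //.
rewrite ler_pdivrMr ?exprn_gt0// mulrC -ler_pdivrMr// -{1}(sqr_sqrtr ce).
by rewrite ler_pXn2r ?nnegrE ?sqrtr_ge0 ?(ltW K0)// lerDl.
Qed.

Lemma mul_small (c e : R) : 0 <= c -> 0 < e ->
  exists2 x, 0 < x & forall x', x' <= x -> c * x' <= e.
Proof.
move=> c0 e0; have c1 : 0 < c + 1 by rewrite ltr_wpDl.
exists (e / (c + 1)); first exact: divr_gt0.
move=> x' xx; apply: le_trans (ler_wpM2l c0 xx) _.
by rewrite mulrA ler_pdivrMr// mulrC ler_pM2l// lerDl.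
Qed.

Lemma delta_small (t f e : R) : 0 < t -> 0 < f -> 0 < e ->
  exists delta, [/\ 0 < delta, 2 * delta <= t & Num.sqrt (8 * t * delta) / f <= e].
Proof.
move=> t0 f0 e0; have t8 : 0 <= 8 * t by rewrite mulr_ge0// ltW.
have [x x0 xP] := mul_small t8 (exprn_gt0 2 (mulr_gt0 e0 f0)).
exists (Num.min x (t / 2)); split.
- by rewrite lt_min x0 divr_gt0.
- have : Num.min x (t / 2) <= t / 2 by rewrite ge_min lexx orbT.
  by lra.
rewrite ler_pdivrMr// -[leRHS]ger0_norm ?mulr_ge0 ?(ltW e0) ?(ltW f0)// -sqrtr_sqr.
by rewrite ler_wsqrtr// xP// ge_min lexx.
Qed.

(** The tolerance [e] and threshold [N] precede the probability space, which varies with [n]. The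
    constants are chosen in the order [delta], [Ks], [eta], the Lindeberg constants, [e], [N], and
    each error term receives a share of [eps]. *)
Lemma sketch_limit d (L : 'M[R]_d) k0 (c0 M t eps : R) :
  col k0 L != 0 -> 0 < c0 -> 0 <= M -> 0 < t -> 0 < eps ->
  exists2 e, 0 < e & exists N, forall (disp : measure_display) (T : measurableType disp)
    (P : probability T R) n m (X : 'M[R]_(n, d)) y lam
    (s : 'I_m -> {mfun T >-> n.-tuple R}) (o : 'I_m),
  (N <= m)%N -> regular P X y lam s o L c0 M e ->
  `|cdf_sketch P X y lam s t - walk_cdf L m t| <= eps.
Proof.
move=> L0 c0_gt0 M_ge0; pose f := frobenius (col k0 L).
have f_gt0 : 0 < f by rewrite lt_def frobenius_ge0 frobenius_eq0 L0.
move=> t0 eps0; have eps8 : 0 < eps / 8 by rewrite divr_gt0.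
have [delta [delta0 dt sd]] := delta_small t0 f_gt0 eps8.
have [Ks Ks0 KsP] := inv_sqr_small (addr_ge0 ler01 M_ge0) eps8.
have c2Ks : 0 <= 2 / c0 * Ks by rewrite mulr_ge0 ?divr_ge0 ?(ltW c0_gt0) ?(ltW Ks0).
have [x x0 xP] := mul_small c2Ks delta0.
pose eta := Num.min x (c0 / 2).
have eta0 : 0 < eta by rewrite lt_min x0 divr_gt0.
have eta_c0 : eta <= c0 / 2 by rewrite ge_min lexx orbT.
have etad : 2 / c0 * (eta * Ks) <= delta.
  by rewrite [eta * Ks]mulrC mulrA xP// ge_min lexx.
have up1 (v : 'cV[R]_d) : `|upper_step t delta v| <= 1.
  have /andP[u0 u1] := upper_step_bounds delta0 dt v.
  rewrite ger0_norm ?(le_trans _ u0)//; apply: le_trans u1 _; rewrite lern1; exact: leq_b1.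
have lo1 (v : 'cV[R]_d) : `|lower_step t delta v| <= 1.
  have /andP[u0 u1] := lower_step_bounds delta0 dt v.
  rewrite ger0_norm ?(le_trans _ u0)//; apply: le_trans u1 _; rewrite lern1; exact: leq_b1.
have [C1 C1_0 H1] := lindeberg L (taylor3_upper d delta0 dt)
  (measurable_on_vec_step _ _ : measurable_on_vec (@upper_step R d t delta)) up1.
have [C2 C2_0 H2] := lindeberg L (taylor3_lower d delta0 dt)
  (measurable_on_vec_step _ _ : measurable_on_vec (@lower_step R d t delta)) lo1.
pose C := C1 + C2; have C0 : 0 <= C by exact: addr_ge0.
have C1C : C1 <= C by rewrite lerDl.
have C2C : C2 <= C by rewrite lerDr.
have Cd : 0 <= C * d%:R ^+ 2 by rewrite mulr_ge0 ?sqr_ge0.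
have [e e0 eP] := mul_small Cd eps8.
have cn0 : 0 <= 1 + M + col_norms L ^+ 3.
  by rewrite !addr_ge0// exprn_ge0// sumr_ge0// => i _; exact: frobenius_ge0.
have [N1 N1P] := inv_sqrt_small (mulr_ge0 C0 cn0) eps8.
have [N2 N2P] := inv_small (M / eta ^+ 2) eps8.
have [N3 N3P] := inv_sqrt_small (ler0n _ 2) eps8.
exists e => //; exists (maxn (maxn N1 N2) N3) => disp T P n m X y lam s o.
rewrite !geq_max => /andP[/andP[N1m N2m] N3m] reg.
have m0 : (0 < m)%N by exact: leq_ltn_trans (ltn_ord o).
pose psi (v : n.-tuple R) := influence X y lam (cvec v).
have mpsi : measurable_vec psi.
  by move=> j; exact: (measurable_influence X y lam (@measurable_cvec R n) ord0 j 0).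
have mV : measurable_mx (fun x => cvec (s o x)).
  move=> j k; rewrite /cvec; under eq_fun do rewrite mxE.
  by apply: (measurableT_comp (measurable_tnth j)); exact: measurable_funPT.
have psi0 j : mean P (fun x => psi (s o x) j 0) = 0.
  exact: (influence_mean mV (reg_iso reg) y c0_gt0 (reg_coercive reg) j).2.
have CP Ci : 0 <= Ci -> Ci <= C ->
    Ci * (d%:R ^+ 2 * e + (1 + M + col_norms L ^+ 3) / Num.sqrt m%:R) <= eps / 4.
  move=> Ci0 CiC.
  apply: le_trans (_ : C * (d%:R ^+ 2 * e + (1 + M + col_norms L ^+ 3) / Num.sqrt m%:R) <= _).
    rewrite ler_wpM2r// addr_ge0//; first by rewrite mulr_ge0 ?sqr_ge0// ltW.
    by rewrite divr_ge0// sqrtr_ge0.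
  have a := eP e (lexx e); have b := N1P m N1m.
  rewrite mulrDr [C * (d%:R ^+ 2 * e)]mulrA [C * (_ / _)]mulrA; move: a b; clear; lra.
have h1 := le_trans (H1 _ _ _ _ P m s psi o e M (reg_indep reg) (reg_ident reg) mpsi psi0
  (reg_psi_itg reg) (reg_psi reg) (reg_cov reg)) (CP C1 C1_0 C1C).
have h2 := le_trans (H2 _ _ _ _ P m s psi o e M (reg_indep reg) (reg_ident reg) mpsi psi0
  (reg_psi_itg reg) (reg_psi reg) (reg_cov reg)) (CP C2 C2_0 C2C).
apply: le_trans (sketch_close m0 (reg_lam reg) (reg_indep reg) (reg_ident reg) (reg_iso reg)
  c0_gt0 (reg_coercive reg) (reg_dH_itg reg) (reg_dH reg) (reg_psi_itg reg) (reg_psi reg)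
  delta0 dt L0 eta0 eta_c0 Ks0 etad h1 h2) _.
have := N2P m N2m; rewrite -mulrA -invfM [eta ^+ 2 * _]mulrC => h3.
have := N3P m N3m; move: sd KsP h3 eps0; rewrite -/f; clear; lra.
Qed.

Lemma boot_limit d (L : 'M[R]_d) k0 (c0 M t eps xi : R) :
  col k0 L != 0 -> 0 < c0 -> 0 <= M -> 0 < t -> 0 < eps -> 0 < xi ->
  exists2 e, 0 < e & exists N, forall (disp : measure_display) (T : measurableType disp)
    (P : probability T R) n m (X : 'M[R]_(n, d)) y lam
    (s : 'I_m -> {mfun T >-> n.-tuple R}) (o : 'I_m),
  (N <= m)%N -> regular P X y lam s o L c0 M e ->
  Pr P [set x | eps <= `|boot_cdf X y lam (sketch_rows s x) t - walk_cdf L m t|] <= xi.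
Proof.
move=> L0 c0_gt0 M_ge0; pose f := frobenius (col k0 L).
have f_gt0 : 0 < f by rewrite lt_def frobenius_ge0 frobenius_eq0 L0.
move=> t0 eps0 xi0; have eps8 : 0 < eps / 8 by rewrite divr_gt0.
have xi8 : 0 < xi / 8 by rewrite divr_gt0.
have [delta [delta0 dt sd]] := delta_small t0 f_gt0 eps8.
have [C C0 HC] := boot_close delta0 dt L0.
have [Ks Ks0 KsP] := inv_sqr_small (addr_ge0 ler01 M_ge0) xi8.
(* [K] is defined as a square so that the same smallness lemma yields [M / K <= xi / 8]. [Kb] is
   chosen after [K] and [Ks], and [eta] after [Kb]. *)
have [K' K'0 K'P] := inv_sqr_small M_ge0 xi8.
pose K := K' ^+ 2; have K0 : 0 < K by exact: exprn_gt0.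
have c1 : 0 <= 2 * (1 + K) + 2 * Ks ^+ 2.
  by rewrite addr_ge0 ?mulr_ge0 ?addr_ge0 ?sqr_ge0// ltW.
have [Kb Kb0 KbP] := inv_sqr_small c1 eps8.
have Cd : 0 <= C * d%:R ^+ 2 by rewrite mulr_ge0 ?sqr_ge0.
have [x1 x1_0 x1P] := mul_small Cd eps8.
have c2 : 0 <= 2 / c0 * (2 * Kb + 2 * Ks).
  by rewrite mulr_ge0 ?divr_ge0 ?addr_ge0 ?mulr_ge0 ?(ltW c0_gt0) ?(ltW Kb0) ?(ltW Ks0).
have [x2 x2_0 x2P] := mul_small c2 delta0.
pose eta := Num.min x1 (Num.min x2 (c0 / 4)).
have eta0 : 0 < eta by rewrite !lt_min x1_0 x2_0 divr_gt0.
have eta1 : eta <= x1 by rewrite ge_min lexx.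
have eta2 : eta <= x2 by rewrite !ge_min lexx orbT.
have eta3 : eta <= c0 / 4 by rewrite !ge_min lexx !orbT.
have eta_c0 : 2 * eta <= c0 / 2 by move: eta3; clear; lra.
have etad : 2 / c0 * (2 * eta * Kb + eta * (2 * Ks)) <= delta.
  by have -> : 2 / c0 * (2 * eta * Kb + eta * (2 * Ks)) = 2 / c0 * (2 * Kb + 2 * Ks) * eta;
    [ring|exact: x2P].
have [N1 N1P] := inv_small (C * (d%:R ^+ 2 * Ks ^+ 2)) eps8.
have cn : 0 <= 8 * (1 + K + Ks ^+ 3) + col_norms L ^+ 3.
  have cL : 0 <= col_norms L ^+ 3.
    by rewrite exprn_ge0// sumr_ge0// => i _; exact: frobenius_ge0.
  have Ks3 : 0 < Ks ^+ 3 by exact: exprn_gt0.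
  by move: cL Ks3 K0; clear; lra.
have [N2 N2P] := inv_sqrt_small (mulr_ge0 C0 cn) eps8.
have [N3 N3P] := inv_small ((2 * K + 2 * eta ^+ 2) / eta ^+ 2) eps8.
have [N4 N4P] := inv_sqrt_small (ler0n _ 2) eps8.
have [N5 N5P] := inv_small (M / eta ^+ 2) xi8.
have [N6 N6P] := inv_small (d%:R ^+ 2 * (2 * M + 2 * (1 + M) ^+ 2) / (eta - eta / 2) ^+ 2) xi8.
have eh : eta / 2 < eta by move: eta0; clear; lra.
(* Half of [eta] is left for the sampling error of the empirical covariance. *)
exists (eta / 2); first by rewrite divr_gt0.
exists (maxn (maxn (maxn N1 N2) (maxn N3 N4)) (maxn N5 N6)) => disp T P n m X y lam s o.
rewrite !geq_max => /andP[/andP[/andP[N1m N2m] /andP[N3m N4m]] /andP[N5m N6m]] reg.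
have m0 : (0 < m)%N by exact: leq_ltn_trans (ltn_ord o).
apply: le_trans (boot_tail m0 (reg_lam reg) (reg_indep reg) (reg_ident reg) (reg_iso reg)
  c0_gt0 (reg_coercive reg) (reg_dH_itg reg) (reg_dH reg) (reg_psi_itg reg) (reg_psi reg)
  (reg_cov reg) eta0 eh Ks0 K0 (eps := eps) (t := t) _) _.
  move=> x g1 g2 g3 g4 g5.
  apply: le_lt_trans (HC n m X y lam (sketch_rows s x) c0 eta Ks Kb K m0 c0_gt0
    (reg_coercive reg) eta0 eta_c0 (ltW Ks0) Kb0 etad g1 g2 g3 g4 g5) _.
  have a1 := x1P eta eta1; have a2 := N1P m N1m; have a3 := N2P m N2m.
  have a4 := N3P m N3m; have a5 := N4P m N4m; move: sd; rewrite -/f => sd'.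
  have -> : C * (d%:R ^+ 2 * (eta + Ks ^+ 2 / m%:R) +
      (8 * (1 + K + Ks ^+ 3) + col_norms L ^+ 3) / Num.sqrt m%:R) =
    C * d%:R ^+ 2 * eta + C * (d%:R ^+ 2 * Ks ^+ 2) / m%:R +
    C * (8 * (1 + K + Ks ^+ 3) + col_norms L ^+ 3) / Num.sqrt m%:R by ring.
  move: a1 a2 a3 a4 a5 KbP sd' eps0; clear; lra.
have := N5P m N5m; rewrite -mulrA -invfM [eta ^+ 2 * _]mulrC => b1.
have := N6P m N6m; rewrite -!mulrA -invfM [(eta - eta / 2) ^+ 2 * _]mulrC => b2.
by move: b1 b2 KsP K'P xi0; rewrite -/K; clear; lra.
Qed.

End Uniform.

(** * Matrix limits and moment bounds from the assumptions *)

Lemma cvg_mx_near (R : realType) p q (M : nat -> 'M[R]_(p, q)) (A : 'M[R]_(p, q)) e :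
  M n @[n --> \oo] --> A -> 0 < e ->
  \forall n \near \oo, forall i j, `|M n i j - A i j| <= e.
Proof.
move=> MA e0; apply: filter_forall => i; apply: filter_forall => j.
have : M n i j @[n --> \oo] --> A i j.
  exact: (cvg_comp _ _ MA (@coord_continuous R p q i j A)).
by move=> /cvgrPdist_le/(_ e e0); apply: filterS => n; rewrite distrC.
Qed.

Lemma limit_psd (R : realType) d (M : nat -> 'M[R]_d) (A : 'M[R]_d) :
  M n @[n --> \oo] --> A ->
  (\forall n \near \oo, (M n)^T = M n /\ forall v, 0 <= quad (M n) v) ->
  A^T = A /\ forall v, 0 <= quad A v.
Proof.
move=> MA Mp.
have near e : 0 < e -> exists B : 'M[R]_d, [/\ B^T = B, forall v, 0 <= quad B v &
    forall i j, `|B i j - A i j| <= e].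
  move=> e0; have [n [[a b] c]] := filter_ex (filterI Mp (cvg_mx_near MA e0)).
  by exists (M n).
split.
  apply/matrixP => i j; rewrite mxE; apply/eqP; rewrite -subr_eq0 -normr_le0.
  apply/ler_addgt0Pr => e e0; rewrite add0r.
  have [|B [Bs _ BA]] := near (e / 2); first by rewrite divr_gt0.
  have := BA i j; have := BA j i; rewrite -{1}Bs mxE => h1 h2.
  have -> : A j i - A i j = (B i j - A i j) - (B i j - A j i) by ring.
  by apply: le_trans (ler_normB _ _) _; move: h1 h2; lra.
move=> v; apply/ler_addgt0Pr => e e0.
pose S := \sum_i \sum_j `|v i 0 * v j 0|.
have S0 : 0 <= S by rewrite sumr_ge0// => i _; rewrite sumr_ge0.
have [x x0 xP] := mul_small S0 e0.
have [B [_ Bp BA]] := near x x0.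
have := Bp v; have -> : B = A + (B - A) by rewrite addrC subrK.
rewrite quadD => H; apply: le_trans H _; rewrite lerD2l.
apply: le_trans (xP x (lexx x)); rewrite /quad /S big_distrl /=; apply: ler_sum => i _.
rewrite big_distrl /=; apply: ler_sum => j _; apply: le_trans (ler_norm _) _.
by rewrite normrM mulrC ler_wpM2l// !mxE; exact: BA.
Qed.

Section Moments.
Context {disp : measure_display} {T : measurableType disp} {R : realType}.
Variables (P : probability T R) (n d : nat) (X : 'M[R]_(n, d)) (y : 'cV[R]_n) (lam : R).
Variables (V : T -> 'cV[R]_n) (c0 Kg M4 : R).
Hypothesis mV : measurable_mx V.
Hypotheses (c0_gt0 : 0 < c0) (cK : coercive c0 (ridgeH X + lam%:M)).
Hypothesis gK : frobenius (ridgeg X y) <= Kg.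

Let psi x := influence X y lam (V x).
Let rest x := frobenius (dH X (V x)) ^+ 4 + frobenius (dg X y (V x)) ^+ 4.
Let Cpsi := 8 * c0^-1 ^+ 4 * (1 + (c0^-1 * Kg) ^+ 4).

Hypothesis rest_E : ('E_P[rest] <= M4%:E)%E.

(** The first summand bounds the fourth moment of the influence vectors, [1 + M4] the second moment
    of [dH]; their sum serves as a single bound for both. *)
Definition moment_bound (c Kg M4 : R) : R :=
  8 * c^-1 ^+ 4 * (1 + (c^-1 * Kg) ^+ 4) * M4 + (1 + M4).

Let mv (_ : 'I_1) : measurable_mx V. Proof. exact: mV. Qed.

Let mpsi : measurable_mx psi.
Proof. exact: (measurable_influence X y lam mv ord0). Qed.

Let mdH : measurable_mx (fun x => dH X (V x)).
Proof.
by apply: measurable_mxB; [exact: (measurable_zz X mv ord0)|exact: measurable_mx_cst].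
Qed.

Let mdg : measurable_mx (fun x => dg X y (V x)).
Proof.
apply: measurable_mxB; last exact: measurable_mx_cst.
by apply: measurable_mxZ; [exact: (measurable_urow y mv ord0)|exact: (measurable_zrow X mv ord0)].
Qed.

Let rest0 x : 0 <= rest x. Proof. by rewrite addr_ge0// exprn_ge0// frobenius_ge0. Qed.

Let restP : itg P rest /\ mean P rest <= M4.
Proof.
have mr : measurable_fun [set: T] rest.
  by apply: measurable_funD; apply: measurable_funX; exact: measurable_frobenius.
have I : itg P rest.
  apply/integrableP; split; first exact/measurable_EFinP.
  under eq_integral do rewrite /= ger0_norm//.
  by move: rest_E; rewrite unlock => /le_lt_trans; apply; exact: ltry.
by split=> //; rewrite -lee_fin EFin_mean//; move: rest_E; rewrite unlock.
Qed.

Let M4_ge0 : 0 <= M4.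
Proof. by apply: le_trans restP.2; exact: mean_ge0. Qed.

Let Cpsi0 : 0 <= Cpsi.
Proof.
have := exprn_even_ge0 (c0^-1 * Kg) (isT : ~~ odd 4).
have ci : 0 <= c0^-1 ^+ 4 by rewrite exprn_ge0// invr_ge0 ltW.
move=> k4; rewrite /Cpsi mulr_ge0//; first by rewrite mulr_ge0.
by rewrite addr_ge0.
Qed.

Lemma moment_bound_ge0 : 0 <= moment_bound c0 Kg M4.
Proof.
by rewrite /moment_bound -/Cpsi; have := mulr_ge0 Cpsi0 M4_ge0; move: M4_ge0; lra.
Qed.

Lemma dH_moment : itg P (fun x => frobenius (dH X (V x)) ^+ 2) /\
  mean P (fun x => frobenius (dH X (V x)) ^+ 2) <= moment_bound c0 Kg M4.
Proof.
have [I E] := restP; have I1 := itgD (itg_cst P 1) I.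
have le x : frobenius (dH X (V x)) ^+ 2 <= 1 + rest x.
  apply: le_trans (pow4_ge (frobenius_ge0 _)).1 _.
  by rewrite lerD2l lerDl exprn_ge0// frobenius_ge0.
have I2 : itg P (fun x => frobenius (dH X (V x)) ^+ 2).
  apply: itg_le I1; first by apply: measurable_funX; exact: measurable_frobenius.
  by move=> x; rewrite ger0_norm ?sqr_ge0.
split=> //; apply: le_trans (ler_mean I2 I1 le) _.
rewrite meanD ?mean_cst//; last exact: itg_cst.
have := mulr_ge0 Cpsi0 M4_ge0; rewrite /moment_bound -/Cpsi; move: E; lra.
Qed.

Lemma psi_moment : itg P (fun x => frobenius (psi x) ^+ 4) /\
  mean P (fun x => frobenius (psi x) ^+ 4) <= moment_bound c0 Kg M4.
Proof.
have [I E] := restP; have I1 := itgZ Cpsi I.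
have le x : frobenius (psi x) ^+ 4 <= Cpsi * rest x.
  exact: influence_pow4.
have I2 : itg P (fun x => frobenius (psi x) ^+ 4).
  apply: itg_le I1; first by apply: measurable_funX; exact: measurable_frobenius.
  by move=> x; rewrite ger0_norm ?exprn_ge0 ?frobenius_ge0.
split=> //; apply: le_trans (ler_mean I2 I1 le) _.
rewrite meanZ//.
have := ler_wpM2l Cpsi0 E; rewrite /moment_bound -/Cpsi; move: M4_ge0; lra.
Qed.

Lemma psi_covE i j : mx_expectation P (fun x => psi x *m (psi x)^T) i j =
  mean P (fun x => psi x i 0 * psi x j 0).
Proof.
rewrite mxE expectation_fine; apply: eq_mean => x.
by rewrite mxE big_ord1 [_^T _ _]mxE.
Qed.

(** The quadratic form is the mean of a square. Passing to the limit makes [Omega] factorizable. *)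
Lemma psi_cov_psd : let C := mx_expectation P (fun x => psi x *m (psi x)^T) in
  C^T = C /\ forall v, 0 <= quad C v.
Proof.
move=> C; split.
  apply/matrixP => i j; rewrite mxE !psi_covE; apply: eq_mean => x.
  by rewrite mulrC.
move=> v; have I i j : itg P (fun x => psi x i 0 * psi x j 0).
  apply: itg_le (itgD (itg_cst P 1) psi_moment.1).
    by apply: measurable_funM; exact: mpsi.
  move=> x; rewrite normrM; apply: le_trans (pow4_ge (frobenius_ge0 _)).1.
  by rewrite expr2 ler_pM//; exact: ler_entry_frobenius.
have Ij i : itg P (fun x => \sum_j psi x i 0 * psi x j 0 * (v i 0 * v j 0)).
  by apply: itg_sum => j; under eq_fun do rewrite mulrC; exact: itgZ.
have -> : quad C v = mean P (fun x => \sum_i \sum_j psi x i 0 * psi x j 0 * (v i 0 * v j 0)).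
  rewrite mean_sum//; apply: eq_bigr => i _; rewrite mean_sum; last first.
    by move=> j; under eq_fun do rewrite mulrC; exact: itgZ.
  apply: eq_bigr => j _; rewrite psi_covE mulrC -meanZ//.
  by apply: eq_mean => x; rewrite mulrC.
apply: mean_ge0 => x.
have -> : \sum_i \sum_j psi x i 0 * psi x j 0 * (v i 0 * v j 0) = dot v (psi x) ^+ 2.
  rewrite expr2 /dot big_distrl /=; apply: eq_bigr => i _; rewrite big_distrr /=.
  by apply: eq_bigr => j _; ring.
exact: sqr_ge0.
Qed.

End Moments.

(** * Convergence of the conditional and empirical bootstrap laws *)

Theorem corollary1 (R : realType) (d : nat) (d_gt0 : (0 < d)%N)
  (m : nat -> nat) (m_gt0 : forall n, (0 < m n)%N)
  (m_oo : m n @[n --> \oo] --> \oo)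
  (B : nat -> nat) (B_gt0 : forall n, (0 < B n)%N)
  (X : forall n, 'M[R]_(n, d)) (y : forall n, 'cV[R]_n)
  (lam : nat -> R) (lam_gt0 : forall n, (0 < n)%N -> 0 < lam n)
  (disp : nat -> measure_display) (T : forall n, measurableType (disp n))
  (P : forall n, probability (T n) R)
  (s : forall n, 'I_(m n) -> {RV (P n) >-> n.-tuple R})
  (w : forall n, 'I_(B n) -> {RV (P n) >-> (m n).-tuple nat})
  (w_boot : forall n, (0 < n)%N ->
    bootstrap_weights (P n) (g_sigma_preimage (fun i => s n i)) (w n))
  (* the conditional law, given the sketch, of the scaled bootstrap error *)
  (kappa : forall n, R.-pker (T n) ~> R)
  (kappa_cond : forall n, (0 < n)%N ->
    is_cond_distribution (P n) (g_sigma_preimage (fun i => s n i))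
      (fun x => boot_err (X n) (y n) (lam n) (fun i => cvec (s n i x))
                  (w n (Ordinal (B_gt0 n)) x))
      (kappa n))
  (* (i) *)
  (lam_oo : R) (lam_oo_ge0 : 0 <= lam_oo) (lam_cvg : lam n @[n --> \oo] --> lam_oo)
  (H : 'M[R]_d) (H_cvg : ridgeH (X n) @[n --> \oo] --> H)
  (g : 'cV[R]_d) (g_cvg : ridgeg (X n) (y n) @[n --> \oo] --> g)
  (c0 : R) (c0_gt0 : 0 < c0)
  (c0_le : \forall n \near \oo, c0 <= lambda_min (ridgeH (X n) + (lam n)%:M))
  (* (ii) *)
  (s_indep : forall n, (0 < n)%N -> mutually_independent (P n) (s n))
  (s_ident : forall n, (0 < n)%N -> identically_distributed (P n) (s n))
  (s_iso : forall n, (0 < n)%N ->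
    mx_expectation (P n) (fun x => let v := cvec (s n (Ordinal (m_gt0 n)) x) in
                                   v *m v^T) = 1%:M)
  (s_moment : (ereal_sup
    [set 'E_(P n)[fun x =>
        let v := cvec (s n (Ordinal (m_gt0 n)) x) in
        let z := zrow (X n) v in
        let u := urow (y n) v in
        (frobenius (z *m z^T - ridgeH (X n)) ^+ 4
         + frobenius (u *: z - ridgeg (X n) (y n)) ^+ 4)%R]
      | n in [set n | (0 < n)%N]] < +oo)%E)
  (Omega : 'M[R]_d)
  (Omega_cvg : mx_expectation (P n) (fun x =>
      let psi := influence (X n) (y n) (lam n)
                   (cvec (s n (Ordinal (m_gt0 n)) x)) in
      psi *m psi^T) @[n --> \oo] --> Omega)
  (* (iii) *)
  (Omega_rank : (1 <= \rank Omega)%N) :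
  cvg_in_prob P (fun n x =>
    sup_dist (cdf_sketch (P n) (X n) (y n) (lam n) (s n))
             (fun t => fine (kappa n x `]-oo, t]%classic))) 0
  /\
  (B n @[n --> \oo] --> \oo ->
   cvg_in_prob P (fun n x =>
     sup_dist (cdf_sketch (P n) (X n) (y n) (lam n) (s n))
              (cdf_boot_emp (X n) (y n) (lam n) (s n) (w n) x)) 0).
Proof.
pose o n := Ordinal (m_gt0 n).
have mV n : measurable_mx (fun x => cvec (s n (o n) x)).
  move=> j k; rewrite /cvec; under eq_fun do rewrite mxE.
  by apply: (measurableT_comp (measurable_tnth j)); exact: measurable_funPT.
have n_pos : \forall n \near \oo, (0 < n)%N by exact: near_pos.
have m_big N : \forall n \near \oo, (N <= m n)%N by exact: (m_oo _ (nbhs_infty_ge N)).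
have [M4 M4P] : exists M4 : R, forall n, (0 < n)%N -> ('E_(P n)[fun x =>
    (frobenius (dH (X n) (cvec (s n (o n) x))) ^+ 4 +
     frobenius (dg (X n) (y n) (cvec (s n (o n) x))) ^+ 4)%R] <= M4%:E)%E.
  move: s_moment; set S := ereal_sup _ => S_fin; exists (fine S) => n n0.
  have le : ('E_(P n)[fun x =>
      (frobenius (dH (X n) (cvec (s n (o n) x))) ^+ 4 +
       frobenius (dg (X n) (y n) (cvec (s n (o n) x))) ^+ 4)%R] <= S)%E.
    by apply: ereal_sup_ubound; exists n.
  apply: le_trans le _; move: S_fin; case: S => [r||] //= _.
  exact: leNye.
have [Kg gK] : exists Kg : R, \forall n \near \oo, frobenius (ridgeg (X n) (y n)) <= Kg.
  exists (\sum_i \sum_j (`|g i j| + 1)); have := cvg_mx_near g_cvg ltr01.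
  apply: filterS => n gn; apply: le_trans (frobenius_le_sum _) _.
  apply: ler_sum => i _; apply: ler_sum => j _; have := gn i j.
  by have := ler_normD (ridgeg (X n) (y n) i j - g i j) (g i j); rewrite subrK; lra.
have coer : \forall n \near \oo, coercive c0 (ridgeH (X n) + (lam n)%:M).
  near=> n; apply: lambda_min_coercive => //; first exact: ridgeK_sym.
    have n0 : (0 < n)%N by near: n.
    by move=> v; rewrite quadD quad_scalar addr_ge0 ?ridgeH_psd// mulr_ge0 ?sqr_ge0// ltW// lam_gt0.
  by near: n.
have base : \forall n \near \oo, [/\ (0 < n)%N, coercive c0 (ridgeH (X n) + (lam n)%:M) &
    frobenius (ridgeg (X n) (y n)) <= Kg] by near=> n; split; near: n.
have [Os Op] : Omega^T = Omega /\ forall v, 0 <= quad Omega v.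
  apply: (limit_psd Omega_cvg); apply: filterS base => n [n0 cK gKn].
  exact: (psi_cov_psd (mV n) c0_gt0 cK gKn (M4P n n0)).
have [L OL] := psd_factor Os Op.
(* Positive rank of [Omega] excludes [L = 0]; the column found here feeds the anti-concentration
   bound. *)
have [k0 L0] : exists k0, col k0 L != 0.
  apply: contrapT => nL; have L0 : L = 0.
    apply/matrixP => i k; rewrite [RHS]mxE; have [Lk|Lk] := eqVneq (col k L) 0.
      by have := congr1 (fun v : 'cV[R]_d => v i 0) Lk; rewrite !mxE.
    by case: nL; exists k.
  by move: Omega_rank; rewrite OL L0 mul0mx mxrank0.
pose M := moment_bound c0 Kg M4.
have M0 : 0 <= M.
  have [n [n0 cK gKn]] := filter_ex base.
  exact: (moment_bound_ge0 Kg (mV n) c0_gt0 (M4P n n0)).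
have reg e : 0 < e -> \forall n \near \oo,
    regular (P n) (X n) (y n) (lam n) (s n) (o n) L c0 M e.
  move=> e0; have Oe := cvg_mx_near Omega_cvg e0.
  near=> n; have [n0 cK gKn] : [/\ (0 < n)%N, coercive c0 (ridgeH (X n) + (lam n)%:M) &
    frobenius (ridgeg (X n) (y n)) <= Kg] by near: n.
  have [I2 E2] := dH_moment Kg (mV n) c0_gt0 (M4P n n0).
  have [I4 E4] := psi_moment (mV n) c0_gt0 cK gKn (M4P n n0).
  split => //; [exact: lam_gt0|exact: s_indep|exact: s_ident|exact: s_iso|].
  move=> i j; rewrite -OL -psi_covE; move: i j; near: n; exact: Oe.
(* The comparison function shared by the sketch and both bootstrap laws. *)
pose Q n := walk_cdf L (m n).
have FQ t e : 0 < t -> 0 < e -> \forall n \near \oo,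
    `|cdf_sketch (P n) (X n) (y n) (lam n) (s n) t - Q n t| <= e.
  move=> t0 e0; have [e' e'0 [N NP]] := sketch_limit L0 c0_gt0 M0 t0 e0.
  near=> n; apply: (NP _ _ _ _ _ _ _ _ _ (o n)); first by near: n; exact: m_big.
  by near: n; exact: reg.
have BQ t e xi : 0 < t -> 0 < e -> 0 < xi -> \forall n \near \oo,
    Pr (P n) [set x | e <= `|boot_cdf (X n) (y n) (lam n) (sketch_rows (s n) x) t - Q n t|] <= xi.
  move=> t0 e0 xi0; have [e' e'0 [N NP]] := boot_limit L0 c0_gt0 M0 t0 e0 xi0.
  near=> n; apply: (NP _ _ _ _ _ _ _ _ _ (o n)); first by near: n; exact: m_big.
  by near: n; exact: reg.
(* Both conclusions reduce to closeness of [G] to [boot_cdf] at each level: closeness of [boot_cdf]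
   to [Q] is already known, and the triangle inequality with halves of [e] and [xi] combines the
   two. *)
have common (G : forall n, T n -> R -> R) :
    (forall n x, (0 < n)%N -> cdf_like (G n x)) ->
    (forall n t, (0 < n)%N -> measurable_fun setT (fun x => G n x t)) ->
    (forall t e xi, 0 < e -> 0 < xi -> \forall n \near \oo,
      Pr (P n) [set x | e <= `|boot_cdf (X n) (y n) (lam n) (sketch_rows (s n) x) t - G n x t|]
      <= xi) ->
    cvg_in_prob P (fun n x =>
      sup_dist (cdf_sketch (P n) (X n) (y n) (lam n) (s n)) (G n x)) 0.
  move=> cG mG GB; apply: (@sup_dist_cvg_in_prob _ _ _ _ _ _ Q) => //.
  - move=> n n0; apply: cdf_like_measure; first exact: probability_setT.
    by apply: measurable_sketch_err; [exact: lam_gt0|move=> i; exact: measurable_sketch_rows].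
  - move=> t e xi t0 e0 xi0.
    have e2 : 0 < e / 2 by rewrite divr_gt0.
    have xi2 : 0 < xi / 2 by rewrite divr_gt0.
    have h1 := BQ t _ _ t0 e2 xi2; have h2 := GB t _ _ e2 xi2.
    near=> n; have n0 : (0 < n)%N by near: n.
    have mb : measurable_fun setT (fun x => boot_cdf (X n) (y n) (lam n) (sketch_rows (s n) x) t).
      by apply: measurable_boot_cdf; [exact: lam_gt0|move=> i; exact: measurable_sketch_rows].
    have mA : measurable [set x | e / 2 <=
        `|boot_cdf (X n) (y n) (lam n) (sketch_rows (s n) x) t - Q n t|].
      apply: measurable_set_le; first exact: measurable_cst.
      by apply: measurableT_comp => //; apply: measurable_funB => //; exact: measurable_cst.
    have mB : measurable [set x | e / 2 <=
        `|boot_cdf (X n) (y n) (lam n) (sketch_rows (s n) x) t - G n x t|].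
      apply: measurable_set_le; first exact: measurable_cst.
      by apply: measurableT_comp => //; apply: measurable_funB => //; exact: mG.
    have mC : measurable [set x | e <= `|G n x t - Q n t|].
      apply: measurable_set_le; first exact: measurable_cst.
      by apply: measurableT_comp => //; apply: measurable_funB; [exact: mG|exact: measurable_cst].
    have p1 : Pr (P n) [set x | e / 2 <=
        `|boot_cdf (X n) (y n) (lam n) (sketch_rows (s n) x) t - Q n t|] <= xi / 2 by near: n.
    have p2 : Pr (P n) [set x | e / 2 <=
        `|boot_cdf (X n) (y n) (lam n) (sketch_rows (s n) x) t - G n x t|] <= xi / 2 by near: n.
    have := PrU_le (P n) mA mB.
    suff : Pr (P n) [set x | e <= `|G n x t - Q n t|] <=
        Pr (P n) ([set x | e / 2 <=
          `|boot_cdf (X n) (y n) (lam n) (sketch_rows (s n) x) t - Q n t|] `|`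
          [set x | e / 2 <=
          `|boot_cdf (X n) (y n) (lam n) (sketch_rows (s n) x) t - G n x t|]).
      by move: p1 p2; clear; lra.
    apply: le_Pr => //; first exact: measurableU.
    move=> x /= Hx; set b := boot_cdf _ _ _ _ _.
    have [h|h] := leP (e / 2) `|b - Q n t|; [by left|right].
    have := ler_normB (b - Q n t) (b - G n x t).
    rewrite (_ : b - Q n t - (b - G n x t) = G n x t - Q n t); last by ring.
    by move: Hx h; clear; lra.
  - move=> e e0; have [N [t [t0 [N' N'P]]]] := walk_grid L0 e0.
    by exists N, t; split => //; near=> n; apply: N'P; near: n; exact: m_big.
split.
  apply: common.
  - move=> n x n0; apply: (cdf_like_measure (mu := kappa n x) (Y := id)) => //.
    exact: prob_kernel.
  - move=> n t n0; apply: (measurableT_comp (f := fine)); first exact: fine_measurable.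
    exact: measurable_kernel.
  - move=> t e xi e0 xi0; apply: near_pos => n n0.
    (* The given conditional law agrees with [boot_cdf] almost surely at each level, so this
       probability is zero for every positive [n]. *)
    rewrite (boot_cond_law (m_gt0 n) (lam_gt0 n n0)
      (fun b => @measurable_funPT _ _ _ _ (w n b)) (w_boot n n0) t e0 (kappa_cond n n0)) ltW//.
move=> B_oo; apply: common.
- move=> n x n0.
  have := @cdf_like_avg R 'I_(B n) (fun b => boot_err (X n) (y n) (lam n)
    (fun i => cvec (s n i x)) (w n b x)).
  by rewrite card_ord /avg card_ord; apply; exact: B_gt0.
- move=> n t n0.
  by have [] := boot_emp_law (X n) (y n) (m_gt0 n) (lam_gt0 n n0)
    (fun b => @measurable_funPT _ _ _ _ (w n b)) (w_boot n n0) t (B_gt0 n) ltr01.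
- move=> t e xi e0 xi0.
  (* Only here does the growth of [B n] enter: Chebyshev's bound is [e ^- 2] divided by the number
     of draws. *)
  have [N NP] := inv_small (e ^- 2) xi0.
  have BN : \forall n \near \oo, (N <= B n)%N by exact: (B_oo _ (nbhs_infty_ge N)).
  near=> n; have n0 : (0 < n)%N by near: n.
  have [_ h] := boot_emp_law (X n) (y n) (m_gt0 n) (lam_gt0 n n0)
    (fun b => @measurable_funPT _ _ _ _ (w n b)) (w_boot n n0) t (B_gt0 n) e0.
  apply: le_trans h _; rewrite invfM mulrC; apply: NP; near: n; exact: BN.
Unshelve. all: by end_near. Qed.
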